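(* Let $(B,g_B)$ be a nondegenerate semi-Riemannian manifold, $(F_j,g_{F_j})$, $1\le j\le l$, semi-regular semi-Riemannian manifolds, and $f_j\in C^\infty(B)$. Consider the multiply warped product $B\times F_1\times\cdots\times F_l$ with warping functions $f_1,\dots,f_l$ and its Riemann curvature $R$. Let $X,Y,Z,T\in\Gamma(TB)$ and $U_j,V_j,W_j,Q_j\in\Gamma(TF_j)$ (lifted), $1\le j\le l$. Then: (1) $R(X,Y,Z,T)=R_B(X,Y,Z,T)$; (2) $R(X,Y,Z,Q_j)=R(X,Y,W_j,Q_j)=0$; (3) $R(X,V_j,W_j,T)=-f_jH^{f_j}(X,T)g_{F_j}(V_j,W_j)$; (4) $R(X,Y,W_j,Q_k)=R(X,V_j,W_k,T)=R(X,V_j,W_k,Q_j)=R(X,W_k,V_j,Q_j)=0$ for $j\ne k$; (5) $R(U_j,V_j,Z,Q_j)=0$; (6) $R(X,W_k,V_j,Q_\alpha)=0$ for $k,j,\alpha$ pairwise different; (7) $R(U_j,V_j,W_j,Q_j)=f_j^2R_{F_j}(U_j,V_j,W_j,Q_j)+f_j^2g_B^*(df_j,df_j)\big[g_{F_j}(U_j,W_j)g_{F_j}(V_j,Q_j)-g_{F_j}(V_j,W_j)g_{F_j}(U_j,Q_j)\big]$; (8) $R(U_k,V_j,W_j,Q_j)=R(U_k,V_k,W_j,Q_j)=0$ for $j\ne k$; (9) $R(U_k,V_j,W_k,Q_j)=f_kf_jg_B^*(df_k,df_j)g_{F_k}(U_k,W_k)g_{F_j}(V_j,Q_j)$ for $j\ne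 k$; (10) $R(U_j,V_j,W_k,Q_\alpha)=R(U_j,V_k,W_j,Q_\alpha)=0$ for $k,j,\alpha$ pairwise different; (11) $R(U_j,V_k,W_\alpha,Q_\beta)=0$ for $k,j,\alpha,\beta$ pairwise different.
   Context: A singular semi-Riemannian manifold $(M,g)$ is a smooth manifold with a smooth symmetric $(0,2)$-tensor field $g=\langle\cdot,\cdot\rangle$, possibly degenerate and of varying signature. Its Koszul form is $\mathcal K(X,Y,Z)=\tfrac12\{X\langle Y,Z\rangle+Y\langle Z,X\rangle-Z\langle X,Y\rangle-\langle X,[Y,Z]\rangle+\langle Y,[Z,X]\rangle+\langle Z,[X,Y]\rangle\}$, and $\nabla^\flat_XY:=\mathcal K(X,Y,\cdot)$. $\mathcal A^\bullet(M)$ is the set of smooth 1-forms $\omega$ such that for each $p$ there is $u\in T_pM$ with $\omega_p=\langle u,\cdot\rangle$. For covectors $\omega_p=\langle u,\cdot\rangle$, $\tau_p=\langle v,\cdot\rangle$ put $\langle\langle\omega,\tau\rangle\rangle_\bullet=\langle u,v\rangle$. If $\nabla^\flat_XY\in\mathcal A^\bullet(M)$ for all $X,Y$, then for $\omega\in\mathcal A^\bullet(M)$ one sets $(\nabla_X\omega)(Y)=X(\omega(Y))-\langle\langle\nabla^\flat_XY,\omega\rangle\rangle_\bullet$, smooth on the regions of constant signature (an open dense set); elsewhere values are understood by smooth extension when it exists. $(M,g)$ is semi-regular if $\nabla^\flat_XY\in\mathcal A^\bullet(M)$ and $\nabla_Z(\nabla^\flat_XY)\in\mathcal A^\bullet(M)$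 for all $X,Y,Z$. On a semi-regular manifold the Riemann curvature is $R(X,Y,Z,T)=(\nabla_X\nabla^\flat_YZ)(T)-(\nabla_Y\nabla^\flat_XZ)(T)-(\nabla^\flat_{[X,Y]}Z)(T)$. The multiply warped product is $B\times F_1\times\cdots\times F_l$ with the metric $\pi_B^*(g_B)+\sum_{j=1}^l(f_j\circ\pi_B)^2\pi_{F_j}^*(g_{F_j})$, where $\pi_B$, $\pi_{F_j}$ are the projections; the $f_j$ may have zeros, and when $(B,g_B)$ is a nondegenerate semi-Riemannian manifold, the $(F_j,g_{F_j})$, $1\le j\le l$, are semi-regular semi-Riemannian manifolds and $f_j\in C^\infty(B)$, it is semi-regular. Objects on the factors are identified with their lifts; $R_B$, $R_{F_j}$ are the curvatures of the factors. $g_B^*$ is the inner product induced by $g_B$ on 1-forms, and $H^{f_j}(X,T)=X(T(f_j))-(\nabla^B_XT)(f_j)$ is the Hessian of $f_j$, with $\nabla^B$ the Levi-Civita connection of $g_B$. *)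

(* Defs.v *)
From HB Require Import structures.
From mathcomp Require Import all_boot all_order all_algebra.
From mathcomp Require Import all_classical all_reals all_analysis.

Set Implicit Arguments.
Unset Strict Implicit.
Unset Printing Implicit Defensive.

Import Order.TTheory GRing.Theory Num.Theory.
Import numFieldNormedType.Exports.

Local Open Scope classical_set_scope.
Local Open Scope ring_scope.

(** [ck_on k U f]: on the open set [U], [f] has continuous partial derivatives
    up to order [k]. *)
Fixpoint ck_on (R : realType) (n k : nat) (U : set 'rV[R]_n)
    (f : 'rV[R]_n -> R) : Prop :=
  (forall x, U x -> {for x, continuous f}) /\
  match k with
  | 0 => True
  | k'.+1 => forall i : 'I_n,
      (forall x, U x -> derivable f x (delta_mx 0 i)) /\
      ck_on k' U ('D_(delta_mx 0 i) f)
  end.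

Definition smooth_on (R : realType) (n : nat) (U : set 'rV[R]_n)
    (f : 'rV[R]_n -> R) : Prop := forall k, ck_on k U f.

(** [ch_inv] is meaningful only on the image of [ch_dom] under [ch_map]. *)
Record chart (R : realType) (M : Type) (n : nat) := Chart {
  ch_dom : set M;
  ch_map : M -> 'rV[R]_n;
  ch_inv : 'rV[R]_n -> M }.

Definition ch_im (R : realType) (M : Type) (n : nat) (c : chart R M n) :
  set 'rV[R]_n := ch_map c @` ch_dom c.

(** A space with a family of charts; the axioms of a manifold are in
    [is_manifold]. *)
Record charted (R : realType) := Charted {
  carrier :> topologicalType;
  mdim : nat;
  atlas : set (chart R carrier mdim) }.

Record is_manifold (R : realType) (M : charted R) : Prop := IsManifold {
  manifold_hausdorff : hausdorff_space M;
  manifold_second_countable : @second_countable M;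
  atlas_cover : forall p : M, exists2 c, atlas c & ch_dom c p;
  chart_dom_open : forall c : chart R M (mdim M), atlas c -> open (ch_dom c);
  chart_im_open : forall c : chart R M (mdim M), atlas c -> open (ch_im c);
  chart_mapK : forall c : chart R M (mdim M), atlas c ->
    forall p, ch_dom c p -> ch_inv c (ch_map c p) = p;
  chart_map_continuous : forall c : chart R M (mdim M), atlas c ->
    forall p, ch_dom c p -> {for p, continuous (ch_map c)};
  chart_inv_continuous : forall c : chart R M (mdim M), atlas c ->
    forall x, ch_im c x -> {for x, continuous (ch_inv c)};
  chart_transition : forall c d : chart R M (mdim M), atlas c -> atlas d ->
    forall i, smooth_on (ch_map c @` (ch_dom c `&` ch_dom d))
                        (fun x => ch_map d (ch_inv c x) 0 i) }.

Definition smooth (R : realType) (M : charted R) (f : M -> R) : Prop :=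
  forall c : chart R M (mdim M), atlas c ->
    smooth_on (ch_im c) (fun x => f (ch_inv c x)).

(** A tangent vector at [p] is an operator [v = \sum_i a_i (d/dx^i)_p] on
    C^oo(M).  Operators are total on [M -> R]; the value 0 prescribed on
    non-smooth functions makes equality of tangent vectors (and of vector
    fields) mean equality as operators on C^oo(M). *)
Definition tangent (R : realType) (M : charted R) (p : M) (v : (M -> R) -> R) :
  Prop :=
  (exists c : chart R M (mdim M), [/\ atlas c, ch_dom c p &
     exists a : 'rV[R]_(mdim M), forall f, smooth f ->
       v f = \sum_(i < mdim M)
         a 0 i * 'D_(delta_mx 0 i) (fun x => f (ch_inv c x)) (ch_map c p)]) /\
  (forall f, ~ smooth f -> v f = 0).

(** Vector fields are operators on functions, [X f] being the derivative of [f]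
    along [X]; [vat X p] is the tangent vector [X_p]. *)
Definition vat (R : realType) (M : charted R) (X : (M -> R) -> (M -> R))
  (p : M) : (M -> R) -> R := fun f => X f p.

Definition vfield (R : realType) (M : charted R) (X : (M -> R) -> (M -> R)) :
  Prop :=
  (forall p, tangent p (vat X p)) /\ (forall f, smooth f -> smooth (X f)).

Definition vadd (R : realType) (M : charted R) (X Y : (M -> R) -> (M -> R)) :
  (M -> R) -> (M -> R) := fun f p => X f p + Y f p.

Definition vscale (R : realType) (M : charted R) (h : M -> R)
  (X : (M -> R) -> (M -> R)) : (M -> R) -> (M -> R) := fun f p => h p * X f p.

Definition bracket (R : realType) (M : charted R)
  (X Y : (M -> R) -> (M -> R)) : (M -> R) -> (M -> R) :=
  fun f p => X (Y f) p - Y (X f) p.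

(** Smooth 1-forms, as C^oo(M)-linear maps from vector fields to C^oo(M). *)
Definition oneform (R : realType) (M : charted R)
  (w : ((M -> R) -> (M -> R)) -> (M -> R)) : Prop :=
  [/\ forall Y, vfield Y -> smooth (w Y),
      forall Y Z, vfield Y -> vfield Z ->
        forall p, w (vadd Y Z) p = w Y p + w Z p &
      forall h Y, smooth h -> vfield Y ->
        forall p, w (vscale h Y) p = h p * w Y p].

Definition differential (R : realType) (M : charted R) (f : M -> R) :
  ((M -> R) -> (M -> R)) -> (M -> R) := fun X => X f.

Definition pushforward (R : realType) (M N : charted R) (phi : M -> N)
  (v : (M -> R) -> R) : (N -> R) -> R :=
  fun h => if `[< smooth h >] then v (fun p => h (phi p)) else 0.

(** Only the values [g p u v] at tangent vectors [u], [v] at [p] are relevant. *)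
Definition tensor02 (R : realType) (M : charted R) : Type :=
  forall p : M, ((M -> R) -> R) -> ((M -> R) -> R) -> R.

Definition pairing (R : realType) (M : charted R) (g : tensor02 M)
  (X Y : (M -> R) -> (M -> R)) : M -> R := fun p => g p (vat X p) (vat Y p).

Record singular_metric (R : realType) (M : charted R) (g : tensor02 M) : Prop :=
  SingularMetric {
  metric_sym : forall p u v, tangent p u -> tangent p v -> g p u v = g p v u;
  metric_linear : forall p (a : R) u v w,
    tangent p u -> tangent p v -> tangent p w ->
    g p (fun f => a * u f + v f) w = a * g p u w + g p v w;
  metric_smooth : forall X Y, vfield X -> vfield Y -> smooth (pairing g X Y) }.

Definition nondegenerate_metric (R : realType) (M : charted R) (g : tensor02 M) : Prop :=
  forall p u, tangent p u -> (forall v, tangent p v -> g p u v = 0) ->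
  u = (fun _ => 0).

Definition tangent_basis (R : realType) (M : charted R) (p : M)
  (e : 'I_(mdim M) -> (M -> R) -> R) : Prop :=
  (forall i, tangent p (e i)) /\
  (forall v, tangent p v ->
     exists! a : 'rV[R]_(mdim M), v = fun f => \sum_(i < mdim M) a 0 i * e i f).

(** [g p] has exactly [r] plus and [s] minus signs in some (equivalently, by
    Sylvester, every) orthogonal basis; the number of zeros is then
    [mdim M - r - s]. *)
Definition has_signature (R : realType) (M : charted R) (g : tensor02 M) (p : M)
  (r s : nat) : Prop :=
  exists e : 'I_(mdim M) -> (M -> R) -> R,
  [/\ tangent_basis p e,
      forall i j, i != j -> g p (e i) (e j) = 0,
      #|[pred i | 0 < g p (e i) (e i)]| = r &
      #|[pred i | g p (e i) (e i) < 0]| = s].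

(** The (open) union of the regions of constant signature. *)
Definition regular_point (R : realType) (M : charted R) (g : tensor02 M) :
  set M :=
  [set p | exists r s : nat, \forall q \near p, has_signature g q r s].

Definition koszul (R : realType) (M : charted R) (g : tensor02 M)
  (X Y Z : (M -> R) -> (M -> R)) : M -> R := fun p =>
  2^-1 * (X (pairing g Y Z) p + Y (pairing g Z X) p - Z (pairing g X Y) p
          - pairing g X (bracket Y Z) p + pairing g Y (bracket Z X) p
          + pairing g Z (bracket X Y) p).

Definition nabla_flat (R : realType) (M : charted R) (g : tensor02 M)
  (X Y : (M -> R) -> (M -> R)) : ((M -> R) -> (M -> R)) -> (M -> R) :=
  koszul g X Y.

(** [w_p = <u, .>] *)
Definition represents (R : realType) (M : charted R) (g : tensor02 M) (p : M)
  (u : (M -> R) -> R) (w : ((M -> R) -> (M -> R)) -> (M -> R)) : Prop :=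
  tangent p u /\ forall Y, vfield Y -> w Y p = g p u (vat Y p).

Definition Abullet (R : realType) (M : charted R) (g : tensor02 M)
  (w : ((M -> R) -> (M -> R)) -> (M -> R)) : Prop :=
  oneform w /\ forall p, exists u, represents g p u w.

(** Independent of the chosen representatives when [g] is symmetric; 0 if
    [w_p] or [t_p] has no representative. *)
Definition bullet (R : realType) (M : charted R) (g : tensor02 M)
  (w t : ((M -> R) -> (M -> R)) -> (M -> R)) : M -> R := fun p =>
  xget 0 [set r | exists u v,
    [/\ represents g p u w, represents g p v t & r = g p u v]].

Definition lower_cov_raw (R : realType) (M : charted R) (g : tensor02 M)
  (X : (M -> R) -> (M -> R)) (w : ((M -> R) -> (M -> R)) -> (M -> R))
  (Y : (M -> R) -> (M -> R)) : M -> R := fun p =>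
  X (w Y) p - bullet g (nabla_flat g X Y) w p.

(** [(nabla_X w)(Y)]: the smooth extension of [lower_cov_raw] from the regions
    of constant signature (unique, as these are dense).  If there is no such
    extension, [lower_cov_raw] itself, which is then not smooth, so that
    [nabla_X w] is not a smooth 1-form. *)
Definition lower_cov (R : realType) (M : charted R) (g : tensor02 M)
  (X : (M -> R) -> (M -> R)) (w : ((M -> R) -> (M -> R)) -> (M -> R)) :
  ((M -> R) -> (M -> R)) -> (M -> R) := fun Y =>
  xget (lower_cov_raw g X w Y)
    [set h | smooth h /\
             forall p, regular_point g p -> h p = lower_cov_raw g X w Y p].

Record semi_regular (R : realType) (M : charted R) (g : tensor02 M) : Prop :=
  SemiRegular {
  semi_regular_flat : forall X Y, vfield X -> vfield Y ->
    Abullet g (nabla_flat g X Y);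
  semi_regular_cov : forall X Y Z, vfield X -> vfield Y -> vfield Z ->
    Abullet g (lower_cov g Z (nabla_flat g X Y)) }.

Definition riemann (R : realType) (M : charted R) (g : tensor02 M)
  (X Y Z T : (M -> R) -> (M -> R)) : M -> R := fun p =>
  lower_cov g X (nabla_flat g Y Z) T p - lower_cov g Y (nabla_flat g X Z) T p
  - nabla_flat g (bracket X Y) Z T p.

Record levi_civita (R : realType) (M : charted R) (g : tensor02 M)
  (D : ((M -> R) -> (M -> R)) -> ((M -> R) -> (M -> R)) ->
       ((M -> R) -> (M -> R))) : Prop := LeviCivita {
  lc_vfield : forall X Y, vfield X -> vfield Y -> vfield (D X Y);
  lc_addl : forall X Y Z, vfield X -> vfield Y -> vfield Z ->
    D (vadd X Y) Z = vadd (D X Z) (D Y Z);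
  lc_scalel : forall h X Y, smooth h -> vfield X -> vfield Y ->
    D (vscale h X) Y = vscale h (D X Y);
  lc_addr : forall X Y Z, vfield X -> vfield Y -> vfield Z ->
    D X (vadd Y Z) = vadd (D X Y) (D X Z);
  lc_leibniz : forall h X Y, smooth h -> vfield X -> vfield Y ->
    D X (vscale h Y) = vadd (vscale (X h) Y) (vscale h (D X Y));
  lc_torsion_free : forall X Y, vfield X -> vfield Y ->
    forall f p, D X Y f p - D Y X f p = bracket X Y f p;
  lc_metric : forall X Y Z, vfield X -> vfield Y -> vfield Z ->
    forall p, X (pairing g Y Z) p =
              pairing g (D X Y) Z p + pairing g Y (D X Z) p }.

Definition hessian (R : realType) (M : charted R)
  (D : ((M -> R) -> (M -> R)) -> ((M -> R) -> (M -> R)) ->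
       ((M -> R) -> (M -> R)))
  (f : M -> R) (X T : (M -> R) -> (M -> R)) : M -> R := fun p =>
  X (T f) p - D X T f p.

Definition prod_chart (R : realType) (l : nat) (B : charted R)
  (F : 'I_l -> charted R) (c : chart R B (mdim B))
  (d : forall j, chart R (F j) (mdim (F j))) :
  chart R (B * prod_topology (fun j => F j))
    (mdim B + \sum_(j < l) mdim (F j)) :=
  Chart
    [set p | ch_dom c p.1 /\ forall j, ch_dom (d j) (p.2 j)]
    (fun p => row_mx (ch_map c p.1) (\mxrow_(j < l) ch_map (d j) (p.2 j)))
    (fun x => (ch_inv c (lsubmx x),
               fun j => ch_inv (d j) (submxrow (rsubmx x) j))).

Definition prod_manifold (R : realType) (l : nat) (B : charted R)
  (F : 'I_l -> charted R) : charted R :=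
  @Charted R (B * prod_topology (fun j => F j))%type
    (mdim B + \sum_(j < l) mdim (F j))
    [set e | exists c d,
       [/\ atlas c, forall j, atlas (d j) & e = prod_chart c d]].

Definition prB (R : realType) (l : nat) (B : charted R) (F : 'I_l -> charted R)
  (p : prod_manifold B F) : B := p.1.

Definition prF (R : realType) (l : nat) (B : charted R) (F : 'I_l -> charted R)
  (j : 'I_l) (p : prod_manifold B F) : F j := p.2 j.

Definition warped_metric (R : realType) (l : nat) (B : charted R)
  (F : 'I_l -> charted R) (gB : tensor02 B) (gF : forall j, tensor02 (F j))
  (f : 'I_l -> B -> R) : tensor02 (prod_manifold B F) := fun p u v =>
  gB (prB p) (pushforward (@prB R l B F) u) (pushforward (@prB R l B F) v) +
  \sum_(j < l) f j (prB p) ^+ 2 *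
    gF j (prF j p) (pushforward (@prF R l B F j) u)
                   (pushforward (@prF R l B F j) v).

(** Lifts: differentiate in the variable of one factor, the others being
    frozen, i.e. [(X~ h)(b, q) = X(h(., q))(b)]. *)
Definition liftB (R : realType) (l : nat) (B : charted R)
  (F : 'I_l -> charted R) (X : (B -> R) -> (B -> R)) :
  (prod_manifold B F -> R) -> (prod_manifold B F -> R) := fun h p =>
  if `[< smooth h >] then X (fun b => h (b, p.2)) p.1 else 0.

Definition liftF (R : realType) (l : nat) (B : charted R)
  (F : 'I_l -> charted R) (j : 'I_l) (V : (F j -> R) -> (F j -> R)) :
  (prod_manifold B F -> R) -> (prod_manifold B F -> R) := fun h p =>
  if `[< smooth h >]
  then V (fun y : F j => h (p.1, @dfwith _ (fun k => F k : Type) p.2 j y))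
         (p.2 j)
  else 0.

(* Main.v *)
(** Lifts of fields from the factors are special cases of fields
    E = X + V_1 + ... + V_l with X on B and V_j on F_j ([jfield X V]), so all the
    formulas are specializations of a single expression for R(E1,E2,E3,E4).

    The Koszul form of such fields is explicit, and K(E,E',.) is represented by
    D_X X' - \sum_j f_j g_{F_j}(V_j,V'_j) grad f_j on B together with
    u_j + (X f_j / f_j) V'_j + (X' f_j / f_j) V_j on F_j, where u_j represents
    K_{F_j}(V_j,V'_j,.).  This gives nabla_{E1} nabla^b_{E2} E3 where the
    signature is locally constant, and the result is the restriction of an
    expression that is smooth everywhere: by additivity of the signature over
    the factors with f_j <> 0 and its lower semicontinuity, at such a point F_j
    has locally constant signature if f_j <> 0, whereas if f_j = 0 then df_j = 0
    or g_{F_j} = 0, so that the products of two derivatives of f_j with g_{F_j},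
    on which the two expressions differ, vanish.  Since the points of locally
    constant signature are dense, the covariant derivative is this expression
    everywhere, and R follows by antisymmetrization. *)

Require Import Defs.
From mathcomp Require Import all_boot all_order all_algebra.
From mathcomp Require Import all_classical all_reals all_analysis.
From mathcomp Require Import ring lra.
Import Order.TTheory GRing.Theory Num.Theory.
Import numFieldNormedType.Exports.

Set Implicit Arguments.
Unset Strict Implicit.
Unset Printing Implicit Defensive.

Local Open Scope classical_set_scope.
Local Open Scope ring_scope.

(** A representative of a 1-form has to be tested against every vector field of the product, and
    such a field need not be a sum of lifts. The Koszul form is therefore computed with an arbitrary
    third argument, expanded in frames of the factors with coefficients that are functions on the
    whole product. Fields being operators on globally smooth functions, frames and fields through a
    given tangent vector must be global: cut-off functions provide them, and the symmetry of second
    derivatives makes brackets into fields. At a zero of f_j the quotients X f_j / f_j are read as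
    0; the vector obtained still represents the Koszul form, because f_j^2 g_{F_j} vanishes there,
    but the raw covariant derivative may then miss the smooth expression, which is where the
    signature enters. Density of the points of locally constant signature is deduced from the
    factors: on a smaller open set of B every f_j is nowhere zero or identically zero, and the
    signature of the product is a weighted sum of signatures of the factors. *)

Local Notation pushforward := Defs.pushforward.
Local Notation zero_field := (fun=> fun=> 0).

(** * Functions of class C^k on open subsets of R^n *)

Section Ck.
Context {R : realType}.

Lemma near_eq_continuous (T S : topologicalType) (f g : T -> S) x :
  (\near x, f x = g x) -> {for x, continuous f} -> {for x, continuous g}.
Proof.
move=> fg cf; rewrite /prop_for /continuous_at -(nbhs_singleton fg).
apply: cvg_trans cf; apply: near_eq_cvg.
by apply: filterS fg => y ->.
Qed.

(** Openness turns equality on [U] into equality of germs, which is all that continuity and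
    directional derivatives see. *)
Lemma ck_on_ext n k (U : set 'rV[R]_n) f g : open U ->
  (forall x, U x -> f x = g x) -> ck_on k U f -> ck_on k U g.
Proof.
move=> oU; elim: k f g => [|k IH] f g fg /= [cf df].
  have nfg x : U x -> \near x, f x = g x.
    by move=> Ux; apply: filterS (open_nbhs_nbhs (conj oU Ux)).
  by split=> // x Ux; apply: near_eq_continuous (cf _ Ux); apply: nfg.
have nfg x : U x -> \near x, f x = g x.
  by move=> Ux; apply: filterS (open_nbhs_nbhs (conj oU Ux)).
split=> [x Ux|i]; first by apply: near_eq_continuous (cf _ Ux); apply: nfg.
have [d1 d2] := df i; split=> [x Ux|].
  by apply: near_eq_derivable (d1 _ Ux); apply: nfg.
by apply: IH d2 => x Ux; apply: near_eq_derive; apply: nfg.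
Qed.

Lemma ck_on_sub n k (U V : set 'rV[R]_n) f : V `<=` U ->
  ck_on k U f -> ck_on k V f.
Proof.
move=> VU; elim: k f => [|k IH] f /= [cf df].
  by split=> // x /VU; apply: cf.
split=> [x /VU|i]; first exact: cf.
by have [d1 d2] := df i; split=> [x /VU|]; [exact: d1|exact: IH].
Qed.

Lemma ck_on_local n k (U : set 'rV[R]_n) f :
  (forall x, U x -> exists V, V x /\ ck_on k V f) -> ck_on k U f.
Proof.
elim: k f => [|k IH] f /= H.
  by split=> // x /H[V [Vx [cf _]]]; apply: cf.
split=> [x /H[V [Vx [cf _]]]|i]; first exact: cf.
split=> [x /H[V [Vx [_ /(_ i)[df _]]]]|]; first exact: df.
by apply: IH => x /H[V [Vx [_ /(_ i)[_ df]]]]; exists V.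
Qed.

Lemma ck_onS n k (U : set 'rV[R]_n) f : ck_on k.+1 U f -> ck_on k U f.
Proof.
elim: k f => [|k IH] f /= [cf df]; split=> // i.
by have [d1 d2] := df i; split=> //; apply: IH.
Qed.

Lemma ck_on_cst n k (U : set 'rV[R]_n) (c : R) : ck_on k U (fun=> c).
Proof.
elim: k c => [|k IH] c /=.
  by split=> // x _; apply: cst_continuous.
split=> [x _|i]; first exact: cst_continuous.
split=> [x _|]; first exact: derivable_cst.
suff -> : 'D_(delta_mx 0 i) (fun=> c) = (fun=> 0 : R) :> ('rV[R]_n -> R) by [].
by apply/funext => x; rewrite derive_cst.
Qed.

Lemma is_derive_coord n (v x : 'rV[R]_n) j :
  is_derive x v (fun y : 'rV[R]_n => y 0 j) (v 0 j).
Proof.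
have /derivable_mxP dx := @derivable_id _ _ x v.
split; first exact: dx.
have := @derive_mx _ _ _ _ (id : 'rV[R]_n -> 'rV[R]_n) x v (@derivable_id _ _ x v).
rewrite derive_id.
by move=> /matrixP/(_ 0 j); rewrite mxE.
Qed.

Lemma ck_on_coord n k (U : set 'rV[R]_n) j : ck_on k U (fun x => x 0 j).
Proof.
case: k => [|k] /=; first by split=> // x _; apply: coord_continuous.
split=> [x _|i]; first exact: coord_continuous.
split=> [x _|]; first by have [] := is_derive_coord (delta_mx 0 i) x j.
suff -> : 'D_(delta_mx 0 i) (fun x : 'rV[R]_n => x 0 j) =
  (fun=> (delta_mx 0 i : 'rV[R]_n) 0 j) by apply: ck_on_cst.
by apply/funext => x; have [] := is_derive_coord (delta_mx 0 i) x j.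
Qed.

Lemma ck_onD n k (U : set 'rV[R]_n) f g : open U -> ck_on k U f ->
  ck_on k U g -> ck_on k U (fun x => f x + g x).
Proof.
move=> oU; elim: k f g => [|k IH] f g /= [cf df] [cg dg].
  by split=> // x Ux; apply: continuousD; [exact: cf|exact: cg].
split=> [x Ux|i]; first by apply: continuousD; [exact: cf|exact: cg].
have [d1 d2] := df i; have [e1 e2] := dg i; split=> [x Ux|].
  by apply: (@derivableD _ _ _ f g); [exact: d1|exact: e1].
apply: ck_on_ext (IH _ _ d2 e2) => // x Ux.
by rewrite (@deriveD _ _ _ f g)//; [exact: d1|exact: e1].
Qed.

Lemma ck_onM n k (U : set 'rV[R]_n) f g : open U -> ck_on k U f ->
  ck_on k U g -> ck_on k U (fun x => f x * g x).
Proof.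
move=> oU; elim: k f g => [|k IH] f g.
  by move=> [cf _] [cg _]; split=> // x Ux; apply: continuousM; [exact: cf|exact: cg].
move=> Cf Cg; have kf := ck_onS Cf; have kg := ck_onS Cg.
move: Cf Cg => /= [cf df] [cg dg].
split=> [x Ux|i]; first by apply: continuousM; [exact: cf|exact: cg].
have [d1 d2] := df i; have [e1 e2] := dg i; split=> [x Ux|].
  by apply: (@derivableM _ _ f g); [exact: d1|exact: e1].
apply: (@ck_on_ext _ _ _ (fun x => f x * 'D_(delta_mx 0 i) g x +
  g x * 'D_(delta_mx 0 i) f x)) => //.
  by move=> x Ux; rewrite (@deriveM _ _ f g)//; [exact: d1|exact: e1].
by apply: ck_onD => //; apply: IH.
Qed.

Lemma ck_on_sum n k (U : set 'rV[R]_n) (I : Type) (r : seq I) (P : pred I)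
    (f : I -> 'rV[R]_n -> R) : open U ->
  (forall i, P i -> ck_on k U (f i)) ->
  ck_on k U (fun x => \sum_(i <- r | P i) f i x).
Proof.
move=> oU Cf; elim: r => [|j r IH].
  have -> : (fun x => \sum_(i <- [::] | P i) f i x) = (fun=> 0 : R).
    by apply/funext => x; rewrite big_nil.
  exact: ck_on_cst.
have -> : (fun x => \sum_(i <- (j :: r) | P i) f i x) = (fun x => if P j then
    f j x + \sum_(i <- r | P i) f i x else \sum_(i <- r | P i) f i x).
  by apply/funext => x; rewrite big_cons.
by case Pj: (P j) => //; apply: ck_onD => //; apply: Cf.
Qed.

Lemma ck_on_prod n k (U : set 'rV[R]_n) (I : Type) (r : seq I) (P : pred I)
    (f : I -> 'rV[R]_n -> R) : open U ->
  (forall i, P i -> ck_on k U (f i)) ->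
  ck_on k U (fun x => \prod_(i <- r | P i) f i x).
Proof.
move=> oU Cf; elim: r => [|j r IH].
  have -> : (fun x => \prod_(i <- [::] | P i) f i x) = (fun=> 1 : R).
    by apply/funext => x; rewrite big_nil.
  exact: ck_on_cst.
have -> : (fun x => \prod_(i <- (j :: r) | P i) f i x) = (fun x => if P j then
    f j x * \prod_(i <- r | P i) f i x else \prod_(i <- r | P i) f i x).
  by apply/funext => x; rewrite big_cons.
by case Pj: (P j) => //; apply: ck_onM => //; apply: Cf.
Qed.

(** Restriction to a line makes one-variable results, such as the chain rule and the mean value
    theorem, available for directional derivatives. *)
Lemma is_derive_line (V W : normedModType R) (f : V -> W) (v a : V) (t : R) l :
  is_derive (t *: v + a) v f l <->
  is_derive t 1 (fun s : R => f (s *: v + a)) l.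
Proof.
have E : (fun h : R => h^-1 *: (((fun s : R => f (s *: v + a)) \o shift t)
            (h *: 1) - f (t *: v + a))) =
         (fun h : R => h^-1 *: ((f \o shift (t *: v + a)) (h *: v) -
            f (t *: v + a))).
  apply/funext => h /=; congr (_ *: (f _ - _)).
  by rewrite scalerDl addrA [h *: 1]mulr1.
split=> -[d e]; split.
- by rewrite /derivable E.
- by move: e; rewrite /derive E.
- by rewrite /derivable -E.
- by move: e; rewrite /derive -E.
Qed.

Lemma is_derive_comp1 (V : normedModType R) (f : V -> R) (psi : R -> R)
    (x v : V) l m : is_derive x v f l -> is_derive (f x) 1 psi m ->
  is_derive x v (psi \o f) (m * l).
Proof.
move=> df dp.
have [L _] := @is_derive_line V R f v x 0 l.
have [_ K] := @is_derive_line V R (psi \o f) v x 0 (m * l).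
rewrite scale0r add0r in L K; apply: K.
have df0 := L df.
have dp0 : is_derive ((fun s : R => f (s *: v + x)) 0) 1 psi m.
  by rewrite scale0r add0r.
exact: (@is_derive1_comp _ psi (fun s : R => f (s *: v + x)) 0 _ _ dp0 df0).
Qed.

Lemma is_derive_continuous (psi : R -> R) (x l : R) :
  is_derive x 1 psi l -> {for x, continuous psi}.
Proof.
by move=> [/derivable1_diffP d _]; apply: differentiable_continuous.
Qed.

(** The induction on [k] passes from [psi] to its derivative, so it runs over a whole class [C] that
    is closed under differentiation on [D]. It serves for inverse powers and for the flat
    exponentials. *)
Lemma ck_on_comp1 (C : set (R -> R)) (D : set R) n k (U : set 'rV[R]_n) f psi :
  (forall psi, C psi -> exists psi', C psi' /\
     forall t, D t -> is_derive t 1 psi (psi' t)) ->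
  open U -> (forall x, U x -> D (f x)) -> C psi ->
  ck_on k U f -> ck_on k U (psi \o f).
Proof.
move=> Cder oU UD; elim: k psi => [|k IH] psi Cpsi.
  have [psi' [_ dpsi]] := Cder _ Cpsi.
  move=> [cf _]; split=> // x Ux; apply: continuous_comp; first exact: cf.
  exact: is_derive_continuous (dpsi _ (UD _ Ux)).
have [psi' [Cpsi' dpsi]] := Cder _ Cpsi.
move=> Cf; have kf := ck_onS Cf; move: Cf => /= [cf df]; split=> [x Ux|i].
  apply: continuous_comp; first exact: cf.
  exact: is_derive_continuous (dpsi _ (UD _ Ux)).
have [d1 d2] := df i.
have E x : U x -> is_derive x (delta_mx 0 i) (psi \o f)
    (psi' (f x) * 'D_(delta_mx 0 i) f x).
  move=> Ux; apply: is_derive_comp1; last exact: dpsi (UD _ Ux).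
  exact/derivableP/d1.
split=> [x Ux|]; first by have [] := E _ Ux.
apply: (@ck_on_ext _ _ _ (fun x => (psi' \o f) x * 'D_(delta_mx 0 i) f x)) => //.
  by move=> x Ux; have [_ ->] := E _ Ux.
by apply: ck_onM => //; apply: IH.
Qed.

Lemma is_deriveV1 (t : R) : t != 0 -> is_derive t 1 (fun t : R => t^-1) (- t^-2).
Proof.
move=> t0; have di := @derivable_id R R t 1.
split; first exact: (@derivableV R R id).
by rewrite (@deriveV R R id t 1 t0 di) derive_id [_ *: _]mulr1.
Qed.

Lemma ck_onV n k (U : set 'rV[R]_n) f : open U ->
  (forall x, U x -> f x != 0) -> ck_on k U f ->
  ck_on k U (fun x => (f x)^-1).
Proof.
move=> oU f0 Cf.
(* Multiples of inverse powers form a class closed under differentiation away from 0. *)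
pose C := [set psi : R -> R | exists c m, psi = fun t => c * t^-1 ^+ m].
apply: (@ck_on_comp1 C [set t | t != 0] _ _ _ _ (fun t => t^-1)) => //; last first.
  by exists 1, 1%N; apply/funext => t; rewrite mul1r expr1.
move=> _ [c [m ->]].
exists (fun t => (- m%:R * c) * t^-1 ^+ m.+1); split; first by exists (- m%:R * c), m.+1.
move=> t /= t0.
have dV := is_deriveV1 t0.
case: m => [|m].
  rewrite mulr0n oppr0 !mul0r.
  have -> : (fun t : R => c * t^-1 ^+ 0) = cst c.
    by apply/funext => s; rewrite expr0 mulr1.
  exact: is_derive_cst.
have d1 := @is_deriveX _ (R^o) (fun t : R => t^-1) m t 1 _ dV.
suff -> : - m.+1%:R * c * t^-1 ^+ m.+2 = c *: ((m.+1%:R * t^-1 ^+ m) *: - t^-2).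
  have -> : (fun t => c * t^-1 ^+ m.+1) = c *: ((fun t : R => t^-1) ^+ m.+1).
    by apply/funext => s; rewrite [RHS]/GRing.scale /= exprfctE.
  exact: is_deriveZ.
rewrite /GRing.scale /= !exprVn !exprS expr0 mulr1.
have := t0; move: (m.+1%:R : R) => M ?; field.
by rewrite t0 expf_neq0.
Qed.

End Ck.

(** * The chain rule in several variables *)

Section CkComp.
Context {R : realType}.

Lemma continuous_mx (T : topologicalType) m n (phi : T -> 'M[R]_(m, n)) x :
  (forall i j, {for x, continuous (fun y => phi y i j)}) ->
  {for x, continuous phi}.
Proof.
move=> cphi A [P nP PA]; near=> y; apply: PA => /= i j.
move: (i) (j); near: y.
apply: filter_forall => i; apply: filter_forall => j.
exact: (cphi i j _ (nP i j)).
Unshelve. all: by end_near. Qed.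

(** The mean value theorem along one coordinate line, as an error bound. Since [s] may be negative,
    it is applied between [Num.min 0 s] and [Num.max 0 s]. *)
Lemma mvt_line n (f : 'rV[R]_n -> R) (i : 'I_n) (w : 'rV[R]_n) (s a e : R) :
  (forall t : R, `|t| <= `|s| -> derivable f (t *: delta_mx 0 i + w) (delta_mx 0 i)) ->
  (forall t : R, `|t| <= `|s| ->
     `|'D_(delta_mx 0 i) f (t *: delta_mx 0 i + w) - a| <= e) ->
  `|f (s *: delta_mx 0 i + w) - f w - s * a| <= e * `|s|.
Proof.
move=> df De.
pose g t := f (t *: delta_mx 0 i + w).
have dg (t : R) : `|t| <= `|s| -> is_derive t 1 g ('D_(delta_mx 0 i) f (t *: delta_mx 0 i + w)).
  move=> ts; apply: (proj1 (@is_derive_line R _ _ f (delta_mx 0 i) w t _)).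
  exact/derivableP/df.
have cg (t : R) : `|t| <= `|s| -> {for t, continuous g}.
  by move=> /dg; apply: is_derive_continuous.
have bnd (t : R) : t \in `[Num.min 0 s, Num.max 0 s] -> `|t| <= `|s|.
  rewrite in_itv /=; case: (ltrP 0 s) => s0 /andP[t1 t2].
    by rewrite (gtr0_norm s0) ger0_norm.
  by rewrite (ler0_norm s0) ler0_norm// lerN2.
have lm : Num.min 0 s <= Num.max 0 s by rewrite le_max ge_min lexx.
have [c cI E] : exists2 c, c \in `[Num.min 0 s, Num.max 0 s]%R &
   g (Num.max 0 s) - g (Num.min 0 s) =
   'D_(delta_mx 0 i) f (c *: delta_mx 0 i + w) * (Num.max 0 s - Num.min 0 s).
  apply: (MVT_segment lm) => [x xI|].
    by apply: dg; apply: bnd; exact: subset_itv_oo_cc.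
  apply: continuous_in_subspaceT => x; rewrite inE => xI; apply: cg; exact: bnd.
have {E} : g s - g 0 = 'D_(delta_mx 0 i) f (c *: delta_mx 0 i + w) * s.
  move: E; case: (ltrP 0 s) => s0; rewrite ?subr0 ?sub0r//.
  by move=> /(congr1 -%R); rewrite opprB mulrN opprK.
rewrite /g scale0r add0r => ->.
rewrite [s * a]mulrC -mulrBl normrM; apply: ler_wpM2r => //.
by apply: De; apply: bnd.
Qed.

(** The point [y] is joined to [z] by segments parallel to the axes, and [mvt_line] bounds the error
    on each segment. *)
Lemma ck1_diff n (V : set 'rV[R]_n) f y e : open V -> ck_on 1 V f -> V y ->
  0 < e -> \forall z \near y, `|f z - f y - \sum_(j < n)
     (z 0 j - y 0 j) * 'D_(delta_mx 0 j) f y| <= e * \sum_(j < n) `|z 0 j - y 0 j|.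
Proof.
move=> oV [_ /= df] Vy e0.
have : \forall z \near y, V z /\ forall j, `|'D_(delta_mx 0 j) f z - 'D_(delta_mx 0 j) f y| <= e.
  near=> z; split; first by near: z; exact: open_nbhs_nbhs.
  near: z; apply: filter_forall => j; have [_ [cd _]] := df j.
  have /cvgrPdist_le/(_ _ e0) := cd _ Vy.
  by apply: filterS => z; rewrite distrC.
move=> /nbhs_ballP[r /= r0 rV].
apply/nbhs_ballP; exists r => //= z zr.
(* Vertices of the path: the first [m] coordinates are already those of [z]. *)
pose w (m : nat) : 'rV[R]_n := \row_j (if (j < m)%N then z 0 j else y 0 j).
have wS (m : 'I_n) : w m.+1 = (z 0 m - y 0 m) *: delta_mx 0 m + w m.
  apply/rowP => j; rewrite !mxE eqxx /=; case: eqVneq => [->|jm].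
    by rewrite ltnS leqnn ltnn mulr1 subrK.
  by rewrite mulr0 add0r ltnS leq_eqVlt (inj_eq val_inj) (negbTE jm).
have wB (m : 'I_n) (t : R) : `|t| <= `|z 0 m - y 0 m| -> ball y r (t *: delta_mx 0 m + w m).
  move=> tm; split=> // i j; rewrite ord1 {i} !mxE eqxx /= /ball /=.
  have [_ /(_ 0 j)] := zr; have [_ /(_ 0 m)] := zr; rewrite /ball /= => zm zj.
  case: eqVneq => [->|jm].
    by rewrite ltnn mulr1 opprD addrCA subrr addr0 normrN (le_lt_trans tm)// distrC.
  by rewrite mulr0 add0r; case: ifP => // _; rewrite subrr normr0.
have w0 : w 0%N = y by apply/rowP => j; rewrite mxE.
have wn : w n = z by apply/rowP => j; rewrite mxE ltn_ord.
have -> : f z - f y = \sum_(m < n) (f (w m.+1) - f (w m)).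
  by rewrite -(big_mkord predT (fun m => f (w m.+1) - f (w m))) telescope_sumr// w0 wn.
rewrite -sumrB mulr_sumr; apply: le_trans (ler_norm_sum _ _ _) _.
apply: ler_sum => m _; rewrite wS.
apply: mvt_line => t tm; have /rV[Vt] := wB _ _ tm; last exact.
by move=> _; have [d1 _] := df m; apply: d1.
Unshelve. all: by end_near. Qed.

(** An exact factorization of the increment with factors continuous at [y]: the chain rule follows
    by substitution, with no remainder to estimate. *)
Lemma ck1_slope n (V : set 'rV[R]_n) f y : open V -> ck_on 1 V f -> V y ->
  exists A : 'I_n -> 'rV[R]_n -> R,
    (forall z, f z - f y = \sum_(j < n) (z 0 j - y 0 j) * A j z) /\
    (forall j, {for y, continuous (A j)} /\ A j y = 'D_(delta_mx 0 j) f y).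
Proof.
move=> oV Cf Vy.
pose D j := 'D_(delta_mx 0 j) f y.
pose S (z : 'rV[R]_n) := \sum_(j < n) `|z 0 j - y 0 j|.
pose rho z := (f z - f y - \sum_(j < n) (z 0 j - y 0 j) * D j) / S z.
(* The relative error [rho] is spread over the coordinates with the signs of the increments, because
   increments times their signs add up to [S z]. At [z = y] division by 0 gives [rho y = 0]. *)
exists (fun j z => D j + rho z * Num.sg (z 0 j - y 0 j)); split.
  move=> z; under eq_bigr do rewrite mulrDr.
  rewrite big_split /=.
  have -> : \sum_(j < n) (z 0 j - y 0 j) * (rho z * Num.sg (z 0 j - y 0 j)) = rho z * S z.
    rewrite /S mulr_sumr; apply: eq_bigr => j _.
    by rewrite mulrCA; congr (_ * _); rewrite mulrC -normrEsg.
  rewrite /rho; have [S0|S0] := eqVneq (S z) 0; last by rewrite divfK// addrC subrK.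
  have zy : z = y.
    apply/rowP => j; apply/eqP; rewrite -subr_eq0 -normr_le0.
    rewrite -S0; rewrite /S (bigD1 j)//= lerDl.
    by apply: sumr_ge0.
  by rewrite S0 invr0 !mulr0 addr0 zy subrr big1// => j _; rewrite subrr mul0r.
move=> j; split; last by rewrite subrr sgr0 mulr0 addr0.
apply/(@cvgrPdist_le R R _ (nbhs y) (nbhs_filter y)) => e e0; near=> z; rewrite subrr sgr0 mulr0 addr0.
have Hz : `|f z - f y - \sum_(j < n) (z 0 j - y 0 j) * D j| <= e * S z.
  by near: z; exact: (ck1_diff oV Cf Vy e0).
rewrite opprD addrA subrr sub0r normrN normrM.
have rle : `|rho z| <= e.
  rewrite /rho normrM normfV; have [S0|S0] := eqVneq (S z) 0.
    by rewrite S0 normr0 invr0 mulr0 ltW.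
  have Sge0 : 0 <= S z by apply: sumr_ge0.
  have Sp : 0 < S z by rewrite lt_neqAle eq_sym S0.
  by rewrite ler_pdivrMr ?normr_gt0// (ger0_norm Sge0).
rewrite -[leRHS]mulr1; apply: ler_pM => //.
by rewrite normr_sg; case: eqP.
Unshelve. all: by end_near. Qed.

Lemma is_derive_comp n m (V : set 'rV[R]_n) f (phi : 'rV[R]_m -> 'rV[R]_n) x v l :
  open V -> ck_on 1 V f -> V (phi x) -> {for x, continuous phi} ->
  (forall j, is_derive x v (fun y => phi y 0 j) (l j)) ->
  is_derive x v (fun y => f (phi y))
    (\sum_(j < n) 'D_(delta_mx 0 j) f (phi x) * l j).
Proof.
move=> oV Cf Vy cphi dphi.
have [A [fA cA]] := ck1_slope oV Cf Vy.
suff C : (fun h : R => h^-1 *: (((fun y => f (phi y)) \o shift x) (h *: v) - f (phi x))) @ 0^'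
   --> \sum_(j < n) 'D_(delta_mx 0 j) f (phi x) * l j.
  by split; [apply/cvg_ex; eexists; exact: C|exact: cvg_lim].
(* By the factorization, the difference quotient is a sum of products of two convergent factors. *)
have -> : (fun h : R => h^-1 *: (((fun y => f (phi y)) \o shift x) (h *: v) - f (phi x))) =
  (fun h : R => \sum_(j < n) A j (phi (h *: v + x)) *
    (h^-1 *: ((phi (h *: v + x)) 0 j - phi x 0 j))).
  apply/funext => h /=; rewrite fA scaler_sumr; apply: eq_bigr => j _.
  by rewrite /GRing.scale /=; ring.
apply: cvg_big => [|j _]; first exact: add_continuous.
apply: cvgM.
  have c1 : (h *: v + x) @[h --> (0 : R)^'] --> x.
    apply: cvg_within_filter.
    have : {for (0 : R), continuous (fun h : R => h *: v + x)}.
      by apply: cvgD; [apply: cvgZr_tmp; exact: cvg_id|exact: cvg_cst].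
    by rewrite /prop_for /continuous_at scale0r add0r.
  have c2 : phi (h *: v + x) @[h --> (0 : R)^'] --> phi x.
    exact: (cvg_comp _ _ c1 cphi).
  have [cAj <-] := cA j.
  exact: (cvg_comp _ _ c2 cAj).
by have [] := dphi j => d <-; exact: d.
Qed.

(** Induction on the order: a partial derivative of the composite is a sum of products of a partial
    derivative of [f], composed with [phi], and a partial derivative of [phi]. *)
Lemma ck_on_comp n m k (U : set 'rV[R]_m) (V : set 'rV[R]_n) f
    (phi : 'rV[R]_m -> 'rV[R]_n) :
  open U -> open V -> (forall x, U x -> V (phi x)) -> ck_on k V f ->
  (forall j, ck_on k U (fun x => phi x 0 j)) ->
  ck_on k U (fun x => f (phi x)).
Proof.
move=> oU oV UV; elim: k f => [|k IH] f.
  move=> [cf _] Cphi; split=> // x Ux.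
  apply: continuous_comp; last exact/cf/UV.
  apply: continuous_mx => i j; rewrite ord1; have [c _] := Cphi j; exact: c.
move=> Cf Cphi.
have cphi x : U x -> {for x, continuous phi}.
  by move=> Ux; apply: continuous_mx => i j; rewrite ord1; have [c _] := Cphi j; exact: c.
have C1 : ck_on 1 V f by case: (Cf) => cf df; split=> // i; have [d1 d2] := df i;
  split=> //; split=> //; case: (k) d2 => [|k'] [].
have D x i : U x -> is_derive x (delta_mx 0 i) (fun y => f (phi y))
    (\sum_(j < n) 'D_(delta_mx 0 j) f (phi x) * 'D_(delta_mx 0 i) (fun y => phi y 0 j) x).
  move=> Ux; apply: (is_derive_comp oV C1) => //; first exact: UV.
    exact: cphi.
  by move=> j; have [_ /(_ i)[d _]] := Cphi j; apply/derivableP/d.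
split=> [x Ux|i].
  apply: continuous_comp; first exact: cphi.
  by case: Cf => cf _; exact/cf/UV.
split=> [x Ux|]; first by have [] := D x i Ux.
apply: (@ck_on_ext _ _ _ _ (fun x => \sum_(j < n) 'D_(delta_mx 0 j) f (phi x) *
  'D_(delta_mx 0 i) (fun y => phi y 0 j) x)) => //.
  by move=> x Ux; have [_ ->] := D x i Ux.
apply: ck_on_sum => // j _; apply: ck_onM => //.
  by apply: (IH ('D_(delta_mx 0 j) f)) => [|j']; [have [_ /(_ j)[]] := Cf|apply/ck_onS/Cphi].
by have [_ /(_ i)[]] := Cphi j.
Qed.

End CkComp.

(** * Bump functions *)

Section Bump.
Context {R : realType}.

(* The family P(1/t) exp(-1/t), 0 for t <= 0, is stable under differentiation. *)
Definition flat_exp (P : {poly R}) (t : R) : R :=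
  if 0 < t then P.[t^-1] * expR (- t^-1) else 0.

(** The term of degree [n.+1] of the exponential series gains one power of [s] over [s ^+ n]. *)
Lemma exprn_expRN_le n (s : R) : 0 < s -> s ^+ n * expR (- s) <= n.+1`!%:R / s.
Proof.
move=> s0; rewrite expRN ler_pdivlMr// mulrAC -exprSr ler_pdivrMr ?expR_gt0//.
have := @expR_ge1Dxn R s n (ltW s0).
have f0 : (0 : R) < n.+1`!%:R by rewrite ltr0n fact_gt0.
move=> H; rewrite mulrC -ler_pdivrMr//; apply: le_trans H; lra.
Qed.

Lemma poly_expRN_le (P : {poly R}) : exists C : R, 0 <= C /\
  forall s : R, 0 < s -> `|P.[s] * expR (- s)| <= C / s.
Proof.
exists (\sum_(i < size P) `|P`_i| * i.+1`!%:R); split.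
  by apply: sumr_ge0 => i _; apply: mulr_ge0.
move=> s s0; rewrite horner_coef !mulr_suml.
apply: le_trans (ler_norm_sum _ _ _) _; apply: ler_sum => i _.
rewrite -!mulrA normrM ler_wpM2l// ger0_norm; last first.
  by rewrite mulr_ge0 ?expR_ge0 ?exprn_ge0// ltW.
exact: exprn_expRN_le.
Qed.

(** The quadratic bound makes the difference quotient at 0 tend to 0. The extra power of [t] comes
    from applying [poly_expRN_le] to ['X * P] at [t^-1]. *)
Lemma flat_exp_le2 (P : {poly R}) : exists C : R, 0 <= C /\
  forall t : R, `|flat_exp P t| <= C * t ^+ 2.
Proof.
have [C [C0 HC]] := poly_expRN_le ('X * P).
exists C; split=> // t; rewrite /flat_exp; case: ifP => t0; last first.
  by rewrite normr0 mulr_ge0 ?sqr_ge0.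
have := HC t^-1; rewrite invr_gt0 t0 invrK => /(_ isT).
rewrite hornerM hornerX -mulrA normrM [`|t^-1|]ger0_norm ?invr_ge0 ?(ltW t0)//.
by rewrite ler_pdivrMl// mulrCA -expr2.
Qed.

Lemma is_derive_flat_exp (P : {poly R}) (t : R) :
  is_derive t 1 (flat_exp P) (flat_exp ('X^2 * (P - P^`())) t).
Proof.
have [t0|t0|->] := ltrgtP t 0.
- rewrite /flat_exp ltNge (ltW t0) /=.
  have d0 : is_derive t 1 (cst (0 : R)) (0 : R) by exact: is_derive_cst.
  apply: near_eq_is_derive d0.
  near=> s; rewrite ltNge ltW//=; near: s; exact: lt_nbhsl.
- pose g (s : R) := P.[s^-1] * expR (- s^-1).
  apply: (@near_eq_is_derive _ _ _ g).
    near=> s; rewrite /flat_exp /g ifT//; near: s; exact: lt_nbhsr.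
  have tn0 : t != 0 by rewrite gt_eqF.
  have d1 := is_deriveV1 tn0.
  have d2 : is_derive t 1 (fun s => P.[s^-1]) (P^`().[t^-1] * - t^-2).
    exact: (@is_derive1_comp _ (horner P) (fun s : R => s^-1) t _ _ (is_derive_poly P _) d1).
  have d3 : is_derive t 1 (fun s => expR (- s^-1)) (expR (- t^-1) * t^-2).
    have dN : is_derive t 1 (fun s : R => - s^-1) (t^-2).
      by have := @is_deriveN _ _ _ _ _ _ _ d1; rewrite opprK.
    exact: (@is_derive1_comp _ expR (fun s : R => - s^-1) t _ _ (is_derive_expR _) dN).
  have d4 := @is_deriveM R R (fun s : R => P.[s^-1]) (fun s : R => expR (- s^-1)) t 1 _ _ d2 d3.
  suff -> : flat_exp ('X^2 * (P - P^`())) t =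
      P.[t^-1] *: (expR (- t^-1) * t^-2) + expR (- t^-1) *: (P^`().[t^-1] * - t^-2).
    exact: d4.
  rewrite /flat_exp t0 hornerM hornerXn hornerD hornerN /GRing.scale /=.
  by rewrite exprVn; ring.
(* At [t = 0] every [flat_exp Q] is 0, so the derivative to be found is 0. *)
- have [C [C0 HC]] := flat_exp_le2 P.
  have E0 Q : flat_exp Q 0 = 0 by rewrite /flat_exp ltxx.
  rewrite E0.
  suff L : (fun h : R => h^-1 *: (((flat_exp P) \o shift 0) (h *: (1 : R)) - flat_exp P 0)) @ 0^' --> (0 : R).
    by split; [apply/cvg_ex; eexists; exact: L|exact: cvg_lim].
  apply/cvgrPdist_le => e e0; near=> h.
  have h0 : h != 0 by near: h; exact: nbhs_dnbhs_neq.
  rewrite sub0r normrN E0 subr0 /= addr0 [_ *: 1]mulr1 [_ *: _]mulrC normrM normfV.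
  rewrite ler_pdivrMr ?normr_gt0//; apply: le_trans (HC h) _.
  rewrite -[h ^+ 2]real_normK ?num_real// expr2 mulrA ler_wpM2r//.
  have : `|h| <= e / (C + 1).
    near: h; apply: dnbhs0_le; rewrite divr_gt0//; lra.
  rewrite ler_pdivlMr; last lra.
  have := normr_ge0 h; nra.
Unshelve. all: by end_near. Qed.

Lemma ck_on_flat_exp n k (U : set 'rV[R]_n) f P : open U -> ck_on k U f ->
  ck_on k U (fun x => flat_exp P (f x)).
Proof.
move=> oU Cf.
apply: (@ck_on_comp1 _ [set psi | exists P, psi = flat_exp P] setT) => //; last by exists P.
move=> _ [Q ->]; exists (flat_exp ('X^2 * (Q - Q^`()))); split; first by eexists.
by move=> t _; exact: is_derive_flat_exp.
Qed.

Lemma flat_exp1_gt0 (t : R) : (0 < flat_exp 1 t) = (0 < t).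
Proof.
rewrite /flat_exp; case: ifP => t0; last by rewrite ltxx.
by rewrite hornerC mul1r expR_gt0.
Qed.

Lemma flat_exp1_ge0 (t : R) : 0 <= flat_exp 1 t.
Proof.
rewrite /flat_exp; case: ifP => t0 //.
by rewrite hornerC mul1r expR_ge0.
Qed.

Lemma flat_exp_le0 P (t : R) : t <= 0 -> flat_exp P t = 0.
Proof. by move=> t0; rewrite /flat_exp ltNge t0. Qed.

Definition sqdist n (y x : 'rV[R]_n) := \sum_(i < n) (x 0 i - y 0 i) ^+ 2.

(** The usual cut-off a / (a + b): it is 1 for [sqdist y x <= e] and 0 for [sqdist y x >= 2 * e].
    The squared Euclidean distance is used because it is polynomial, unlike the norm of the space;
    thus [e] is a squared radius. *)
Definition plateau n (y : 'rV[R]_n) (e : R) (x : 'rV[R]_n) : R :=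
  flat_exp 1 (2 * e - sqdist y x) /
  (flat_exp 1 (2 * e - sqdist y x) + flat_exp 1 (sqdist y x - e)).

Lemma plateau_eq1 n (y : 'rV[R]_n) e x : 0 < e -> sqdist y x <= e -> plateau y e x = 1.
Proof.
move=> e0 xe; rewrite /plateau [flat_exp _ (_ - e)]flat_exp_le0; last lra.
by rewrite addr0 divff// gt_eqF// flat_exp1_gt0; lra.
Qed.

Lemma plateau_eq0 n (y : 'rV[R]_n) e x : 2 * e <= sqdist y x -> plateau y e x = 0.
Proof. by move=> xe; rewrite /plateau flat_exp_le0 ?mul0r//; lra. Qed.

Lemma ck_on_plateau n k (U : set 'rV[R]_n) (y : 'rV[R]_n) e : open U -> 0 < e ->
  ck_on k U (plateau y e).
Proof.
move=> oU e0.
have CS : ck_on k U (sqdist y).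
  apply: ck_on_sum => // i _; under eq_fun do rewrite expr2.
  by apply: ck_onM => //; apply: ck_onD => //; [exact: ck_on_coord|exact: ck_on_cst
    |exact: ck_on_coord|exact: ck_on_cst].
have C1 : ck_on k U (fun x => flat_exp 1 (2 * e - sqdist y x)).
  apply: ck_on_flat_exp => //; apply: ck_onD => //; first exact: ck_on_cst.
  rewrite (_ : (fun x => - sqdist y x) = (fun x => -1 * sqdist y x)).
    by apply: ck_onM => //; exact: ck_on_cst.
  by apply/funext => x; rewrite mulN1r.
have C2 : ck_on k U (fun x => flat_exp 1 (sqdist y x - e)).
  by apply: ck_on_flat_exp => //; apply: ck_onD => //; exact: ck_on_cst.
apply: ck_onM => //; apply: ck_onV => //; last exact: ck_onD.
move=> x _; have [xe|xe] := lerP (sqdist y x) e.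
  by rewrite gt_eqF// ltr_pwDl ?flat_exp1_ge0// flat_exp1_gt0; lra.
by rewrite gt_eqF// ltr_wpDl ?flat_exp1_ge0// flat_exp1_gt0; lra.
Qed.

Lemma sqdist_continuous n (y : 'rV[R]_n) : continuous (sqdist y).
Proof.
have C : ck_on 0 setT (sqdist y).
  apply: ck_on_sum => //; first exact: openT.
  move=> i _; under eq_fun do rewrite expr2.
  by apply: ck_onM => //; [exact: openT| |];
   apply: ck_onD => //; try exact: openT; [exact: ck_on_coord|exact: ck_on_cst
    |exact: ck_on_coord|exact: ck_on_cst].
by case: C => C _ x; exact: C.
Qed.

Lemma sqdist_refl n (y : 'rV[R]_n) : sqdist y y = 0.
Proof. by rewrite /sqdist big1// => i _; rewrite subrr expr0n. Qed.

Lemma sqdist_ge n (y x : 'rV[R]_n) i : (x 0 i - y 0 i) ^+ 2 <= sqdist y x.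
Proof.
rewrite /sqdist (bigD1 i)//= lerDl; apply: sumr_ge0 => j _; exact: sqr_ge0.
Qed.

Lemma sqdist_ball n (y : 'rV[R]_n) (r : R) : 0 < r ->
  [set x | sqdist y x < r ^+ 2] `<=` ball y r.
Proof.
move=> r0 x /= xr; split=> // i j; rewrite ord1 /ball /= distrC.
rewrite -(@ltr_pXn2r _ 2)// ?nnegrE ?(ltW r0)// real_normK ?num_real//.
exact: le_lt_trans (sqdist_ge _ _ _) xr.
Qed.

Lemma compact_sqdist n (y : 'rV[R]_n) (r : R) : compact [set x | sqdist y x <= r].
Proof.
apply: bounded_closed_compact; last first.
  have := @closed_comp _ _ (sqdist y) [set t | t <= r] (fun x _ => @sqdist_continuous n y x).
  by apply; exact: closed_le.
(* A number whose square is at most [r] has absolute value at most [|r| + 1], whatever the size of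
   [r]. *)
have r0 : 0 <= `|r| + 1 by rewrite addr_ge0.
exists (`|y| + (`|r| + 1)); split; first exact: num_real.
move=> M HM x /= xr; apply: le_trans (ltW HM).
have -> : x = y + (x - y) by rewrite addrC subrK.
apply: le_trans (ler_normD _ _) _; rewrite lerD2l.
rewrite [leLHS]/Num.Def.normr/= mx_normrE (bigmax_le _ r0)//= => -[i j] _.
rewrite !mxE/= ord1 -(@ler_pXn2r _ 2)// ?nnegrE// real_normK ?num_real//.
apply: le_trans (sqdist_ge _ _ _) _; apply: le_trans xr _.
have := ler_norm r; have := normr_ge0 r; nra.
Qed.

End Bump.

(** * Smooth functions, tangent vectors and local frames *)

(* [is_manifold] without second countability. *)
Record smooth_atlas (R : realType) (M : charted R) : Prop := SmoothAtlas {
  sa_hausdorff : hausdorff_space M;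
  sa_cover : forall p : M, exists2 c, atlas c & ch_dom c p;
  sa_dom_open : forall c : chart R M (mdim M), atlas c -> open (ch_dom c);
  sa_im_open : forall c : chart R M (mdim M), atlas c -> open (ch_im c);
  sa_mapK : forall c : chart R M (mdim M), atlas c ->
    forall p, ch_dom c p -> ch_inv c (ch_map c p) = p;
  sa_map_continuous : forall c : chart R M (mdim M), atlas c ->
    forall p, ch_dom c p -> {for p, continuous (ch_map c)};
  sa_inv_continuous : forall c : chart R M (mdim M), atlas c ->
    forall x, ch_im c x -> {for x, continuous (ch_inv c)};
  sa_transition : forall c d : chart R M (mdim M), atlas c -> atlas d ->
    forall i, smooth_on (ch_map c @` (ch_dom c `&` ch_dom d))
                        (fun x => ch_map d (ch_inv c x) 0 i) }.

Lemma manifold_smooth_atlas (R : realType) (M : charted R) :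
  is_manifold M -> smooth_atlas M.
Proof. by case=> *; split. Qed.

Section Manifold.
Context {R : realType} {M : charted R} (aM : smooth_atlas M).
Implicit Types (f g : M -> R) (p q : M) (c d : chart R M (mdim M)).

Lemma im_map c p : ch_dom c p -> ch_im c (ch_map c p).
Proof. by move=> cp; exists p. Qed.

Lemma dom_inv c x : atlas c -> ch_im c x -> ch_dom c (ch_inv c x).
Proof. by move=> ac [p cp <-]; rewrite (sa_mapK aM). Qed.

Lemma map_inv c x : atlas c -> ch_im c x -> ch_map c (ch_inv c x) = x.
Proof. by move=> ac [p cp <-]; rewrite (sa_mapK aM). Qed.

Lemma near_inv c x (P : set M) : atlas c -> ch_im c x ->
  (\forall q \near ch_inv c x, P q) -> \forall y \near x, P (ch_inv c y).
Proof. by move=> ac cx; apply: (sa_inv_continuous aM ac cx). Qed.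

Lemma near_map c p (P : set 'rV[R]_(mdim M)) : atlas c -> ch_dom c p ->
  (\forall x \near ch_map c p, P x) -> \forall q \near p, P (ch_map c q).
Proof. by move=> ac cp; apply: (sa_map_continuous aM ac cp). Qed.

Lemma near_dom c p : atlas c -> ch_dom c p -> \forall q \near p, ch_dom c q.
Proof. by move=> ac cp; apply: open_nbhs_nbhs; split=> //; exact: sa_dom_open. Qed.

Lemma near_im c x : atlas c -> ch_im c x -> \forall y \near x, ch_im c y.
Proof. by move=> ac cp; apply: open_nbhs_nbhs; split=> //; exact: sa_im_open. Qed.

Lemma smooth_cst (a : R) : smooth (fun _ : M => a).
Proof. by move=> c ac k; exact: ck_on_cst. Qed.

Lemma smoothD f g : smooth f -> smooth g -> smooth (fun p => f p + g p).
Proof. by move=> sf sg c ac k; apply: ck_onD; [exact: sa_im_open|exact: sf|exact: sg]. Qed.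

Lemma smoothM f g : smooth f -> smooth g -> smooth (fun p => f p * g p).
Proof. by move=> sf sg c ac k; apply: ck_onM; [exact: sa_im_open|exact: sf|exact: sg]. Qed.

Lemma smoothN f : smooth f -> smooth (fun p => - f p).
Proof.
move=> sf; rewrite (_ : (fun p => - f p) = (fun p => -1 * f p)).
  by apply: smoothM => //; exact: smooth_cst.
by apply/funext => p; rewrite mulN1r.
Qed.

Lemma smoothB f g : smooth f -> smooth g -> smooth (fun p => f p - g p).
Proof. by move=> sf sg; apply: smoothD => //; exact: smoothN. Qed.

Lemma smoothX f n : smooth f -> smooth (fun p => f p ^+ n).
Proof.
move=> sf; elim: n => [|n IH]; first by under eq_fun do rewrite expr0; exact: smooth_cst.
by under eq_fun do rewrite exprS; exact: (smoothM sf IH).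
Qed.

Lemma smooth_sum (I : Type) (r : seq I) (P : pred I) (F : I -> M -> R) :
  (forall i, P i -> smooth (F i)) -> smooth (fun p => \sum_(i <- r | P i) F i p).
Proof.
move=> sF c ac k; apply: (@ck_on_sum _ _ _ _ _ _ _ (fun i x => F i (ch_inv c x))).
  exact: sa_im_open.
by move=> i Pi; exact: sF.
Qed.

Lemma smooth_prod (I : Type) (r : seq I) (P : pred I) (F : I -> M -> R) :
  (forall i, P i -> smooth (F i)) -> smooth (fun p => \prod_(i <- r | P i) F i p).
Proof.
move=> sF c ac k; apply: (@ck_on_prod _ _ _ _ _ _ _ (fun i x => F i (ch_inv c x))).
  exact: sa_im_open.
by move=> i Pi; exact: sF.
Qed.

Lemma smooth_det n (A : M -> 'M[R]_n) :
  (forall i j, smooth (fun p => A p i j)) -> smooth (fun p => \det (A p)).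
Proof.
move=> sA; rewrite /determinant; apply: smooth_sum => s _.
by apply: smoothM; [exact: smooth_cst|apply: smooth_prod => i _; exact: sA].
Qed.

(** The quotient form serves for functions given by Cramer's rule; with denominator 1 it says that
    smoothness is local. *)
Lemma smooth_quotient_local f :
  (forall p, exists h n, [/\ smooth h, smooth n, h p != 0 &
     \forall q \near p, h q * f q = n q]) -> smooth f.
Proof.
move=> H c ac k; apply: ck_on_local => x cx.
have [h [n [sd sn dp E]]] := H (ch_inv c x).
pose V := [set y | [/\ ch_im c y, h (ch_inv c y) != 0 &
  h (ch_inv c y) * f (ch_inv c y) = n (ch_inv c y)]]°.
have oV : open V by exact: open_interior.
have Vs y : V y -> [/\ ch_im c y, h (ch_inv c y) != 0 &
  h (ch_inv c y) * f (ch_inv c y) = n (ch_inv c y)] by apply: interior_subset.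
exists V; split.
  have cd : {for x, continuous (fun y => h (ch_inv c y))}.
    by have [cd _] := sd c ac 0%N; apply: cd.
  rewrite /V /interior; near=> y; split; first by near: y; exact: near_im.
    near: y; apply: (cd [set t | t != 0]).
    by apply: open_nbhs_nbhs; split; [exact: open_neq|exact: dp].
  by near: y; exact: near_inv ac cx E.
apply: (@ck_on_ext _ _ _ _ (fun y => n (ch_inv c y) * (h (ch_inv c y))^-1)) => //.
  by move=> y /Vs[_ dy <-]; rewrite mulrC mulKf.
have Vim : V `<=` ch_im c by move=> y /Vs[].
apply: ck_onM => //; first exact: ck_on_sub Vim (sn c ac k).
apply: ck_onV => //; last exact: ck_on_sub Vim (sd c ac k).
by move=> y /Vs[].
Unshelve. all: by end_near. Qed.

Lemma smooth_local f :
  (forall p, exists g, smooth g /\ \forall q \near p, f q = g q) -> smooth f.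
Proof.
move=> H; apply: smooth_quotient_local => p; have [g [sg fg]] := H p.
have n1 : (1 : R) != 0 by exact: oner_neq0.
exists (fun=> 1), g; split=> //; first exact: smooth_cst.
by apply: filterS fg => q ->; rewrite mul1r.
Qed.

Lemma smooth_continuous f : smooth f -> continuous f.
Proof.
move=> sf p; have [c ac cp] := sa_cover aM p.
have [cf _] := sf c ac 0%N.
have C : {for p, continuous (fun q => f (ch_inv c (ch_map c q)))}.
  apply: (@continuous_comp _ _ _ (ch_map c) (fun x => f (ch_inv c x))).
    exact: sa_map_continuous.
  exact: cf (im_map cp).
apply: near_eq_continuous C.
by apply: filterS (near_dom ac cp) => q cq; rewrite (sa_mapK aM).
Qed.

Definition partial c (i : 'I_(mdim M)) p f : R :=
  'D_(delta_mx 0 i) (fun x => f (ch_inv c x)) (ch_map c p).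

Lemma smooth_derivable c i p f : atlas c -> ch_dom c p -> smooth f ->
  derivable (fun x => f (ch_inv c x)) (ch_map c p) (delta_mx 0 i).
Proof.
move=> ac cp sf; have [_ /(_ i)[d _]] := sf c ac 1%N.
exact: d (im_map cp).
Qed.

Lemma partialD c i p f g : atlas c -> ch_dom c p -> smooth f -> smooth g ->
  partial c i p (fun q => f q + g q) = partial c i p f + partial c i p g.
Proof.
move=> ac cp sf sg.
rewrite /partial.
by rewrite (@deriveD R _ _ (fun x => f (ch_inv c x)) (fun x => g (ch_inv c x)));
  [|exact: smooth_derivable|exact: smooth_derivable].
Qed.

Lemma partialM c i p f g : atlas c -> ch_dom c p -> smooth f -> smooth g ->
  partial c i p (fun q => f q * g q) = f p * partial c i p g + g p * partial c i p f.
Proof.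
move=> ac cp sf sg.
rewrite /partial.
rewrite (@deriveM R _ (fun x => f (ch_inv c x)) (fun x => g (ch_inv c x)));
  [|exact: smooth_derivable|exact: smooth_derivable].
by rewrite (sa_mapK aM).
Qed.

Lemma partial_cst c i p (a : R) : partial c i p (fun=> a) = 0.
Proof. exact: derive_cst. Qed.

Lemma partial_near c i p f g : atlas c -> ch_dom c p ->
  (\forall q \near p, f q = g q) -> partial c i p f = partial c i p g.
Proof.
move=> ac cp fg; apply: near_eq_derive.
by apply: (near_inv (P := fun q => f q = g q) ac (im_map cp)); rewrite (sa_mapK aM).
Qed.

Lemma tangent_nonsmooth p v f : tangent p v -> ~ smooth f -> v f = 0.
Proof. by case=> _; exact. Qed.

Lemma tangentD p v f g : tangent p v -> smooth f -> smooth g ->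
  v (fun q => f q + g q) = v f + v g.
Proof.
move=> [[c [ac cp [a va]]] _] sf sg; rewrite !va//; last exact: smoothD.
rewrite -big_split /=; apply: eq_bigr => i _; rewrite -mulrDr.
by have := partialD i ac cp sf sg; rewrite /partial => ->.
Qed.

Lemma tangentM p v f g : tangent p v -> smooth f -> smooth g ->
  v (fun q => f q * g q) = f p * v g + g p * v f.
Proof.
move=> [[c [ac cp [a va]]] _] sf sg; rewrite !va//; last exact: smoothM.
rewrite !mulr_sumr -big_split /=; apply: eq_bigr => i _.
by have := partialM i ac cp sf sg; rewrite /partial => ->; rewrite /=; ring.
Qed.

Lemma tangent_cst p v (a : R) : tangent p v -> v (fun=> a) = 0.
Proof.
move=> [[c [ac cp [b vb]]] _]; rewrite vb; last exact: smooth_cst.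
by rewrite big1// => i _; have := partial_cst c i p a; rewrite /partial => ->; rewrite mulr0.
Qed.

Lemma tangent_near p v f g : tangent p v -> smooth f -> smooth g ->
  (\forall q \near p, f q = g q) -> v f = v g.
Proof.
move=> [[c [ac cp [a va]]] _] sf sg fg; rewrite !va//; apply: eq_bigr => i _.
by have := partial_near i ac cp fg; rewrite /partial => ->.
Qed.

Lemma tangentZ p v (a : R) f : tangent p v -> smooth f ->
  v (fun q => a * f q) = a * v f.
Proof.
move=> tv sf; rewrite (tangentM tv (smooth_cst a) sf) (tangent_cst _ tv).
by rewrite mulr0 addr0.
Qed.

Lemma tangentN p v f : tangent p v -> smooth f -> v (fun q => - f q) = - v f.
Proof.
move=> tv sf; rewrite (_ : (fun q => - f q) = (fun q => -1 * f q)).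
  by rewrite (tangentZ _ tv)// mulN1r.
by apply/funext => q; rewrite mulN1r.
Qed.

Lemma tangentB p v f g : tangent p v -> smooth f -> smooth g ->
  v (fun q => f q - g q) = v f - v g.
Proof.
by move=> tv sf sg; rewrite (tangentD tv sf (smoothN sg)) (tangentN tv sg).
Qed.

Lemma tangent_sum p v (I : Type) (r : seq I) (P : pred I) (F : I -> M -> R) :
  tangent p v -> (forall i, P i -> smooth (F i)) ->
  v (fun q => \sum_(i <- r | P i) F i q) = \sum_(i <- r | P i) v (F i).
Proof.
move=> tv sF; elim: r => [|i r IH].
  rewrite big_nil; under eq_fun do rewrite big_nil; exact: tangent_cst tv.
rewrite big_cons; under eq_fun do rewrite big_cons.
case Pi: (P i) => //; rewrite (tangentD tv)// ?IH//; first exact: sF.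
exact: smooth_sum.
Qed.

Lemma partial_change c d i p f : atlas c -> atlas d -> ch_dom c p -> ch_dom d p ->
  smooth f -> partial d i p f = \sum_(j < mdim M) partial c j p f *
    'D_(delta_mx 0 i) (fun x => ch_map c (ch_inv d x) 0 j) (ch_map d p).
Proof.
move=> ac ad cp dp sf.
pose phi x := ch_map c (ch_inv d x).
have phip : phi (ch_map d p) = ch_map c p by rewrite /phi (sa_mapK aM).
have cphi : {for ch_map d p, continuous phi}.
  apply: continuous_comp; first exact: sa_inv_continuous (im_map dp).
  by rewrite (sa_mapK aM)//; exact: sa_map_continuous.
have dphi j : is_derive (ch_map d p) (delta_mx 0 i) (fun x => phi x 0 j)
   ('D_(delta_mx 0 i) (fun x => phi x 0 j) (ch_map d p)).
  apply/derivableP; have [_ /(_ i)[D _]] := sa_transition aM ad ac j 1%N.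
  by apply: D; exists p.
have := @is_derive_comp _ _ _ (ch_im c) (fun x => f (ch_inv c x)) phi (ch_map d p)
  (delta_mx 0 i) _ (sa_im_open aM ac) (sf c ac 1%N) _ cphi dphi.
rewrite phip => /(_ (im_map cp))[_ <-].
apply: near_eq_derive; apply: (near_inv (P := fun q => f q = f (ch_inv c (ch_map c q))) ad (im_map dp)).
by rewrite (sa_mapK aM)//; apply: filterS (near_dom ac cp) => q cq; rewrite (sa_mapK aM).
Qed.

(** The definition of [tangent] provides coordinates in some chart only; the chain rule for the
    transition map carries them to any chart at [p], so that two tangent vectors can be added. *)
Lemma tangent_chart c p v : atlas c -> ch_dom c p -> tangent p v ->
  exists a : 'rV[R]_(mdim M), forall f, smooth f ->
    v f = \sum_(i < mdim M) a 0 i * partial c i p f.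
Proof.
move=> ac cp [[d [ad dp [a va]]] _].
exists (\row_j \sum_(i < mdim M) a 0 i *
  'D_(delta_mx 0 i) (fun x => ch_map c (ch_inv d x) 0 j) (ch_map d p)) => f sf.
rewrite va//.
under eq_bigr => i _.
  have := partial_change i ac ad cp dp sf; rewrite {1}/partial => ->.
  rewrite mulr_sumr; over.
rewrite exchange_big /=; apply: eq_bigr => j _; rewrite mxE mulr_suml.
by apply: eq_bigr => i _; rewrite -mulrA; congr (_ * _); rewrite mulrC.
Qed.

Lemma tangent0 p : tangent p (fun=> 0).
Proof.
split=> //; have [c ac cp] := sa_cover aM p; exists c; split=> //; exists 0 => f sf.
by rewrite big1// => i _; rewrite mxE mul0r.
Qed.

Lemma tangent_lin p (a : R) u v : tangent p u -> tangent p v ->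
  tangent p (fun f => a * u f + v f).
Proof.
move=> tu tv; split; last first.
  by move=> f nf; rewrite (tangent_nonsmooth tu)// (tangent_nonsmooth tv)// mulr0 addr0.
have [c ac cp] := sa_cover aM p; exists c; split=> //.
have [b Hb] := tangent_chart ac cp tu; have [e He] := tangent_chart ac cp tv.
exists (a *: b + e) => f sf; rewrite Hb// He// mulr_sumr -big_split /=.
by apply: eq_bigr => i _; rewrite !mxE mulrDl mulrA.
Qed.

Lemma tangent_scale p (a : R) u : tangent p u -> tangent p (fun f => a * u f).
Proof.
move=> tu; have := tangent_lin a tu (tangent0 p).
by under eq_fun do rewrite addr0.
Qed.

Lemma tangent_add p u v : tangent p u -> tangent p v -> tangent p (fun f => u f + v f).
Proof.
move=> tu tv; have := tangent_lin 1 tu tv.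
by under eq_fun do rewrite mul1r.
Qed.

Lemma tangent_bigsum p (I : Type) (r : seq I) (P : pred I) (a : I -> R)
    (u : I -> (M -> R) -> R) : (forall i, P i -> tangent p (u i)) ->
  tangent p (fun f => \sum_(i <- r | P i) a i * u i f).
Proof.
move=> tu; elim: r => [|i r IH].
  by under eq_fun do rewrite big_nil; exact: tangent0.
under eq_fun do rewrite big_cons.
by case Pi: (P i) => //; apply: tangent_lin => //; exact: tu.
Qed.

Lemma open_chart_preim c (O : set M) : atlas c -> open O ->
  open (ch_im c `&` ch_inv c @^-1` O).
Proof.
move=> ac oO; rewrite openE => x [cx Ox]; rewrite /interior.
apply: filterI; first exact: near_im.
by apply: (near_inv ac cx); exact: open_nbhs_nbhs.
Qed.

(** A smooth function of the coordinates, multiplied by a cut-off, extends by 0 to the whole space.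
    The extension is smooth because the support lies in the image of a compact ball, which is closed
    in a Hausdorff space. *)
Lemma bump_extension c p : atlas c -> ch_dom c p ->
  exists e : R, [/\ 0 < e,
    forall phi, smooth_on (ch_im c) phi ->
      smooth (fun q => if `[< ch_dom c q >]
        then plateau (ch_map c p) e (ch_map c q) * phi (ch_map c q) else 0) &
    \forall q \near p, ch_dom c q /\ sqdist (ch_map c p) (ch_map c q) < e].
Proof.
move=> ac cp; set y := ch_map c p.
have /nbhs_ballP[r /= r0 rim] := near_im ac (im_map cp).
(* The cut-off vanishes from [2 * e = r ^+ 2 / 2] on, strictly inside the ball of radius [r]
   contained in the image of the chart. *)
pose e := r ^+ 2 / 4.
have e0 : 0 < e by rewrite divr_gt0// exprn_gt0.
pose K := [set x | sqdist y x <= 2 * e].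
have Kim : K `<=` ch_im c.
  move=> x Kx; apply: rim; apply: (sqdist_ball r0) => /=.
  apply: le_lt_trans Kx _; rewrite /e; have : 0 < r ^+ 2 by rewrite exprn_gt0.
  lra.
pose K' := ch_inv c @` K.
have cK' : closed K'.
  apply: compact_closed; first exact: sa_hausdorff.
  apply: continuous_compact; last exact: compact_sqdist.
  apply: continuous_in_subspaceT => x; rewrite inE => /Kim cx.
  exact: sa_inv_continuous.
exists e; split=> //; last first.
  apply: filterI; first exact: near_dom.
  apply: (near_map (P := fun x => sqdist y x < e) ac cp).
  have : {for y, continuous (sqdist y)} by exact: sqdist_continuous.
  move=> /(_ [set t | t < e]); apply.
  by rewrite sqdist_refl; exact: lt_nbhsl.
move=> phi sphi d ad k; apply: ck_on_local => x dx.
(* Inside the domain of [c] the transition map gives smoothness; a point outside it has a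
   neighbourhood missing the closed set [K'], where the function is 0. *)
case: (pselect (ch_dom c (ch_inv d x))) => [cx|ncx].
  exists (ch_im d `&` ch_inv d @^-1` ch_dom c); split=> //.
  have oV := open_chart_preim ad (sa_dom_open aM ac).
  have VV : ch_im d `&` ch_inv d @^-1` ch_dom c `<=` ch_map d @` (ch_dom d `&` ch_dom c).
    by move=> z [dz cz]; exists (ch_inv d z); [split=> //; exact: dom_inv|exact: map_inv].
  apply: (@ck_on_ext _ _ _ _ (fun z => (fun w => plateau y e w * phi w) (ch_map c (ch_inv d z)))) => //.
    by move=> z [dz cz]; rewrite asboolT.
  apply: (@ck_on_comp _ _ _ _ _ (ch_im c) (fun w => plateau y e w * phi w)
    (fun z => ch_map c (ch_inv d z))) => //.
  - exact: sa_im_open.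
  - by move=> z [dz cz]; exact: im_map.
  - apply: ck_onM; [exact: sa_im_open|apply: ck_on_plateau => //; exact: sa_im_open|exact: sphi].
  - by move=> j; apply: ck_on_sub VV _; exact: sa_transition.
exists (ch_im d `&` ch_inv d @^-1` (~` K')); split.
  by split=> //= -[z Kz zx]; apply: ncx; rewrite -zx; exact/dom_inv/Kim.
apply: (@ck_on_ext _ _ _ _ (fun=> 0)); last exact: ck_on_cst.
  exact: open_chart_preim ad (closed_openC cK').
move=> z [dz nK]; case: asboolP => // cz.
rewrite plateau_eq0 ?mul0r// leNgt; apply/negP => lt.
by apply: nK; exists (ch_map c (ch_inv d z)); [exact: ltW|exact: sa_mapK].
Qed.

(** Coordinate fields [E i] and coordinate functions [y i], both cut off so as to be global. Where
    the cut-off is 1 they are dual, hence the components of a tangent vector [v] are the numbers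
    [v (y i)]. *)
Lemma local_frame_chart c p : atlas c -> ch_dom c p -> exists (E : 'I_(mdim M) -> (M -> R) -> (M -> R))
    (y : 'I_(mdim M) -> M -> R),
  [/\ forall i, vfield (E i), forall i, smooth (y i) &
   \forall q \near p, [/\ forall i j, E i (y j) q = (i == j)%:R,
     forall v, tangent q v -> v = fun f => \sum_(i < mdim M) v (y i) * E i f q &
     ch_dom c q /\ forall i f, smooth f -> E i f q = partial c i q f]].
Proof.
move=> ac cp.
have [e [e0 He ne]] := bump_extension ac cp.
set eta := plateau (ch_map c p) e in He.
pose y i q := if `[< ch_dom c q >] then eta (ch_map c q) * ch_map c q 0 i else 0.
pose E i f q := if `[< smooth f >] then if `[< ch_dom c q >]
  then eta (ch_map c q) * partial c i q f else 0 else 0.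
have sy i : smooth (y i) by apply: (He (fun x => x 0 i)) => k; exact: ck_on_coord.
have vE i : vfield (E i).
  split=> [q|f sf]; last first.
    have := He ('D_(delta_mx 0 i) (fun x => f (ch_inv c x))).
    have sD : smooth_on (ch_im c) ('D_(delta_mx 0 i) (fun x => f (ch_inv c x))).
      by move=> k; have [_ /(_ i)[]] := sf c ac k.+1.
    by move=> /(_ sD); rewrite /E (asboolT sf).
  split; last by move=> f nf; rewrite /vat /E asboolF.
  case: (pselect (ch_dom c q)) => [cq|ncq].
    exists c; split=> //; exists (eta (ch_map c q) *: delta_mx 0 i) => f sf.
    rewrite /vat /E !asboolT// (bigD1 i)//= !mxE !eqxx mulr1 big1 ?addr0// => j ji.
    by rewrite !mxE (negbTE ji) andbF mulr0 mul0r.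
  have [d ad dq] := sa_cover aM q; exists d; split=> //; exists 0 => f sf.
  rewrite /vat /E (asboolT sf) asboolF// big1// => j _.
  by rewrite mxE mul0r.
exists E, y; split=> //.
(* Differentiating [y j] at [q] requires the cut-off to be 1 on a neighbourhood of [q], hence the
   interior. *)
apply: filterS (nbhs_interior ne) => q nq.
have [cq qe] := nbhs_singleton nq.
have Ep i f : smooth f -> E i f q = partial c i q f.
  by move=> sf; rewrite /E !asboolT// /eta plateau_eq1 ?mul1r// ltW.
have Ey i j : E i (y j) q = (i == j)%:R.
  rewrite Ep// /partial.
  have -> : 'D_(delta_mx 0 i) (fun x => y j (ch_inv c x)) (ch_map c q) =
     'D_(delta_mx 0 i) (fun x : 'rV[R]_(mdim M) => x 0 j) (ch_map c q).
    apply: near_eq_derive.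
    have N1 := near_im ac (im_map cq).
    have N2 : \forall x \near ch_map c q, y j (ch_inv c x) = ch_map c (ch_inv c x) 0 j.
      apply: (near_inv (P := fun q => y j q = ch_map c q 0 j) ac (im_map cq)).
      rewrite (sa_mapK aM)//; apply: filterS nq => w [cw we].
      by rewrite /y asboolT// /eta plateau_eq1 ?mul1r// ltW.
    by apply: filterS2 N1 N2 => x cx ->; rewrite map_inv.
  by have [_ ->] := is_derive_coord (delta_mx 0 i) (ch_map c q) j; rewrite mxE eqxx eq_sym.
split=> // [v tv]; apply/funext => f.
case: (pselect (smooth f)) => [sf|nf]; last first.
  rewrite (tangent_nonsmooth tv nf) big1// => i _.
  by rewrite /E asboolF// mulr0.
have [a va] := tangent_chart ac cq tv.
rewrite va//; apply: eq_bigr => i _; rewrite Ep//; congr (_ * _).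
rewrite va// (bigD1 i)//= -Ep// Ey eqxx mulr1 big1 ?addr0// => j ji.
by rewrite -Ep// Ey (negbTE ji) mulr0.
Qed.

Lemma local_frame p : exists (E : 'I_(mdim M) -> (M -> R) -> (M -> R))
    (y : 'I_(mdim M) -> M -> R),
  [/\ forall i, vfield (E i), forall i, smooth (y i) &
   \forall q \near p, (forall i j, E i (y j) q = (i == j)%:R) /\
     forall v, tangent q v -> v = fun f => \sum_(i < mdim M) v (y i) * E i f q].
Proof.
have [c ac cp] := sa_cover aM p.
have [E [y [vE sy nE]]] := local_frame_chart ac cp.
by exists E, y; split=> //; apply: filterS nE => q [].
Qed.

End Manifold.

(** * Signature and points of locally constant signature *)

Section Inertia.
Context {R : realFieldType}.

Lemma diag_quadr n (D : 'M[R]_n) (x : 'rV[R]_n) :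
  (forall i j, i != j -> D i j = 0) ->
  (x *m D *m x^T) 0 0 = \sum_i D i i * x 0 i ^+ 2.
Proof.
move=> D0; rewrite mxE; apply: eq_bigr => i _; rewrite !mxE (bigD1 i)//=.
rewrite big1 ?addr0; first by ring.
by move=> j ji; rewrite D0// mulr0.
Qed.

(** Polarization: if the quadratic form is identically 0, its value on the sum of two unit vectors
    is twice an entry of [G], so [G] is 0. *)
Lemma anisotropic_vector n (G : 'M[R]_n) : G^T = G -> G != 0 ->
  exists v : 'rV[R]_n, (v *m G *m v^T) 0 0 != 0.
Proof.
move=> symG G0; apply: contrapT => /forallNP H.
case/eqP: G0; apply/matrixP => i j; rewrite mxE.
have q0 (v : 'rV[R]_n) : (v *m G *m v^T) 0 0 = 0 by apply/eqP; apply: contraT => hh; case: (H v hh).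
have ent (k l : 'I_n) : ((delta_mx 0 k : 'rV[R]_n) *m G *m (delta_mx 0 l : 'rV[R]_n)^T) 0 0 = G k l.
  by rewrite -rowE trmx_delta -colE !mxE.
have add00 (A B : 'M[R]_1) : (A + B) 0 0 = A 0 0 + B 0 0 by rewrite mxE.
have := q0 (delta_mx 0 i + delta_mx 0 j).
rewrite linearD /= !mulmxDl !mulmxDr !add00 !q0 add0r addr0 !ent.
have -> : G j i = G i j by rewrite -{1}symG mxE.
by move=> /eqP; rewrite -mulr2n mulrn_eq0 => /eqP.
Qed.

Lemma symmetric_congruent_diag n (G : 'M[R]_n) : G^T = G ->
  exists P, P \in unitmx /\ forall i j, i != j -> (P *m G *m P^T) i j = 0.
Proof.
elim: n G => [|n IH] G symG; first by exists 1%:M; split=> [|[]//]; exact: unitmx1.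
have [->|G0] := eqVneq G 0.
  by exists 1%:M; split=> [|i j _]; [exact: unitmx1|rewrite mulmx0 mul0mx mxE].
have [v vG] := anisotropic_vector symG G0.
have vn0 : v != 0 by apply: contraNneq vG => ->; rewrite !mul0mx mxE.
(* An invertible matrix whose first row is proportional to [v]: after the change of basis the corner
   entry is nonzero and can serve as a pivot. *)
pose Q := row_ebase v.
have [a va] : exists a, v = a *: row 0 Q.
  have rv : \rank v = 1%N.
    by apply/eqP; rewrite eqn_leq rank_leq_row lt0n mxrank_eq0.
  exists (col_ebase v 0 0); rewrite -{1}(mulmx_ebase v) -/Q rv.
  apply/rowP => j; rewrite !mxE; rewrite (bigD1 ord0)//= big1 ?addr0.
    by rewrite !mxE big_ord1 !mxE /= mulr1.
  by move=> k k0; rewrite !mxE big_ord1 !mxE eq_sym -val_eqE /= in k0 *; rewrite (negbTE k0) mulr0 mul0r.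
pose G1 : 'M[R]_(1 + n) := Q *m G *m Q^T.
have symG1 : G1^T = G1 by rewrite /G1 !trmx_mul trmxK symG mulmxA.
have d0 : G1 0 0 != 0.
  have rowq : (row 0 Q *m G *m (row 0 Q)^T) 0 0 = G1 0 0.
    by rewrite -row_mul /G1 [LHS]mxE [RHS]mxE; apply: eq_bigr => k _; rewrite !mxE.
  apply: contraNneq vG => E.
  have -> : v *m G *m v^T = (a * a) *: (row 0 Q *m G *m (row 0 Q)^T).
    by rewrite va linearZ /= -!scalemxAl -scalemxAr scalerA.
  by rewrite mxE rowq E mulr0.
pose d := G1 0 0; pose r : 'rV[R]_n := ursubmx G1; pose H := drsubmx G1.
have G1E : G1 = block_mx d%:M r r^T H.
  rewrite -{1}(submxK G1); congr block_mx.
    apply/matrixP => i j; rewrite !ord1 [RHS]mxE eqxx mulr1n /ulsubmx /lsubmx /usubmx.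
    by rewrite mxE mxE /d; congr (G1 _ _); apply/val_inj.
  by rewrite /r trmx_ursub symG1.
(* Elimination with the pivot [d]; the Schur complement [H'] is symmetric again and goes to the
   induction hypothesis. *)
pose L : 'M[R]_(1 + n) := block_mx 1%:M 0 (- d^-1 *: r^T) 1%:M.
pose H' := H - d^-1 *: (r^T *m r).
have LG : L *m G1 *m L^T = block_mx d%:M 0 0 H'.
  rewrite G1E /L tr_block_mx !mulmx_block !trmx1 !trmx0 !mul1mx !mul0mx !mulmx0 !mulmx1 !addr0.
  rewrite linearZ /= trmxK -!scalemxAl -!scalemxAr mul_scalar_mx.
  congr block_mx.
  - by rewrite scalerA mulNr mulVf// scaleN1r addNr.
  - by rewrite mul_mx_scalar scalerA mulNr mulVf// scaleN1r addNr.
  - rewrite mul_mx_scalar scalerA mulNr mulVf// scaleN1r addNr mul0mx scaler0 add0r.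
    by rewrite /H' scaleNr addrC.
have symH' : H'^T = H'.
  by rewrite /H' linearB linearZ /= trmx_mul trmxK /H trmx_drsub symG1.
have [P' [uP' dP']] := IH _ symH'.
pose B : 'M[R]_(1 + n) := block_mx 1%:M 0 0 P'.
exists (B *m L *m Q); split.
  have uQ : Q \in unitmx by exact: row_ebase_unit.
  have uL : L \in unitmx by rewrite unitmxE det_lblock !det1 mulr1 unitr1.
  have uB : B \in unitmx by rewrite unitmxE det_lblock det1 mul1r -unitmxE.
  by rewrite !unitmx_mul uB uL.
have offdiag : forall i j : 'I_(1 + n), i != j ->
    (block_mx d%:M 0 0 (P' *m H' *m P'^T) : 'M[R]_(1 + n)) i j = 0.
  move=> i j; case: (split_ordP i) => i' ->; case: (split_ordP j) => j' -> ij.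
  - by rewrite !ord1 eqxx in ij.
  - by rewrite block_mxEur mxE.
  - by rewrite block_mxEdl mxE.
  - by rewrite block_mxEdr dP'//; apply: contraNneq ij => ->.
move=> i j ij.
have -> : B *m L *m Q *m G *m (B *m L *m Q)^T = block_mx d%:M 0 0 (P' *m H' *m P'^T).
  transitivity (B *m (L *m G1 *m L^T) *m B^T).
    by rewrite /G1 !trmx_mul !mulmxA.
  rewrite LG /B tr_block_mx !mulmx_block !trmx1 !trmx0.
  by rewrite !mul1mx !mul0mx !mulmx0 !mulmx1 !addr0 !add0r !mul0mx.
exact: offdiag.
Qed.

(* Sylvester: a subspace on which [G] is positive definite meets the span of the
   nonpositive diagonal directions trivially. *)
Lemma posdef_le_index r n (G : 'M[R]_n) (W : 'M[R]_(r, n)) (P : 'M[R]_n) :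
  (forall c : 'rV[R]_r, c != 0 -> 0 < (c *m (W *m G *m W^T) *m c^T) 0 0) ->
  P \in unitmx -> (forall i j, i != j -> (P *m G *m P^T) i j = 0) ->
  (r <= #|[pred i | 0 < (P *m G *m P^T)%R i i]%R|)%N.
Proof.
move=> posW uP dP; set pos := [pred i | _]; rewrite leqNgt; apply/negP => lt.
pose A := W *m invmx P.
pose A' : 'M[R]_(r, #|pos|) := \matrix_(i, j) A i (enum_val j).
have : kermx A' != 0.
  rewrite -mxrank_eq0 mxrank_ker subn_eq0 -ltnNge.
  exact: leq_ltn_trans (rank_leq_col _) lt.
move=> /rowV0Pn[c /sub_kermxP cA' c0].
have := posW c c0; apply/negP; rewrite -leNgt.
pose x := c *m A.
have xP : x *m P = c *m W by rewrite /x /A -!mulmxA mulVmx// mulmx1.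
have -> : c *m (W *m G *m W^T) *m c^T = x *m (P *m G *m P^T) *m x^T.
  have -> : c *m (W *m G *m W^T) *m c^T = (c *m W) *m G *m (c *m W)^T.
    by rewrite trmx_mul !mulmxA.
  by rewrite -xP trmx_mul !mulmxA.
rewrite diag_quadr//; apply: sumr_le0 => i _.
have [ip|ip] := boolP (pos i).
  suff -> : x 0 i = 0 by rewrite expr0n mulr0.
  have <- : (c *m A') 0 (enum_rank_in ip i) = 0 by rewrite cA' mxE.
  rewrite /x [LHS]mxE [RHS]mxE; apply: eq_bigr => k _; congr (_ * _).
  by rewrite [RHS]mxE enum_rankK_in.
by rewrite mulr_le0_ge0 ?sqr_ge0// leNgt.
Qed.

Lemma le_quad_bound (e t x y : R) : - e <= t <= e ->
  - (e * ((x ^+ 2 + y ^+ 2) / 2)) <= x * t * y.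
Proof.
move=> /andP[h1 h2]; rewrite -subr_ge0.
have -> : x * t * y - - (e * ((x ^+ 2 + y ^+ 2) / 2)) =
  (e + t) * (x + y) ^+ 2 / 4 + (e - t) * (x - y) ^+ 2 / 4 by field.
by rewrite addr_ge0// mulr_ge0 ?invr_ge0 ?ler0n// mulr_ge0 ?sqr_ge0//; lra.
Qed.

(** By x y <= (x^2 + y^2) / 2, a perturbation with entries of size at most [e] lowers the quadratic
    form by at most [r%:R * e] times the sum of squares. *)
Lemma near_diag_posdef r (D A : 'M[R]_r) (e : R) :
  (forall i j, i != j -> D i j = 0) -> (forall i, r%:R * e < D i i) ->
  (forall i j, `|A i j - D i j| <= e) ->
  forall c : 'rV[R]_r, c != 0 -> 0 < (c *m A *m c^T) 0 0.
Proof.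
move=> D0 De Ae c c0.
have -> : c *m A *m c^T = c *m D *m c^T + c *m (A - D) *m c^T.
  by rewrite -mulmxDl -mulmxDr addrC subrK.
rewrite mxE diag_quadr//.
have H : - \sum_i (r%:R * e * c 0 i ^+ 2) <= (c *m (A - D) *m c^T) 0 0.
  have e0 (i : 'I_r) : 0 <= e by apply: le_trans (Ae i i).
  pose S := \sum_i \sum_j e * ((c 0 i ^+ 2 + c 0 j ^+ 2) / 2).
  have SE : S = \sum_i (r%:R * e * c 0 i ^+ 2).
    transitivity (\sum_(i < r) (r%:R * e * c 0 i ^+ 2 / 2 + e * (\sum_j c 0 j ^+ 2) / 2)).
      apply: eq_bigr => i _.
      transitivity (\sum_(j < r) (e * c 0 i ^+ 2 / 2 + e * c 0 j ^+ 2 / 2)).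
        by apply: eq_bigr => j _; ring.
      rewrite big_split /= sumr_const card_ord -mulr_suml -mulr_sumr; congr (_ + _).
      by rewrite -mulr_natl; ring.
    rewrite big_split /= sumr_const card_ord -mulr_natl.
    by rewrite -mulr_suml -!mulr_sumr; field.
  rewrite -SE -sumrN mxE; apply: ler_sum => i _.
  rewrite [(c *m _) 0 i]mxE mulr_suml -sumrN.
  apply: ler_sum => j _; rewrite !mxE.
  rewrite [c 0 i ^+ 2 + _]addrC; apply: le_quad_bound; by have := Ae j i; rewrite ler_norml.
apply: lt_le_trans (lerD (lexx _) H).
rewrite -sumrB.
have [i ci] : exists i, c 0 i != 0.
  apply: contrapT => /forallNP h; case/eqP: c0; apply/rowP => i; rewrite mxE.
  by apply/eqP; apply: contraT => hh; case: (h i hh).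
rewrite (bigD1 i)//=; apply: ltr_pwDl.
  by rewrite -mulrBl mulr_gt0 ?subr_gt0// exprn_even_gt0//= ci orbT.
by apply: sumr_ge0 => j _; rewrite -mulrBl mulr_ge0 ?sqr_ge0// subr_ge0 ltW.
Qed.

End Inertia.

(** * Bilinear forms on a tangent space and their signature *)

Section Form.
Context {R : realType} {M : charted R} (aM : smooth_atlas M) (g : tensor02 M) (p : M).
Local Notation n := (mdim M).

(** The pointwise part of [singular_metric]. It also applies to the warped metric and to pull-backs,
    for which the smoothness clause on arbitrary pairs of fields is not established. *)
Definition bilinear_at : Prop :=
  (forall u v, tangent p u -> tangent p v -> g p u v = g p v u) /\
  (forall (a : R) u v w, tangent p u -> tangent p v -> tangent p w ->
    g p (fun f => a * u f + v f) w = a * g p u w + g p v w).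

Hypothesis bg : bilinear_at.

Lemma form_sym u v : tangent p u -> tangent p v -> g p u v = g p v u.
Proof. by case: bg => + _; apply. Qed.

Lemma form_linl (a : R) u v w : tangent p u -> tangent p v -> tangent p w ->
  g p (fun f => a * u f + v f) w = a * g p u w + g p v w.
Proof. by case: bg => _; apply. Qed.

Lemma form0l w : tangent p w -> g p (fun=> 0) w = 0.
Proof.
move=> tw; have := form_linl (-1) (tangent0 aM p) (tangent0 aM p) tw.
have -> : (fun f : M -> R => -1 * (0 : R) + 0) = (fun=> 0).
  by apply/funext => f; rewrite mulr0 addr0.
by move=> ->; rewrite mulN1r addNr.
Qed.

Lemma form_addl u v w : tangent p u -> tangent p v -> tangent p w ->
  g p (fun f => u f + v f) w = g p u w + g p v w.
Proof.
move=> tu tv tw; have := form_linl 1 tu tv tw; rewrite mul1r => <-.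
by congr (g p _ w); apply/funext => f; rewrite mul1r.
Qed.

Lemma form_scalel (a : R) u w : tangent p u -> tangent p w ->
  g p (fun f => a * u f) w = a * g p u w.
Proof.
move=> tu tw; have := form_linl a tu (tangent0 aM p) tw; rewrite form0l// addr0 => <-.
by congr (g p _ w); apply/funext => f; rewrite addr0.
Qed.

Lemma form_suml (I : Type) (r : seq I) (P : pred I) (a : I -> R) u w :
  (forall i, P i -> tangent p (u i)) -> tangent p w ->
  g p (fun f => \sum_(i <- r | P i) a i * u i f) w =
  \sum_(i <- r | P i) a i * g p (u i) w.
Proof.
move=> tu tw; elim: r => [|i r IH].
  rewrite big_nil -[RHS](form0l tw); congr (g p _ w).
  by apply/funext => f; rewrite big_nil.
rewrite big_cons; case Pi: (P i).
  rewrite -IH -form_linl//; [|exact: tu|exact: tangent_bigsum].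
  by congr (g p _ w); apply/funext => f; rewrite big_cons Pi.
rewrite -IH.
by congr (g p _ w); apply/funext => f; rewrite big_cons Pi.
Qed.

Lemma form_sumr (I : Type) (r : seq I) (P : pred I) (a : I -> R) u w :
  (forall i, P i -> tangent p (u i)) -> tangent p w ->
  g p w (fun f => \sum_(i <- r | P i) a i * u i f) =
  \sum_(i <- r | P i) a i * g p w (u i).
Proof.
move=> tu tw; rewrite form_sym ?form_suml//; last exact: tangent_bigsum.
by apply: eq_bigr => i Pi; rewrite form_sym//; exact: tu.
Qed.

Lemma form_addr u v w : tangent p u -> tangent p v -> tangent p w ->
  g p w (fun f => u f + v f) = g p w u + g p w v.
Proof.
move=> tu tv tw; rewrite form_sym ?form_addl//; last exact: tangent_add.
by rewrite form_sym// (form_sym tv).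
Qed.

Lemma form_scaler (a : R) u w : tangent p u -> tangent p w ->
  g p w (fun f => a * u f) = a * g p w u.
Proof.
move=> tu tw; rewrite form_sym ?form_scalel//; last exact: tangent_scale.
by rewrite form_sym.
Qed.

Definition combine m (P : 'M[R]_(m, n)) (e : 'I_n -> (M -> R) -> R) (i : 'I_m) :
  (M -> R) -> R := fun f => \sum_j P i j * e j f.

Definition gram (e : 'I_n -> (M -> R) -> R) : 'M[R]_n := \matrix_(i, j) g p (e i) (e j).

Lemma tangent_combine m (P : 'M[R]_(m, n)) e i :
  (forall j, tangent p (e j)) -> tangent p (combine P e i).
Proof. by move=> te; apply: tangent_bigsum => // j _; exact: te. Qed.

Lemma form_combine m (P : 'M[R]_(m, n)) e i j : (forall j, tangent p (e j)) ->
  g p (combine P e i) (combine P e j) = (P *m gram e *m P^T) i j.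
Proof.
move=> te; rewrite form_suml//; last exact: tangent_combine.
rewrite -mulmxA mxE; apply: eq_bigr => k _; congr (_ * _).
rewrite form_sumr// mxE; apply: eq_bigr => l _.
by rewrite !mxE mulrC.
Qed.

(** Expanding each basis in the other gives two matrices, and uniqueness of the coordinates makes
    them mutually inverse. *)
Lemma basis_change e e' : tangent_basis p e -> tangent_basis p e' ->
  exists P : 'M[R]_n, P \in unitmx /\ forall i, e' i = combine P e i.
Proof.
move=> [te se] [te' se'].
have ex (b c : 'I_n -> (M -> R) -> R) : (forall v, tangent p v ->
     exists! a : 'rV[R]_n, v = fun f => \sum_(i < n) a 0 i * b i f) ->
   (forall i, tangent p (c i)) -> exists P : 'M[R]_n, forall i, c i = combine P b i.
  move=> sb tc.
  have H i : exists a : 'rV[R]_n, c i = fun f => \sum_(j < n) a 0 j * b j f.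
    by have [a [Ha _]] := sb _ (tc i); exists a.
  have [a Ha] := choice H.
  exists (\matrix_i a i) => i; rewrite (Ha i); apply/funext => f.
  by apply: eq_bigr => j _; rewrite mxE.
have [P HP] := ex _ _ se te'; have [Q HQ] := ex _ _ se' te.
exists P; split=> //.
have QP : Q *m P = 1%:M.
  apply/row_matrixP => i; have [a [Ha ua]] := se _ (te i).
  rewrite -(ua (row i (Q *m P))); last first.
    rewrite {1}HQ; apply/funext => f; rewrite /combine.
    under eq_bigr => j _ do rewrite HP /combine mulr_sumr.
    rewrite exchange_big /=; apply: eq_bigr => k _; rewrite !mxE mulr_suml.
    by apply: eq_bigr => j _; rewrite mulrA.
  apply: ua; apply/funext => f; rewrite (bigD1 i)//= !mxE eqxx mul1r big1 ?addr0// => j ji.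
  by rewrite !mxE eq_sym (negbTE ji) mul0r.
by case: (mulmx1_unit QP).
Qed.

Lemma basis_combine e (P : 'M[R]_n) : tangent_basis p e -> P \in unitmx ->
  tangent_basis p (combine P e).
Proof.
move=> [te se] uP; split=> [i|v tv]; first exact: tangent_combine.
have comb (b : 'rV[R]_n) : (fun f => \sum_i b 0 i * combine P e i f) =
    (fun f => \sum_j (b *m P) 0 j * e j f).
  apply/funext => f; rewrite /combine; under eq_bigr do rewrite mulr_sumr.
  rewrite exchange_big /=; apply: eq_bigr => j _; rewrite mxE mulr_suml.
  by apply: eq_bigr => i _; rewrite mulrA.
have [a [Ha ua]] := se _ tv; exists (a *m invmx P); split.
  by rewrite comb -mulmxA mulVmx// mulmx1.
move=> b; rewrite comb => /ua ->.
by rewrite -mulmxA mulmxV// mulmx1.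
Qed.

Lemma exists_signature e : tangent_basis p e -> exists r s, has_signature g p r s.
Proof.
move=> be; have te := be.1.
have symG : (gram e)^T = gram e.
  by apply/matrixP => i j; rewrite !mxE form_sym.
have [P [uP dP]] := symmetric_congruent_diag symG.
exists #|[pred i | 0 < g p (combine P e i) (combine P e i)]|,
  #|[pred i | g p (combine P e i) (combine P e i) < 0]|.
exists (combine P e); split=> //; first exact: basis_combine.
by move=> i j ij; rewrite form_combine// dP.
Qed.

Lemma signature_le r s : has_signature g p r s -> (r + s <= n)%N.
Proof.
move=> [e [_ _ <- <-]]; rewrite -[n in leqRHS]card_ord.
set A := [pred i | _]; set B := [pred i | _].
have AB : [predI A & B] =i pred0.
  move=> i; rewrite !inE; apply/negP => /andP[h1 h2].
  by have := lt_trans h1 h2; rewrite ltxx.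
by rewrite -cardUI (eq_card0 AB) addn0 max_card.
Qed.

Lemma posdef_le_signature e r0 (W : 'M[R]_(r0, n)) r s : tangent_basis p e ->
  has_signature g p r s ->
  (forall c : 'rV[R]_r0, c != 0 -> 0 < (c *m (W *m gram e *m W^T) *m c^T) 0 0) ->
  (r0 <= r)%N.
Proof.
move=> be [e' [be' oe' <- _]] pW; have te := be.1.
have [P [uP eP]] := basis_change be be'.
have D i j : (P *m gram e *m P^T) i j = g p (e' i) (e' j) by rewrite -form_combine// !eP.
apply: leq_trans (posdef_le_index pW uP _) _.
  by move=> i j ij; rewrite D oe'.
by apply/eq_leq/eq_card => i; rewrite !inE D.
Qed.

Lemma negdef_le_signature e r0 (W : 'M[R]_(r0, n)) r s : tangent_basis p e ->
  has_signature g p r s ->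
  (forall c : 'rV[R]_r0, c != 0 -> 0 < (c *m (W *m - gram e *m W^T) *m c^T) 0 0) ->
  (r0 <= s)%N.
Proof.
move=> be [e' [be' oe' _ <-]] pW; have te := be.1.
have [P [uP eP]] := basis_change be be'.
have D i j : (P *m - gram e *m P^T) i j = - g p (e' i) (e' j).
  by rewrite mulmxN mulNmx mxE -form_combine// !eP.
apply: leq_trans (posdef_le_index pW uP _) _.
  by move=> i j ij; rewrite D oe'// oppr0.
by apply/eq_leq/eq_card => i; rewrite !inE D oppr_gt0.
Qed.

Lemma signature_posdef e r s : tangent_basis p e -> has_signature g p r s ->
  exists W : 'M[R]_(r, n),
    (forall i j, i != j -> (W *m gram e *m W^T) i j = 0) /\
    (forall i, 0 < (W *m gram e *m W^T) i i).
Proof.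
move=> be [e' [be' oe' <- _]]; have te := be.1.
have [P [uP eP]] := basis_change be be'.
set pos := [pred i | _].
exists (\matrix_(i < #|pos|) row (enum_val i) P).
have D i j : ((\matrix_(i < #|pos|) row (enum_val i) P) *m gram e *m
    (\matrix_(i < #|pos|) row (enum_val i) P)^T) i j = g p (e' (enum_val i)) (e' (enum_val j)).
  rewrite -form_combine// !eP; congr (g p _ _); apply/funext => f;
  by apply: eq_bigr => k _; rewrite !mxE.
split=> [i j ij|i]; rewrite D; last by have := enum_valP i; rewrite inE.
by apply: oe'; rewrite (inj_eq enum_val_inj).
Qed.

Lemma signature_negdef e r s : tangent_basis p e -> has_signature g p r s ->
  exists W : 'M[R]_(s, n),
    (forall i j, i != j -> (W *m - gram e *m W^T) i j = 0) /\
    (forall i, 0 < (W *m - gram e *m W^T) i i).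
Proof.
move=> be [e' [be' oe' _ <-]]; have te := be.1.
have [P [uP eP]] := basis_change be be'.
set neg := [pred i | _].
exists (\matrix_(i < #|neg|) row (enum_val i) P).
have D i j : ((\matrix_(i < #|neg|) row (enum_val i) P) *m - gram e *m
    (\matrix_(i < #|neg|) row (enum_val i) P)^T) i j = - g p (e' (enum_val i)) (e' (enum_val j)).
  rewrite mulmxN mulNmx mxE -form_combine// !eP; congr (- g p _ _); apply/funext => f;
  by apply: eq_bigr => k _; rewrite !mxE.
split=> [i j ij|i]; rewrite D; last by have := enum_valP i; rewrite inE oppr_gt0.
by rewrite oe' ?oppr0// (inj_eq enum_val_inj).
Qed.

(** Sylvester's law: the positive directions of one orthogonal basis span a positive definite
    subspace, whose dimension the positive index of any other bounds; likewise for the negative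
    ones. *)
Lemma signature_unique r s r' s' :
  has_signature g p r s -> has_signature g p r' s' -> r = r' /\ s = s'.
Proof.
suff H a b c d : has_signature g p a b -> has_signature g p c d -> (a <= c)%N /\ (b <= d)%N.
  move=> h h'; have [h1 h2] := H _ _ _ _ h h'; have [h3 h4] := H _ _ _ _ h' h.
  by split; apply/eqP; rewrite eqn_leq ?h1 ?h2.
move=> h h'; have [e [be _ _ _]] := h.
have [W [W0 Wp]] := signature_posdef be h; have [V [V0 Vp]] := signature_negdef be h.
split.
  (* The matrix is exactly diagonal, so the perturbation lemma is used with tolerance 0. *)
  apply: (posdef_le_signature be h' (W := W)); apply: (near_diag_posdef (e := 0) W0).
    by move=> i; rewrite mulr0.
  by move=> i j; rewrite subrr normr0.
apply: (negdef_le_signature be h' (W := V)); apply: (near_diag_posdef (e := 0) V0).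
  by move=> i; rewrite mulr0.
by move=> i j; rewrite subrr normr0.
Qed.

End Form.

(** * Semicontinuity of the signature and density of regular points *)

Section Regular.
Context {R : realType} {M : charted R} (aM : smooth_atlas M) (g : tensor02 M).
Hypothesis mg : singular_metric g.
Local Notation n := (mdim M).

Lemma metric_bilinear p : bilinear_at g p.
Proof. by split=> *; [apply: (Defs.metric_sym mg)|apply: (metric_linear mg)]. Qed.

Lemma frame_basis q (E : 'I_n -> (M -> R) -> (M -> R)) (y : 'I_n -> M -> R) :
  (forall i, vfield (E i)) ->
  (forall i j, E i (y j) q = (i == j)%:R) ->
  (forall v, tangent q v -> v = fun f => \sum_(i < n) v (y i) * E i f q) ->
  tangent_basis q (fun i => vat (E i) q).
Proof.
move=> vE Ey Es; split=> [i|v tv]; first by have [+ _] := vE i; apply.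
exists (\row_i v (y i)); split.
  by rewrite {1}(Es v tv); apply/funext => f; apply: eq_bigr => i _; rewrite mxE.
move=> a Ha; apply/rowP => j; rewrite mxE Ha (bigD1 j)//= /vat Ey eqxx mulr1.
by rewrite big1 ?addr0// => i ij; rewrite Ey (negbTE ij) mulr0.
Qed.

Lemma signature_exists p : exists r s, has_signature g p r s.
Proof.
have [E [y [vE sy /nbhs_singleton[Ey Es]]]] := local_frame aM p.
exact: (exists_signature aM (metric_bilinear p) (frame_basis vE Ey Es)).
Qed.

Lemma near_posdef (p : M) r (A : M -> 'M[R]_r) :
  (forall i j, {for p, continuous (fun q => A q i j)}) ->
  (forall i j, i != j -> A p i j = 0) -> (forall i, 0 < A p i i) ->
  \forall q \near p, forall c : 'rV[R]_r, c != 0 -> 0 < (c *m A q *m c^T) 0 0.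
Proof.
move=> cA A0 Ap.
have [e [e0 He]] : exists e : R, 0 < e /\ forall i, r%:R * e < A p i i.
  (* The neutral value 1 keeps [m] positive when [r = 0], and the denominator [r.+1] below makes
     [r%:R * e < m] strict for every [r]. *)
  pose m : R := \big[Num.min/1]_(i < r) A p i i.
  have m0 : 0 < m by rewrite /m; elim/big_ind: _ => // x y x0 y0; rewrite lt_min x0.
  exists (m / r.+1%:R); split; first by rewrite divr_gt0.
  move=> i; apply: (@lt_le_trans _ _ m); last exact: bigmin_le.
  rewrite mulrA ltr_pdivrMr// mulrC ltr_pM2l// ltr_nat.
  exact: ltnSn.
near=> q; apply: (near_diag_posdef A0 He) => i j.
move: i j; near: q; apply: filter_forall => i; apply: filter_forall => j.
have /cvgrPdist_le/(_ _ e0) := cA i j.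
by apply: filterS => q; rewrite distrC.
Unshelve. all: by end_near. Qed.

(** Fixed combinations of the frame fields that span a definite subspace at [p] still do so nearby,
    by continuity of the Gram matrix; so neither index can drop. *)
Lemma signature_lsc p r s : has_signature g p r s ->
  \forall q \near p, forall r' s', has_signature g q r' s' -> (r <= r')%N /\ (s <= s')%N.
Proof.
move=> h; have [E [y [vE sy nE]]] := local_frame aM p.
pose G q := gram g q (fun i => vat (E i) q).
have cG i j : {for p, continuous (fun q => G q i j)}.
  have -> : (fun q => G q i j) = pairing g (E i) (E j).
    by apply/funext => q; rewrite mxE.
  by apply: (smooth_continuous aM); exact: metric_smooth.
have cW m (W : 'M[R]_(m, n)) i j : {for p, continuous (fun q => (W *m G q *m W^T) i j)}.
  have -> : (fun q => (W *m G q *m W^T) i j) =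
     (fun q => \sum_k (\sum_l W i l * G q l k) * W^T k j).
    by apply/funext => q; rewrite mxE; apply: eq_bigr => k _; rewrite mxE.
  apply: cvg_big => [|k _]; first exact: add_continuous.
  apply: cvgM; last exact: cvg_cst.
  apply: cvg_big => [|l _]; first exact: add_continuous.
  by apply: cvgM; [exact: cvg_cst|exact: cG].
have cV m (W : 'M[R]_(m, n)) i j : {for p, continuous (fun q => (W *m - G q *m W^T) i j)}.
  have -> : (fun q => (W *m - G q *m W^T) i j) = (fun q => - (W *m G q *m W^T) i j).
    by apply/funext => q; rewrite mulmxN mulNmx mxE.
  by apply: cvgN; exact: cW.
have [Ey Es] := nbhs_singleton nE; have bp := frame_basis vE Ey Es.
have [W [W0 Wp]] := signature_posdef aM (metric_bilinear p) bp h.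
have [V [V0 Vp]] := signature_negdef aM (metric_bilinear p) bp h.
have N1 := near_posdef (cW _ W) W0 Wp.
have N2 := near_posdef (cV _ V) V0 Vp.
near=> q => r' s' h'.
have bq : tangent_basis q (fun i => vat (E i) q).
  have [Eyq Esq] : (forall i j, E i (y j) q = (i == j)%:R) /\
     forall v, tangent q v -> v = fun f => \sum_(i < mdim M) v (y i) * E i f q.
    by near: q.
  exact: frame_basis vE Eyq Esq.
split.
  apply: (posdef_le_signature aM (metric_bilinear q) bq h' (W := W)).
  by near: q.
apply: (negdef_le_signature aM (metric_bilinear q) bq h' (W := V)).
by near: q.
Unshelve. all: by end_near. Qed.

(* The rank r + s is maximal at some point of [O]; near it neither index can grow. *)
Lemma regular_dense (O : set M) p : open O -> O p ->
  exists q, O q /\ regular_point g q.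
Proof.
move=> oO Op.
pose P m := `[< exists q r s, [/\ O q, has_signature g q r s & (r + s)%N = m] >].
have exP : exists m, P m.
  have [r [s h]] := signature_exists p.
  by exists (r + s)%N; apply/asboolP; exists p, r, s.
have ubP m : P m -> (m <= n)%N.
  by move=> /asboolP[q [r [s [_ h <-]]]]; exact: signature_le h.
case: (ex_maxnP exP ubP) => m /asboolP[q [r [s [Oq h <-]]]] maxm.
exists q; split=> //; exists r, s.
have N := signature_lsc h; near=> q'.
have Oq' : O q' by near: q'; exact: open_nbhs_nbhs.
have [r' [s' h']] := signature_exists q'.
have [h1 h2] : (r <= r')%N /\ (s <= s')%N.
  by apply: (near N q'); last exact: h'.
have h3 : (r' + s' <= r + s)%N by apply: maxm; apply/asboolP; exists q', r', s'.
have -> : r = r' by apply/eqP; rewrite eqn_leq h1 /= -(leq_add2r s'); apply: leq_trans h3 _; rewrite leq_add2l.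
have -> // : s = s' by apply/eqP; rewrite eqn_leq h2 /= -(leq_add2l r'); apply: leq_trans h3 _; rewrite leq_add2r.
Unshelve. all: by end_near. Qed.

End Regular.

(** * Product manifolds *)

Lemma cvg_prod_topology (I : Type) (K : I -> topologicalType) (T : Type)
    (G : set_system T) (h : T -> prod_topology K) (x : prod_topology K) :
  Filter G -> (forall i, h t i @[t --> G] --> x i) -> h @ G --> x.
Proof.
move=> FG H; apply/cvg_sup => i A [V [[W oW <-] /= Wx WA]].
apply: (filterS WA); apply: (H i W).
exact: open_nbhs_nbhs.
Qed.

Lemma hausdorff_pair (S T : topologicalType) :
  hausdorff_space S -> hausdorff_space T -> hausdorff_space (S * T)%type.
Proof.
move=> hS hT [a b] [a' b'] cl; congr pair.
- apply: hS => A A' nA nA'.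
  have /(_ (fst @^-1` A) (fst @^-1` A')) := cl.
  by case=> [||[u v] [/= uA uA']]; [exact: cvg_fst nA|exact: cvg_fst nA'|exists u].
- apply: hT => A A' nA nA'.
  have /(_ (snd @^-1` A) (snd @^-1` A')) := cl.
  by case=> [||[u v] [/= uA uA']]; [exact: cvg_snd nA|exact: cvg_snd nA'|exists v].
Qed.

Section ProductAtlas.
Context {R : realType} {l : nat} {B : charted R} {F : 'I_l -> charted R}.
Hypotheses (aB : smooth_atlas B) (aF : forall j, smooth_atlas (F j)).
Local Notation M := (prod_manifold B F).
Local Notation mB := (mdim B).
Local Notation mF := (\sum_(j < l) mdim (F j))%N.

Definition idxB (i : 'I_mB) : 'I_(mB + mF) := lshift _ i.
(** The rows of the fibres are concatenated by [\mxrow], which enumerates the pairs of a factor and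
    a coordinate through [tagnat.Rank]. *)
Definition idxF (j : 'I_l) (i : 'I_(mdim (F j))) : 'I_(mB + mF) :=
  rshift _ (@tagnat.Rank l (fun j => mdim (F j)) j i).

Variant idx_spec : 'I_(mB + mF) -> Type :=
  | IdxB i : idx_spec (idxB i)
  | IdxF j i : idx_spec (@idxF j i).

Lemma idxP k : idx_spec k.
Proof.
case: (split_ordP k) => [i ->|s ->]; first exact: IdxB.
by rewrite -(tagnat.sig2K s); exact: IdxF.
Qed.

Lemma sum_idx (V : nmodType) (G : 'I_(mB + mF) -> V) :
  \sum_k G k = \sum_i G (idxB i) + \sum_j \sum_i G (@idxF j i).
Proof.
rewrite big_split_ord /=; congr (_ + _).
rewrite sig_big_dep /= (reindex _ (@tagnat.sig_bij_on l (fun j => mdim (F j)))) /=.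
by apply: eq_bigr => s _; rewrite /idxF tagnat.sig2K.
Qed.

Definition partF (x : 'rV[R]_(mB + mF)) (j : 'I_l) : 'rV[R]_(mdim (F j)) :=
  submxrow (rsubmx x) j.

Lemma lsubE (x : 'rV[R]_(mB + mF)) i : lsubmx x 0 i = x 0 (idxB i).
Proof. by rewrite mxE. Qed.

Lemma partFE (x : 'rV[R]_(mB + mF)) j i : partF x j 0 i = x 0 (@idxF j i).
Proof. by rewrite /partF !mxE. Qed.

Definition join_row (a : 'rV[R]_mB) (b : forall j, 'rV[R]_(mdim (F j))) :
  'rV[R]_(mB + mF) := row_mx a (\mxrow_(j < l) b j).

Lemma lsub_join a b : lsubmx (join_row a b) = a.
Proof. exact: row_mxKl. Qed.

Lemma partF_join a b j : partF (join_row a b) j = b j.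
Proof. by rewrite /partF row_mxKr mxrowK. Qed.

Lemma join_rowK x : join_row (lsubmx x) (partF x) = x.
Proof. by rewrite /join_row submxrowK hsubmxK. Qed.

Lemma join_rowB a b i : join_row a b 0 (idxB i) = a 0 i.
Proof. by rewrite -lsubE lsub_join. Qed.

Lemma join_rowF a b j i : join_row a b 0 (@idxF j i) = b j 0 i.
Proof. by rewrite -partFE partF_join. Qed.

Lemma lsub_continuous : continuous (fun x : 'rV[R]_(mB + mF) => lsubmx x).
Proof.
move=> x; apply: continuous_mx => i j; rewrite ord1.
have -> : (fun y : 'rV[R]_(mB + mF) => lsubmx y 0 j) = (fun y => y 0 (idxB j)).
  by apply/funext => y; exact: lsubE.
exact: coord_continuous.
Qed.

Lemma partF_continuous j : continuous (fun x : 'rV[R]_(mB + mF) => partF x j).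
Proof.
move=> x; apply: continuous_mx => i k; rewrite ord1.
have -> : (fun y : 'rV[R]_(mB + mF) => partF y j 0 k) = (fun y => y 0 (@idxF j k)).
  by apply/funext => y; exact: partFE.
exact: coord_continuous.
Qed.

Lemma ck_on_lsub k (U : set 'rV[R]_(mB + mF)) i : ck_on k U (fun x => lsubmx x 0 i).
Proof.
have -> : (fun y : 'rV[R]_(mB + mF) => lsubmx y 0 i) = (fun y => y 0 (idxB i)).
  by apply/funext => y; exact: lsubE.
exact: ck_on_coord.
Qed.

Lemma ck_on_partF k (U : set 'rV[R]_(mB + mF)) j i : ck_on k U (fun x => partF x j 0 i).
Proof.
have -> : (fun y : 'rV[R]_(mB + mF) => partF y j 0 i) = (fun y => y 0 (@idxF j i)).
  by apply/funext => y; exact: partFE.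
exact: ck_on_coord.
Qed.

Lemma prB_continuous : continuous (fun p : M => p.1).
Proof. by move=> p; exact: cvg_fst. Qed.

Lemma prF_continuous j : continuous (fun p : M => p.2 j).
Proof.
move=> p; apply: (@continuous_comp _ _ _ (fun p : M => p.2) (fun q => q j)).
  exact: cvg_snd.
exact: (@proj_continuous _ (fun j => F j) j p.2).
Qed.

Section OneChart.
Variables (c : chart R B mB) (d : forall j, chart R (F j) (mdim (F j))).
Hypotheses (ac : atlas c) (ad : forall j, atlas (d j)).
Let e : chart R M (mdim M) := prod_chart c d.

Lemma prod_im x : ch_im e x <-> ch_im c (lsubmx x) /\ forall j, ch_im (d j) (partF x j).
Proof.
split=> [[p [cp dp] <-]|[[b cb bx] H]].
  rewrite -[ch_map e p]/(join_row (ch_map c p.1) (fun j => ch_map (d j) (p.2 j))).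
  by rewrite lsub_join; split=> [|j]; [exists p.1|rewrite partF_join; exists (p.2 j)].
exists (b, fun j => ch_inv (d j) (partF x j)).
  by split=> //= j; exact: (dom_inv (aF j)).
rewrite -[LHS]/(join_row (ch_map c b) (fun j => ch_map (d j) (ch_inv (d j) (partF x j)))).
rewrite -[RHS]join_rowK bx; congr (join_row _ _).
by apply: functional_extensionality_dep => j; exact: (map_inv (aF j)).
Qed.

Lemma prod_dom_open : open (ch_dom e).
Proof.
rewrite openE => -[b q] [/= cb dq]; rewrite /interior.
have N1 : \forall p \near ((b, q) : M), ch_dom c p.1.
  by apply: cvg_fst; exact: near_dom.
have N2 : \forall p \near ((b, q) : M), forall j, ch_dom (d j) (p.2 j).
  near=> p => j; move: (j); near: p; apply: filter_forall => {}j.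
  apply: (@prF_continuous j ((b, q) : M)).
  exact: near_dom.
by apply: filterS2 N1 N2 => p.
Unshelve. all: by end_near. Qed.

Lemma prod_im_open : open (ch_im e).
Proof.
rewrite openE => x /prod_im[cx dx]; rewrite /interior.
have N1 : \forall y \near x, ch_im c (lsubmx y).
  by apply: (lsub_continuous (near_im aB ac cx)).
have N2 : \forall y \near x, forall j, ch_im (d j) (partF y j).
  near=> y => j; move: (j); near: y; apply: filter_forall => {}j.
  exact: (partF_continuous (near_im (aF j) (ad j) (dx j))).
by apply: filterS2 N1 N2 => y h1 h2; apply/prod_im.
Unshelve. all: by end_near. Qed.

Lemma prod_mapK p : ch_dom e p -> ch_inv e (ch_map e p) = p.
Proof.
case: p => b q [/= cb dq].
pose x := join_row (ch_map c b) (fun j => ch_map (d j) (q j)).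
rewrite -[LHS]/(ch_inv c (lsubmx x), fun j => ch_inv (d j) (partF x j)).
rewrite /x lsub_join (sa_mapK aB)//; congr pair.
apply: functional_extensionality_dep => j.
by rewrite partF_join (sa_mapK (aF j)).
Qed.

Lemma prod_map_continuous p : ch_dom e p -> {for p, continuous (ch_map e)}.
Proof.
case: p => b q [/= cb dq]; apply: continuous_mx => i k; rewrite ord1.
have cF j : {for ((b, q) : M), continuous (fun p : M => ch_map (d j) (p.2 j))}.
  apply: (@continuous_comp _ _ _ (fun p : M => p.2 j) (ch_map (d j))).
    exact: prF_continuous.
  exact: (sa_map_continuous (aF j)).
case: (idxP k) => [i'|j i'].
  have -> : (fun y : M => ch_map e y 0 (idxB i')) = (fun p => ch_map c p.1 0 i').
    by apply/funext => p; rewrite -[ch_map e p]/(join_row (ch_map c p.1) (fun j => ch_map (d j) (p.2 j))) join_rowB.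
  apply: (@continuous_comp _ _ _ (fun p : M => ch_map c p.1) (fun x => x 0 i')).
    apply: (@continuous_comp _ _ _ (fun p : M => p.1) (ch_map c)).
      exact: cvg_fst.
    exact: (sa_map_continuous aB).
  exact: coord_continuous.
have -> : (fun y : M => ch_map e y 0 (@idxF j i')) = (fun p => ch_map (d j) (p.2 j) 0 i').
  by apply/funext => p; rewrite -[ch_map e p]/(join_row (ch_map c p.1) (fun j => ch_map (d j) (p.2 j))) join_rowF.
apply: (@continuous_comp _ _ _ (fun p : M => ch_map (d j) (p.2 j)) (fun x => x 0 i')).
  exact: cF.
exact: coord_continuous.
Qed.

Lemma prod_inv_continuous x : ch_im e x -> {for x, continuous (ch_inv e)}.
Proof.
move=> /prod_im[cx dx].
have h1 : {for x, continuous (fun y : 'rV[R]_(mB + mF) => ch_inv c (lsubmx y))}.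
  apply: (@continuous_comp _ _ _ (fun x : 'rV[R]_(mB + mF) => lsubmx x) (ch_inv c)).
    exact: lsub_continuous.
  exact: (sa_inv_continuous aB).
have h2 : {for x, continuous (fun y : 'rV[R]_(mB + mF) =>
    (fun j => ch_inv (d j) (partF y j)) : prod_topology (fun j => F j))}.
  apply: (@cvg_prod_topology _ (fun j => F j) _ _ _ _ (nbhs_filter x)) => j.
  apply: (@continuous_comp _ _ _ (fun x => partF x j) (ch_inv (d j))).
    exact: partF_continuous.
  exact: (sa_inv_continuous (aF j)).
exact: (@cvg_pair _ _ _ _ _ _ (nbhs_filter x) (nbhs_filter _) (nbhs_filter _) _ _ h1 h2).
Qed.

End OneChart.

(** Each coordinate of the transition map involves a single factor, through the transition map of
    that factor. *)
Lemma prod_transition (c c' : chart R B mB)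
    (d d' : forall j, chart R (F j) (mdim (F j))) k :
  atlas c -> atlas c' -> (forall j, atlas (d j)) -> (forall j, atlas (d' j)) ->
  let e : chart R M (mdim M) := prod_chart c d in
  let e' : chart R M (mdim M) := prod_chart c' d' in
  smooth_on (ch_map e @` (ch_dom e `&` ch_dom e')) (fun x => ch_map e' (ch_inv e x) 0 k).
Proof.
move=> ac ac' ad ad' e e'.
have eK p : ch_dom e p -> ch_inv e (ch_map e p) = p by exact: prod_mapK.
have oU : open (ch_map e @` (ch_dom e `&` ch_dom e')).
  have -> : ch_map e @` (ch_dom e `&` ch_dom e') = ch_im e `&` ch_inv e @^-1` ch_dom e'.
    apply/seteqP; split=> [x [p [ep ep'] <-]|x [[p ep <-]]].
      split; first by exists p.
      by change (ch_dom e' (ch_inv e (ch_map e p))); rewrite eK.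
    by change (ch_dom e' (ch_inv e (ch_map e p)) -> (ch_map e @` (ch_dom e `&` ch_dom e')) (ch_map e p));
      rewrite eK// => ep'; exists p.
  rewrite openE => x [ex ex']; apply: filterI.
    by apply: open_nbhs_nbhs; split=> //; exact: prod_im_open.
  apply: (prod_inv_continuous ac ad ex).
  by apply: open_nbhs_nbhs; split=> //; exact: prod_dom_open.
have Udom x : (ch_map e @` (ch_dom e `&` ch_dom e')) x ->
   (ch_map c @` (ch_dom c `&` ch_dom c')) (lsubmx x) /\
   forall j, (ch_map (d j) @` (ch_dom (d j) `&` ch_dom (d' j))) (partF x j).
  move=> [p [[cp dp] [cp' dp']] <-].
  rewrite -[ch_map e p]/(join_row (ch_map c p.1) (fun j => ch_map (d j) (p.2 j))).
  by rewrite lsub_join; split=> [|j]; [exists p.1|rewrite partF_join; exists (p.2 j)].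
have otr (N : charted R) (aN : smooth_atlas N) (c1 c2 : chart R N (mdim N)) : atlas c1 -> atlas c2 ->
    open (ch_map c1 @` (ch_dom c1 `&` ch_dom c2)).
  move=> ac1 ac2.
  have -> : ch_map c1 @` (ch_dom c1 `&` ch_dom c2) = ch_im c1 `&` ch_inv c1 @^-1` ch_dom c2.
    apply/seteqP; split=> [x [p [ep ep'] <-]|x [[p ep <-]]] /=.
      by split; [exists p|rewrite (sa_mapK aN)].
    by rewrite (sa_mapK aN)// => ep'; exists p.
  by apply: (open_chart_preim aN) => //; exact: sa_dom_open.
move=> m; case: (idxP k) => [i|j i].
  have -> : (fun x => ch_map e' (ch_inv e x) 0 (idxB i)) =
     (fun x => (fun y => ch_map c' (ch_inv c y) 0 i) (lsubmx x)).
    apply/funext => x; rewrite -[ch_map e' _]/(join_row (ch_map c' (ch_inv c (lsubmx x)))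
      (fun j => ch_map (d' j) (ch_inv (d j) (partF x j)))).
    by rewrite join_rowB.
  apply: (@ck_on_comp _ _ _ _ _ (ch_map c @` (ch_dom c `&` ch_dom c'))
    (fun y => ch_map c' (ch_inv c y) 0 i) (fun x => lsubmx x)) => //.
  - exact: otr.
  - by move=> x /Udom[].
  - exact: (sa_transition aB).
  - exact: ck_on_lsub.
have -> : (fun x => ch_map e' (ch_inv e x) 0 (@idxF j i)) =
   (fun x => (fun y => ch_map (d' j) (ch_inv (d j) y) 0 i) (partF x j)).
  apply/funext => x; rewrite -[ch_map e' _]/(join_row (ch_map c' (ch_inv c (lsubmx x)))
    (fun j => ch_map (d' j) (ch_inv (d j) (partF x j)))).
  by rewrite join_rowF.
apply: (@ck_on_comp _ _ _ _ _ (ch_map (d j) @` (ch_dom (d j) `&` ch_dom (d' j)))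
  (fun y => ch_map (d' j) (ch_inv (d j) y) 0 i) (fun x => partF x j)) => //.
- exact: otr.
- by move=> x /Udom[].
- exact: (sa_transition (aF j)).
- exact: ck_on_partF.
Qed.

Lemma prod_cover (p : M) : exists c d, [/\ atlas c, forall j, atlas (d j),
  ch_dom c p.1 & forall j, ch_dom (d j) (p.2 j)].
Proof.
have [c ac cp] := sa_cover aB p.1.
have H j : exists d : chart R (F j) (mdim (F j)), atlas d /\ ch_dom d (p.2 j).
  by have [d ad dp] := sa_cover (aF j) (p.2 j); exists d.
have [d Hd] := fin_all_exists H.
by exists c, d; split=> // j; have [] := Hd j.
Qed.

Lemma prod_smooth_atlas : smooth_atlas M.
Proof.
split.
- apply: hausdorff_pair; first exact: sa_hausdorff.
  apply: (@hausdorff_product _ (fun j => F j)) => j; exact: sa_hausdorff.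
- move=> p; have [c [d [ac ad cp dp]]] := prod_cover p.
  by exists (prod_chart c d); [exists c, d|].
- by move=> _ [c [d [ac ad ->]]]; exact: prod_dom_open.
- by move=> _ [c [d [ac ad ->]]]; exact: prod_im_open.
- by move=> _ [c [d [ac ad ->]]] p; exact: prod_mapK.
- by move=> _ [c [d [ac ad ->]]] p; exact: prod_map_continuous.
- by move=> _ [c [d [ac ad ->]]] x; exact: prod_inv_continuous.
- move=> _ _ [c [d [ac ad ->]]] [c' [d' [ac' ad' ->]]] i.
  exact: prod_transition.
Qed.

End ProductAtlas.

(** * Tangent vectors and lifts on the product *)

Section ProductTangent.
Context {R : realType} {l : nat} {B : charted R} {F : 'I_l -> charted R}.
Hypotheses (aB : smooth_atlas B) (aF : forall j, smooth_atlas (F j)).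
Local Notation M := (prod_manifold B F).
Local Notation mB := (mdim B).
Local Notation mF := (\sum_(j < l) mdim (F j))%N.
Let aM : smooth_atlas M := prod_smooth_atlas aB aF.
Local Notation prF := (@prF R l B F).
Local Notation prB := (@prB R l B F).

Definition sliceB (h : M -> R) (p : M) : B -> R := fun b => h (b, p.2).
Definition sliceF (j : 'I_l) (h : M -> R) (p : M) : F j -> R :=
  fun y => h (p.1, @dfwith _ (fun k => F k : Type) p.2 j y).

Lemma delta_idxB_lsub i : lsubmx (delta_mx 0 (idxB (F := F) i) : 'rV[R]_(mB + mF)) = delta_mx 0 i.
Proof. by apply/rowP => k; rewrite lsubE !mxE /idxB (inj_eq (@lshift_inj _ _)). Qed.

Lemma delta_idxB_partF i j : partF (delta_mx 0 (idxB (F := F) i) : 'rV[R]_(mB + mF)) j = 0.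
Proof. by apply/rowP => k; rewrite partFE !mxE /idxB /idxF eq_rlshift andbF. Qed.

Lemma delta_idxF_lsub j i : lsubmx (delta_mx 0 (@idxF _ _ B F j i) : 'rV[R]_(mB + mF)) = 0.
Proof. by apply/rowP => k; rewrite lsubE !mxE /idxB /idxF eq_lrshift andbF. Qed.

Lemma Rank_inj j : injective (@tagnat.Rank l (fun j => mdim (F j)) j).
Proof.
by move=> i k E; have := @tagnat.eq_Rank l (fun j => mdim (F j)) j j i k; rewrite E !eqxx /= => /esym/eqP/val_inj.
Qed.

Lemma delta_idxF_partF j i k : partF (delta_mx 0 (@idxF _ _ B F j i) : 'rV[R]_(mB + mF)) k =
  @dfwith _ (fun k => 'rV[R]_(mdim (F k))) (fun=> 0) j (delta_mx 0 i) k.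
Proof.
apply/rowP => m; rewrite partFE; have [E|jk] := eqVneq j k.
  case: _ / E m => m.
  by rewrite dfwithin !mxE /idxF (inj_eq (@rshift_inj _ _)) (inj_eq (@Rank_inj j)).
rewrite dfwithout// !mxE /idxF (inj_eq (@rshift_inj _ _)) eqxx /=.
case: eqP => // E; case/eqP: jk.
have := congr1 (@tagnat.sig1 l (fun j => mdim (F j))) E.
by rewrite !tagnat.Rank1K.
Qed.

Lemma partF_lin (a : R) (x y : 'rV[R]_(mB + mF)) j :
  partF (a *: x + y) j = a *: partF x j + partF y j.
Proof. by apply/rowP => i; rewrite !mxE. Qed.

Lemma smooth_prB (h : B -> R) : smooth h -> smooth (fun p : M => h (prB p)).
Proof.
move=> sh _ [c [d [ac ad ->]]] k.
apply: (@ck_on_comp _ _ _ _ _ (ch_im c) (fun x => h (ch_inv c x)) (fun x => lsubmx x)).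
- exact: prod_im_open.
- exact: sa_im_open.
- by move=> x /(prod_im aF c ad)[].
- exact: sh.
- exact: ck_on_lsub.
Qed.

Lemma smooth_prF j (h : F j -> R) : smooth h -> smooth (fun p : M => h (prF j p)).
Proof.
move=> sh _ [c [d [ac ad ->]]] k.
apply: (@ck_on_comp _ _ _ _ _ (ch_im (d j)) (fun x => h (ch_inv (d j) x)) (fun x => partF x j)).
- exact: prod_im_open.
- exact: sa_im_open.
- by move=> x /(prod_im aF c ad)[].
- exact: sh.
- exact: ck_on_partF.
Qed.

Lemma prod_invE (c : chart R B mB) (d : forall j, chart R (F j) (mdim (F j))) x :
  ch_inv (prod_chart c d) x = (ch_inv c (lsubmx x), fun j => ch_inv (d j) (partF x j)).
Proof. by []. Qed.

Lemma prod_mapE (c : chart R B mB) (d : forall j, chart R (F j) (mdim (F j))) (p : M) :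
  ch_map (prod_chart c d) p = join_row (ch_map c p.1) (fun j => ch_map (d j) (p.2 j)).
Proof. by []. Qed.

Lemma smooth_sliceB h p : smooth h -> smooth (sliceB h p).
Proof.
move=> sh c ac k; have [_ [d [_ ad _ dp]]] := prod_cover aB aF p.
pose phi (x : 'rV[R]_mB) := join_row x (fun j => ch_map (d j) (p.2 j)).
have -> : (fun x => sliceB h p (ch_inv c x)) =
    (fun x => (fun y => h (ch_inv (prod_chart c d) y)) (phi x)).
  apply/funext => x; rewrite /sliceB prod_invE /phi lsub_join; congr (h (_, _)).
  by apply: functional_extensionality_dep => j; rewrite partF_join (sa_mapK (aF j)).
apply: (@ck_on_comp _ _ _ _ _ (ch_im (prod_chart c d : chart R M (mdim M)))
  (fun y => h (ch_inv (prod_chart c d) y)) phi).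
- exact: sa_im_open.
- exact: prod_im_open.
- move=> x cx; apply/(prod_im aF c ad); rewrite /phi lsub_join; split=> // j.
  by rewrite partF_join; exact: im_map.
- by apply: sh; exists c, d.
- move=> m; case: (idxP m) => [i|j i].
    have -> : (fun x => phi x 0 (idxB i)) = (fun x => x 0 i).
      by apply/funext => x; exact: join_rowB.
    exact: ck_on_coord.
  have -> : (fun x => phi x 0 (idxF i)) = (fun=> ch_map (d j) (p.2 j) 0 i).
    by apply/funext => x; exact: join_rowF.
  exact: ck_on_cst.
Qed.

Lemma smooth_sliceF j h p : smooth h -> smooth (@sliceF j h p).
Proof.
move=> sh dj adj k; have [c [d [ac ad cp dp]]] := prod_cover aB aF p.
pose d' := @dfwith _ (fun k => chart R (F k) (mdim (F k))) d j dj.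
have ad' i : atlas (d' i) by rewrite /d'; case: dfwithP.
pose pt (x : 'rV[R]_(mdim (F j))) := @dfwith _ (fun k => 'rV[R]_(mdim (F k)))
  (fun k => ch_map (d k) (p.2 k)) j x.
pose phi (x : 'rV[R]_(mdim (F j))) := join_row (ch_map c p.1) (pt x).
have -> : (fun x => sliceF h p (ch_inv dj x)) =
    (fun x => (fun y => h (ch_inv (prod_chart c d') y)) (phi x)).
  apply/funext => x; rewrite /sliceF prod_invE /phi lsub_join (sa_mapK aB)//; congr (h (_, _)).
  apply: functional_extensionality_dep => i; rewrite partF_join /pt /d'.
  have [ji|ji] := eqVneq j i; last by rewrite !dfwithout// (sa_mapK (aF i)).
  by case: _ / ji; rewrite !dfwithin.
apply: (@ck_on_comp _ _ _ _ _ (ch_im (prod_chart c d' : chart R M (mdim M)))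
  (fun y => h (ch_inv (prod_chart c d') y)) phi).
- exact: sa_im_open.
- exact: prod_im_open.
- move=> x cx; apply/(prod_im aF c ad'); rewrite /phi lsub_join; split=> [|i].
    exact: im_map.
  rewrite partF_join /pt /d'; have [ji|ji] := eqVneq j i; last first.
    by rewrite !dfwithout//; exact: im_map.
  by case: _ / ji; rewrite !dfwithin.
- by apply: sh; exists c, d'.
- move=> m; case: (idxP m) => [i|i m'].
    have -> : (fun x => phi x 0 (idxB i)) = (fun=> ch_map c p.1 0 i).
      by apply/funext => x; exact: join_rowB.
    exact: ck_on_cst.
  have E : (fun x => phi x 0 (idxF m')) = (fun x => pt x i 0 m').
    by apply/funext => x; exact: join_rowF.
  rewrite E; have [ji|ji] := eqVneq j i.
    case: _ / ji m' E => m' E.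
    have -> : (fun x => pt x j 0 m') = (fun x => x 0 m').
      by apply/funext => x; rewrite /pt dfwithin.
    exact: ck_on_coord.
  have -> : (fun x => pt x i 0 m') = (fun=> ch_map (d i) (p.2 i) 0 m').
    by apply/funext => x; rewrite /pt dfwithout.
  exact: ck_on_cst.
Qed.

(** A directional derivative only sees the function on one line. This identifies partial derivatives
    on the product with those on a factor, for arbitrary functions. *)
Lemma derive_eq_line (V W : normedModType R) (f : V -> R) (g : W -> R) v w x y :
  (forall t : R, f (t *: v + x) = g (t *: w + y)) -> 'D_v f x = 'D_w g y.
Proof.
move=> E; rewrite /derive.
suff -> : (fun h : R => h^-1 *: ((f \o shift x) (h *: v) - f x)) =
  (fun h : R => h^-1 *: ((g \o shift y) (h *: w) - g y)) by [].
apply/funext => t /=.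
by rewrite E; have := E 0; rewrite !scale0r !add0r => ->.
Qed.

Section Partials.
Variables (c : chart R B mB) (d : forall j, chart R (F j) (mdim (F j))) (p : M).
Hypotheses (ac : atlas c) (ad : forall j, atlas (d j)).
Hypotheses (cp : ch_dom c p.1) (dp : forall j, ch_dom (d j) (p.2 j)).
Let e : chart R M (mdim M) := prod_chart c d.

Lemma partial_idxB i h : partial e (idxB i) p h = partial c i p.1 (sliceB h p).
Proof.
apply: derive_eq_line => t; rewrite prod_mapE prod_invE /sliceB; congr (h (_, _)).
  by rewrite linearP /= delta_idxB_lsub lsub_join.
apply: functional_extensionality_dep => j.
by rewrite partF_lin delta_idxB_partF scaler0 add0r partF_join (sa_mapK (aF j)).
Qed.

Lemma partial_idxF j i h : partial e (@idxF _ _ _ _ j i) p h = partial (d j) i (p.2 j) (sliceF h p).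
Proof.
apply: derive_eq_line => t; rewrite prod_mapE prod_invE /sliceF; congr (h (_, _)).
  by rewrite linearP /= delta_idxF_lsub scaler0 add0r lsub_join (sa_mapK aB).
apply: functional_extensionality_dep => k.
rewrite partF_lin delta_idxF_partF partF_join.
have [jk|jk] := eqVneq j k; last first.
  by rewrite !dfwithout// scaler0 add0r (sa_mapK (aF k)).
by case: _ / jk; rewrite !dfwithin.
Qed.

End Partials.

(** The isomorphism from the direct sum of the tangent spaces of the factors onto the tangent space
    of the product; its inverse is the family of pushforwards. The value 0 on non-smooth functions
    is the one [tangent] prescribes. *)
Definition joinv (p : M) (u : (B -> R) -> R) (w : forall j, (F j -> R) -> R) : (M -> R) -> R :=
  fun h => if `[< smooth h >] then u (sliceB h p) + \sum_(j < l) w j (sliceF h p) else 0.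

Lemma joinvE (p : M) (u : (B -> R) -> R) (w : forall j, (F j -> R) -> R) (h : M -> R) :
  smooth h -> joinv p u w h = u (sliceB h p) + \sum_(j < l) w j (sliceF h p).
Proof. by move=> sh; rewrite /joinv asboolT. Qed.

Lemma tangent_joinv (p : M) (u : (B -> R) -> R) (w : forall j, (F j -> R) -> R) :
  tangent p.1 u -> (forall j, tangent (p.2 j) (w j)) ->
  tangent p (joinv p u w).
Proof.
move=> tu tw; split; last by move=> h nh; rewrite /joinv asboolF.
have [c [d [ac ad cp dp]]] := prod_cover aB aF p.
exists (prod_chart c d); split=> //; first by exists c, d.
have [a Ha] := tangent_chart aB ac cp tu.
have H j : exists b : 'rV[R]_(mdim (F j)), forall f, smooth f ->
    w j f = \sum_(i < mdim (F j)) b 0 i * partial (d j) i (p.2 j) f.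
  exact: (tangent_chart (aF j) (ad j) (dp j) (tw j)).
have [b Hb] := fin_all_exists H.
exists (join_row a b) => h sh; rewrite joinvE// Ha; last exact: smooth_sliceB.
rewrite sum_idx; congr (_ + _).
  apply: eq_bigr => i _; rewrite join_rowB; congr (_ * _).
  by have := @partial_idxB c d p ad dp i h; rewrite /partial => ->.
apply: eq_bigr => j _; rewrite Hb; last exact: smooth_sliceF.
apply: eq_bigr => i _; rewrite join_rowF; congr (_ * _).
by have := @partial_idxF c d p ac ad cp dp j i h; rewrite /partial => ->.
Qed.

(** A function pulled back from [B] is constant on every fibre slice, and tangent vectors annihilate
    constants. *)
Lemma pushforward_joinvB (p : M) (u : (B -> R) -> R) (w : forall j, (F j -> R) -> R) :
  tangent p.1 u -> (forall j, tangent (p.2 j) (w j)) ->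
  pushforward prB (joinv p u w) = u.
Proof.
move=> tu tw; apply/funext => f; rewrite /pushforward.
case: asboolP => sf; last by rewrite (tangent_nonsmooth tu).
rewrite joinvE; last exact: smooth_prB.
rewrite big1 ?addr0// => j _.
exact: (tangent_cst (f p.1) (tw j)).
Qed.

Lemma pushforward_joinvF (p : M) (u : (B -> R) -> R) (w : forall j, (F j -> R) -> R) j :
  tangent p.1 u -> (forall j, tangent (p.2 j) (w j)) ->
  pushforward (prF j) (joinv p u w) = w j.
Proof.
move=> tu tw; apply/funext => f; rewrite /pushforward.
case: asboolP => sf; last by rewrite (tangent_nonsmooth (tw j)).
rewrite joinvE; last exact: smooth_prF.
rewrite (_ : u _ = 0); last exact: (tangent_cst (f (p.2 j)) tu).
rewrite add0r (bigD1 j)//= big1 ?addr0.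
  by congr (w j _); apply/funext => y; rewrite /sliceF /Defs.prF /= dfwithin.
move=> k kj; rewrite (_ : sliceF _ _ = fun=> f (p.2 j)); first exact: (tangent_cst _ (tw k)).
by apply/funext => y; rewrite /sliceF /Defs.prF /= dfwithout.
Qed.

Section Pushforward.
Variables (p : M) (v : (M -> R) -> R).
Hypothesis tv : tangent p v.

Let chart_data : exists c d (a : 'rV[R]_(mdim M)), [/\ atlas c, forall j, atlas (d j),
  ch_dom c p.1, forall j, ch_dom (d j) (p.2 j) &
  forall h, smooth h -> v h =
    \sum_i a 0 (idxB i) * partial c i p.1 (sliceB h p) +
    \sum_j \sum_i a 0 (@idxF _ _ _ _ j i) * partial (d j) i (p.2 j) (sliceF h p)].
Proof.
have [c [d [ac ad cp dp]]] := prod_cover aB aF p.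
have ae : atlas (prod_chart c d : chart R M (mdim M)) by exists c, d.
have [a Ha] := tangent_chart aM ae (conj cp dp) tv.
exists c, d, a; split=> // h sh; rewrite Ha// sum_idx; congr (_ + _).
  by apply: eq_bigr => i _; rewrite partial_idxB.
by apply: eq_bigr => j _; apply: eq_bigr => i _; rewrite partial_idxF.
Qed.

Let partial_const (N : charted R) (c : chart R N (mdim N)) i q (f : N -> R) a :
  (forall y, f y = a) -> partial c i q f = 0.
Proof.
move=> fa; rewrite (_ : f = fun=> a); first exact: partial_cst.
by apply/funext.
Qed.

Lemma tangent_pushforwardB : tangent p.1 (pushforward prB v).
Proof.
split; last by move=> f nf; rewrite /pushforward asboolF.
have [c [d [a [ac ad cp dp H]]]] := chart_data.
exists c; split=> //; exists (\row_i a 0 (idxB i)) => f sf.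
rewrite /pushforward asboolT// H; last exact: smooth_prB.
rewrite [X in _ + X]big1 ?addr0.
  by apply: eq_bigr => i _; rewrite mxE.
move=> j _; rewrite big1// => i _.
by rewrite (@partial_const _ _ _ _ _ (f p.1)) ?mulr0.
Qed.

Lemma tangent_pushforwardF j : tangent (p.2 j) (pushforward (prF j) v).
Proof.
split; last by move=> f nf; rewrite /pushforward asboolF.
have [c [d [a [ac ad cp dp H]]]] := chart_data.
exists (d j); split=> //; exists (\row_i a 0 (@idxF _ _ _ _ j i)) => f sf.
rewrite /pushforward asboolT// H; last exact: smooth_prF.
rewrite big1 ?add0r; last first.
  by move=> i _; rewrite (@partial_const _ _ _ _ _ (f (p.2 j))) ?mulr0.
rewrite (bigD1 j)//= [X in _ + X]big1 ?addr0.
  apply: eq_bigr => i _; rewrite mxE; congr (_ * partial _ _ _ _).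
  by apply/funext => y; rewrite /sliceF /Defs.prF /= dfwithin.
move=> k kj; rewrite big1// => i _.
rewrite (@partial_const _ _ _ _ _ (f (p.2 j))) ?mulr0// => y.
by rewrite /sliceF /Defs.prF /= dfwithout.
Qed.

(** In a product chart the derivative of [h] splits into derivatives of its slices. The part along a
    factor is found again by applying [v] to the slice pulled back to the product, on which the
    other directions give 0. *)
Lemma joinv_pushforward :
  v = joinv p (pushforward prB v) (fun j => pushforward (prF j) v).
Proof.
apply/funext => h; case: (pselect (smooth h)) => [sh|nh]; last first.
  by rewrite /joinv asboolF// (tangent_nonsmooth tv).
have [c [d [a [ac ad cp dp H]]]] := chart_data.
rewrite joinvE// H//; congr (_ + _).
  rewrite /pushforward asboolT; last exact: smooth_sliceB.
  rewrite H; last exact/smooth_prB/smooth_sliceB.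
  rewrite [X in _ = _ + X]big1 ?addr0//.
  move=> j _; rewrite big1// => i _.
  by rewrite (@partial_const _ _ _ _ _ (h p)) ?mulr0// => y; rewrite /sliceF /sliceB /Defs.prB /=; case: (p).
apply: eq_bigr => j _; rewrite /pushforward asboolT; last exact: smooth_sliceF.
have self k : @dfwith _ (fun k => F k : Type) p.2 k (p.2 k) = p.2.
  by apply: functional_extensionality_dep => m; case: dfwithP.
rewrite H; last exact/smooth_prF/smooth_sliceF.
rewrite [X in _ = X + _]big1 ?add0r; last first.
  move=> i _; rewrite (@partial_const _ _ _ _ _ (h p)) ?mulr0// => y.
  by rewrite /sliceF /sliceB /Defs.prF /= self; case: (p).
rewrite [RHS](bigD1 j)//= [X in _ = _ + X]big1 ?addr0.
  apply: eq_bigr => i _; congr (_ * partial _ _ _ _).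
  by apply/funext => y; rewrite /sliceF /Defs.prF /= dfwithin.
move=> k kj; rewrite big1// => i _.
rewrite (@partial_const _ _ _ _ _ (h p)) ?mulr0// => y.
by rewrite /sliceF /Defs.prF /= dfwithout// self; case: (p).
Qed.

End Pushforward.

Lemma pushforward_lin (N : charted R) (phi : M -> N) (a : R) u v :
  pushforward phi (fun f => a * u f + v f) =
  (fun f => a * pushforward phi u f + pushforward phi v f).
Proof.
by apply/funext => f; rewrite /pushforward; case: asboolP => // _; rewrite mulr0 addr0.
Qed.

Definition jfield (X : (B -> R) -> (B -> R)) (V : forall j, (F j -> R) -> (F j -> R)) :
  (M -> R) -> (M -> R) := fun h p => joinv p (vat X p.1) (fun j => vat (V j) (p.2 j)) h.

Lemma tangent_jfield X V p : vfield X -> (forall j, vfield (V j)) -> tangent p (vat (jfield X V) p).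
Proof.
move=> [vX _] vV; apply: tangent_joinv => [|j]; first exact: vX.
by have [+ _] := vV j; apply.
Qed.

Lemma jfield_prB X V f : vfield X -> (forall j, vfield (V j)) -> smooth f ->
  jfield X V (fun p => f (prB p)) = fun p => X f (prB p).
Proof.
move=> [vX _] vV sf; apply/funext => p.
have := congr1 (fun u => u f) (@pushforward_joinvB p (vat X p.1) (fun j => vat (V j) (p.2 j))
  (vX _) (fun j => (vV j).1 _)).
by rewrite /pushforward asboolT.
Qed.

Lemma jfield_prF X V j f : vfield X -> (forall j, vfield (V j)) -> smooth f ->
  jfield X V (fun p => f (prF j p)) = fun p => V j f (prF j p).
Proof.
move=> [vX _] vV sf; apply/funext => p.
have := congr1 (fun u => u f) (@pushforward_joinvF p (vat X p.1) (fun j => vat (V j) (p.2 j))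
  j (vX _) (fun j => (vV j).1 _)).
by rewrite /pushforward asboolT.
Qed.

Lemma liftB_jfield X : liftB X = jfield X (fun _ _ => fun=> 0).
Proof.
apply/funext => h; apply/funext => p; rewrite /liftB /jfield /joinv.
by case: ifP => // _; rewrite big1 ?addr0.
Qed.

Lemma liftF_jfield j (V : (F j -> R) -> (F j -> R)) : liftF V =
  jfield (fun _ => fun=> 0) (@dfwith _ (fun k => (F k -> R) -> (F k -> R)) (fun _ _ => fun=> 0) j V).
Proof.
apply/funext => h; apply/funext => p; rewrite /liftF /jfield /joinv.
case: ifP => // _; rewrite (bigD1 j)//= big1 ?addr0; last first.
  by move=> k kj; rewrite /vat dfwithout// eq_sym.
by rewrite /vat dfwithin add0r.
Qed.

Lemma vfield0 (N : charted R) : smooth_atlas N -> vfield (fun _ : N -> R => fun=> 0).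
Proof. by move=> aN; split=> [p|f _]; [exact: tangent0|exact: smooth_cst]. Qed.

End ProductTangent.

(** * Signature of a warped product *)

Section Dense.
Context {R : realType} {M : charted R} (aM : smooth_atlas M) (g : tensor02 M).
Hypothesis regD : forall (O : set M) p, open O -> O p -> exists q, O q /\ regular_point g q.

Lemma eq_on_regular (h h' : M -> R) : smooth h -> smooth h' ->
  (forall p, regular_point g p -> h p = h' p) -> h = h'.
Proof.
move=> sh sh' E; apply/funext => p; apply: contrapT => ne.
pose k q := h q - h' q.
have ck : {for p, continuous k} by apply: (smooth_continuous aM); exact: smoothB.
have /ck nk : nbhs (k p) [set t | t != 0].
  by apply: open_nbhs_nbhs; split; [exact: open_neq|apply/eqP => /eqP; rewrite subr_eq0 => /eqP].
have : (k @^-1` [set t | t != 0])° p by [].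
move=> /regD[|q [qk rq]]; first exact: open_interior.
by have := interior_subset qk; rewrite /preimage /= /k E// subrr eqxx.
Qed.

(** Density of the regular points makes the smooth extension unique, so the one picked by [xget] is
    [h]. *)
Lemma lower_cov_eq X (w : ((M -> R) -> (M -> R)) -> M -> R) Y h : smooth h ->
  (forall p, regular_point g p -> h p = lower_cov_raw g X w Y p) ->
  lower_cov g X w Y = h.
Proof.
move=> sh hE; rewrite /lower_cov.
set S := [set h | _].
have : S (xget (lower_cov_raw g X w Y) S) by apply: xgetPex; exists h.
move=> [sx xE]; apply: eq_on_regular => // p rp.
by rewrite xE// hE.
Qed.

End Dense.

Lemma leq_sum_eq (I : finType) (a a' : nat) (b b' : I -> nat) :
  (a <= a')%N -> (forall i, (b i <= b' i)%N) ->
  (a + \sum_i b i = a' + \sum_i b' i)%N -> a = a' /\ forall i, b i = b' i.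
Proof.
move=> aa bb E.
have sb : (\sum_i b i <= \sum_i b' i)%N by apply: leq_sum.
have ea : a = a'.
  apply/eqP; rewrite eqn_leq aa /= -(leq_add2r (\sum_i b' i)) -E leq_add2l //.
have eb : (\sum_i b i = \sum_i b' i)%N by apply/eqP; rewrite -(eqn_add2l a) E ea.
split=> // i; apply/eqP; rewrite eqn_leq bb /=.
have := eb; rewrite (bigD1 i)//= [in RHS](bigD1 i)//= => e.
rewrite -(leq_add2r (\sum_(j | j != i) b' j)) -e leq_add2l.
by apply: leq_sum.
Qed.

Section Warped.
Context {R : realType} {l : nat} {B : charted R} {F : 'I_l -> charted R}.
Hypotheses (aB : smooth_atlas B) (aF : forall j, smooth_atlas (F j)).
Variables (gB : tensor02 B) (gF : forall j, tensor02 (F j)) (f : 'I_l -> B -> R).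
Arguments gF : clear implicits.
Hypotheses (mB : singular_metric gB) (mF : forall j, singular_metric (gF j)).
Hypothesis sf : forall j, smooth (f j).
Local Notation M := (prod_manifold B F).
Local Notation g := (warped_metric gB gF f : tensor02 M).
Let aM : smooth_atlas M := prod_smooth_atlas aB aF.
Local Notation prF := (@prF R l B F).
Local Notation prB := (@prB R l B F).
Let bB (p : B) : bilinear_at gB p := metric_bilinear mB p.
Let bF (j : 'I_l) (p : F j) : bilinear_at (gF j) p := metric_bilinear (mF j) p.
Arguments bF : clear implicits.

Lemma warped_joinv (p : M) (u u' : (B -> R) -> R) (w w' : forall j, (F j -> R) -> R) :
  tangent p.1 u -> (forall j, tangent (p.2 j) (w j)) ->
  tangent p.1 u' -> (forall j, tangent (p.2 j) (w' j)) ->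
  g p (joinv p u w) (joinv p u' w') =
  gB p.1 u u' + \sum_(j < l) f j p.1 ^+ 2 * gF j (p.2 j) (w j) (w' j).
Proof.
move=> tu tw tu' tw'; rewrite /warped_metric !(pushforward_joinvB aB aF)//.
by congr (_ + _); apply: eq_bigr => j _; rewrite !(pushforward_joinvF aB aF)//.
Qed.

Lemma warped_bilinear (p : M) : bilinear_at g p.
Proof.
have tB v : tangent p v -> tangent (prB p) (pushforward prB v) by exact: tangent_pushforwardB.
have tF j v : tangent p v -> tangent (prF j p) (pushforward (prF j) v).
  by move=> tv; exact: (tangent_pushforwardF aB aF tv j).
split=> [u v tu tv|a u v w tu tv tw]; rewrite /warped_metric.
  rewrite (form_sym (bB _))//; [|exact: tB|exact: tB]; congr (_ + _).
  by apply: eq_bigr => j _; rewrite (form_sym (bF _ _))//; exact: tF.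
rewrite !pushforward_lin (form_linl (bB _)); [|exact: tB|exact: tB|exact: tB].
rewrite mulrDr addrACA mulr_sumr -big_split /=; congr (_ + _).
apply: eq_bigr => j _; rewrite pushforward_lin (form_linl (bF _ _)); [|exact: tF|exact: tF|exact: tF].
by ring.
Qed.

(** The factor [f j ^+ 2] reverses no sign: it keeps both indices of [gF j], or makes all directions
    of the fibre null. *)
Definition weight j (b : B) : nat := (f j b != 0).

(** Orthogonal bases of the factors form together an orthogonal basis of the product, in which the
    squares of the fibre vectors are multiplied by [f j p.1 ^+ 2]. *)
Lemma product_signature (p : M) rB sB (r s : 'I_l -> nat) :
  has_signature gB p.1 rB sB ->
  (forall j, has_signature (gF j) (p.2 j) (r j) (s j)) ->
  has_signature g p (rB + \sum_j weight j p.1 * r j)%N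
                    (sB + \sum_j weight j p.1 * s j)%N.
Proof.
move=> [eB [[teB seB] oB rBE sBE]] hF.
have [eF HeF] := fin_all_exists hF.
have teF j i : tangent (p.2 j) (eF j i) by case: (HeF j) => -[].
have z0B : tangent p.1 (fun _ : B -> R => 0 : R) by exact: tangent0.
have z0F j : tangent (p.2 j) (fun _ : F j -> R => 0 : R) by exact: tangent0.
pose zF := (fun j (_ : F j -> R) => 0 : R).
pose wF j i := @dfwith _ (fun k => (F k -> R) -> R) zF j (eF j i).
have twF j i k : tangent (p.2 k) (wF j i k) by rewrite /wF; case: dfwithP.
pose e (k : 'I_(mdim B + \sum_(j < l) mdim (F j))) := match fintype.split k with
  | inl i => joinv p (eB i) zF
  | inr s => let t := @tagnat.sig l (fun j => mdim (F j)) s in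
      joinv p (fun=> 0) (wF (tag t) (tagged t)) end.
have eBE i : e (idxB i) = joinv p (eB i) zF.
  rewrite /e /idxB; case: split_ordP => [i' /lshift_inj <-//|s' /eqP].
  by rewrite eq_lrshift.
have eFE j i : e (@idxF _ _ _ _ j i) = joinv p (fun=> 0) (wF j i).
  rewrite /e /idxF; case: split_ordP => [i' /eqP|s' /rshift_inj <-].
    by rewrite eq_rlshift.
  by rewrite /tagnat.Rank tagnat.rankK.
have te k : tangent p (e k).
  by case: (idxP k) => [i|j i]; rewrite ?eBE ?eFE; apply: tangent_joinv => // ?; exact: z0F.
have pB (c : 'rV[R]_(mdim M)) : pushforward prB (fun h => \sum_k c 0 k * e k h) =
    fun h => \sum_i lsubmx c 0 i * eB i h.
  apply/funext => h; rewrite /pushforward; case: asboolP => sh; last first.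
    by rewrite big1// => i _; rewrite (tangent_nonsmooth (teB i))// mulr0.
  rewrite sum_idx [X in _ + X]big1 ?addr0.
    apply: eq_bigr => i _; rewrite lsubE; congr (_ * _).
    have := congr1 (fun u => u h) (pushforward_joinvB aB aF (teB i) z0F).
    by rewrite /pushforward asboolT// eBE.
  move=> j _; rewrite big1// => i _.
  have := congr1 (fun u => u h) (pushforward_joinvB aB aF z0B (twF j i)).
  by rewrite /pushforward asboolT// eFE => ->; rewrite mulr0.
have pF j (c : 'rV[R]_(mdim M)) : pushforward (prF j) (fun h => \sum_k c 0 k * e k h) =
    fun h => \sum_i partF c j 0 i * eF j i h.
  apply/funext => h; rewrite /pushforward; case: asboolP => sh; last first.
    by rewrite big1// => i _; rewrite (tangent_nonsmooth (teF j i))// mulr0.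
  rewrite sum_idx big1 ?add0r; last first.
    move=> i _.
    have := congr1 (fun u => u h) (pushforward_joinvF aB aF j (teB i) z0F).
    by rewrite /pushforward asboolT// eBE => ->; rewrite mulr0.
  rewrite (bigD1 j)//= [X in _ + X]big1 ?addr0.
    apply: eq_bigr => i _; rewrite partFE; congr (_ * _).
    have := congr1 (fun u => u h) (pushforward_joinvF aB aF j z0B (twF j i)).
    by rewrite /pushforward asboolT// eFE => ->; rewrite /wF dfwithin.
  move=> k kj; rewrite big1// => i _.
  have := congr1 (fun u => u h) (pushforward_joinvF aB aF j z0B (twF k i)).
  by rewrite /pushforward asboolT// eFE => ->; rewrite /wF dfwithout// mulr0.
have gBB i i' : g p (e (idxB i)) (e (idxB i')) = gB p.1 (eB i) (eB i').
  rewrite !eBE warped_joinv// big1 ?addr0// => j _.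
  by rewrite (form0l (aF j) (bF j _))// mulr0.
have gBF i j i' : g p (e (idxB i)) (e (@idxF _ _ _ _ j i')) = 0.
  rewrite eBE eFE warped_joinv// (form_sym (bB _))// (form0l aB (bB _))// add0r.
  by rewrite big1// => k _; rewrite (form0l (aF k) (bF k _)) ?mulr0.
have gFF j i i' : g p (e (@idxF _ _ _ _ j i)) (e (@idxF _ _ _ _ j i')) =
    f j p.1 ^+ 2 * gF j (p.2 j) (eF j i) (eF j i').
  rewrite !eFE warped_joinv// (form0l aB (bB _))// add0r (bigD1 j)//= big1 ?addr0.
    by rewrite /wF !dfwithin.
  move=> k kj; rewrite {1}/wF dfwithout 1?eq_sym//.
  by rewrite (form0l (aF k) (bF k _)) ?mulr0.
have gFF' j k i i' : j != k -> g p (e (@idxF _ _ _ _ j i)) (e (@idxF _ _ _ _ k i')) = 0.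
  move=> jk; rewrite !eFE warped_joinv// (form0l aB (bB _))// add0r big1// => m _.
  have [E|jm] := eqVneq j m; last first.
    by rewrite {1}/wF dfwithout// (form0l (aF m) (bF m _)) ?mulr0.
  rewrite [X in gF _ _ _ X]/wF [X in gF _ _ _ X]dfwithout; last by rewrite -E eq_sym.
  by rewrite (form_sym (bF m _)) ?(form0l (aF m) (bF m _)) ?mulr0.
have wE j (t : R) : (0 < f j p.1 ^+ 2 * t) = (f j p.1 != 0) && (0 < t).
  have [->|f0] /= := eqVneq (f j p.1) 0; first by rewrite expr0n mul0r ltxx.
  by rewrite pmulr_rgt0// exprn_even_gt0.
have wE' j (t : R) : (f j p.1 ^+ 2 * t < 0) = (f j p.1 != 0) && (t < 0).
  by have := wE j (- t); rewrite mulrN !oppr_gt0.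
exists e; split.
- split=> // v tv.
  have [a [Ha ua]] := seB _ (tangent_pushforwardB aB aF tv).
  have H j : exists b : 'rV[R]_(mdim (F j)), pushforward (prF j) v = fun h => \sum_i b 0 i * eF j i h.
    have [[_ seF] _ _ _] := HeF j.
    by have [b [Hb _]] := seF _ (tangent_pushforwardF aB aF tv j); exists b.
  have [b Hb] := fin_all_exists H.
  exists (join_row a b); split.
    have tc : tangent p (fun h => \sum_k join_row a b 0 k * e k h) by exact: tangent_bigsum.
    rewrite [LHS](joinv_pushforward aB aF tv) [RHS](joinv_pushforward aB aF tc).
    rewrite pB Ha lsub_join; congr joinv.
    apply: functional_extensionality_dep => j.
    by rewrite pF Hb partF_join.
  move=> c Hc; rewrite -(join_rowK c); congr join_row.
    by apply: ua; rewrite Hc pB.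
  apply: functional_extensionality_dep => j.
  have [[_ seF] _ _ _] := HeF j.
  have [b' [_ ub']] := seF _ (tangent_pushforwardF aB aF tv j).
  rewrite -(ub' _ (Hb j)); apply: ub'.
  by rewrite {1}Hc pF.
- move=> k k'; case: (idxP k) => [i|j i]; case: (idxP k') => [i'|j' i'] kk.
  + by rewrite gBB oB//; apply: contraNneq kk => ->.
  + by rewrite gBF.
  + by rewrite (form_sym (warped_bilinear p) (te _) (te _)) gBF.
  + have [E|jj] := eqVneq j j'; last by rewrite gFF'.
    case: _ / E i' kk => i' kk; rewrite gFF.
    have [_ oF _ _] := HeF j; rewrite oF ?mulr0//.
    by apply: contraNneq kk => ->.
- rewrite -rBE -sum1_card big_mkcond /= sum_idx; congr addn.
    rewrite -sum1_card [RHS]big_mkcond /=; apply: eq_bigr => i _.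
    by rewrite !inE gBB.
  apply: eq_bigr => j _; have [_ _ <- _] := HeF j.
  rewrite -sum1_card [in RHS]big_mkcond /= big_distrr /=; apply: eq_bigr => i _.
  by rewrite !inE gFF wE /weight; case: (f j p.1 != 0); rewrite /= ?mul1n ?mul0n.
- rewrite -sBE -sum1_card big_mkcond /= sum_idx; congr addn.
    rewrite -sum1_card [RHS]big_mkcond /=; apply: eq_bigr => i _.
    by rewrite !inE gBB.
  apply: eq_bigr => j _; have [_ _ _ <-] := HeF j.
  rewrite -sum1_card [in RHS]big_mkcond /= big_distrr /=; apply: eq_bigr => i _.
  by rewrite !inE gFF wE' /weight; case: (f j p.1 != 0); rewrite /= ?mul1n ?mul0n.
Qed.

Local Notation upd := (@dfwith _ (fun k => F k : Type)).

Lemma upd_self (q : prod_topology (fun j => F j)) j : upd q j (q j) = q.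
Proof. by apply: functional_extensionality_dep => m; case: dfwithP. Qed.

Lemma sliceB_continuous (p : M) : continuous (fun b : B => ((b, p.2) : M)).
Proof.
move=> b; apply: (@cvg_pair _ _ _ _ _ _ (nbhs_filter b) (nbhs_filter b) (nbhs_filter _)).
  exact: cvg_id.
exact: cvg_cst.
Qed.

Lemma sliceF_continuous j (p : M) : continuous (fun y : F j => ((p.1, upd p.2 j y) : M)).
Proof.
move=> y; apply: (@cvg_pair _ _ _ _ _ _ (nbhs_filter y) (nbhs_filter p.1) (nbhs_filter _)).
  exact: cvg_cst.
exact: (@dfwith_continuous _ (fun j => F j) p.2 j y).
Qed.

Lemma near_sliceB (p : M) (P : set M) : (\forall q \near p, P q) ->
  \forall b \near p.1, P (b, p.2).
Proof.
case: p => b q nP; exact: (@sliceB_continuous (b, q) b P nP).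
Qed.

Lemma near_sliceF j (p : M) (P : set M) : (\forall q \near p, P q) ->
  \forall y \near p.2 j, P (p.1, upd p.2 j y).
Proof.
case: p => b q nP; apply: (@sliceF_continuous j (b, q) (q j) P) => /=.
by rewrite upd_self.
Qed.

Lemma near_prB (p : M) (P : set B) : (\forall b \near p.1, P b) -> \forall q \near p, P q.1.
Proof. by move=> nP; exact: (@prB_continuous _ _ _ _ p P nP). Qed.

Lemma near_prF j (p : M) (P : set (F j)) : (\forall y \near p.2 j, P y) ->
  \forall q \near p, P (q.2 j).
Proof. by move=> nP; exact: (@prF_continuous _ _ _ _ j p P nP). Qed.

Lemma near_neq0 (N : charted R) (aN : smooth_atlas N) (h : N -> R) q : smooth h -> h q != 0 ->
  \forall q' \near q, h q' != 0.
Proof.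
move=> sh h0; have ch : {for q, continuous h} by exact: smooth_continuous.
apply: (ch [set t | t != 0]).
by apply: open_nbhs_nbhs; split; [exact: open_neq|exact: h0].
Qed.

(* The signature is the sum of terms that are each lower semicontinuous, so if the
   sum is locally constant then so is every term.  When [f j p.1 = 0] and [f j] is
   not locally zero, this forces the signature of [gF j] to be (0, 0). *)
Lemma warped_regular (p : M) : regular_point g p ->
  [/\ regular_point gB p.1,
      forall j, f j p.1 != 0 -> regular_point (gF j) (p.2 j) &
      forall j u, f j p.1 = 0 -> tangent p.1 u -> u (f j) != 0 ->
        forall v w, tangent (p.2 j) v -> tangent (p.2 j) w -> gF j (p.2 j) v w = 0].
Proof.
move=> [r0 [s0 reg]].
have [rB HrB] := choice (fun b => signature_exists aB mB b).
have [sB HB] := choice HrB.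
have HexF j : exists r : F j -> nat, exists s : F j -> nat, forall y, has_signature (gF j) y (r y) (s y).
  have [r Hr] := choice (fun y => signature_exists (aF j) (mF j) y).
  by have [s Hs] := choice Hr; exists r, s.
have [rF HrF] := fin_all_exists HexF; have [sF HF] := fin_all_exists HrF.
have sig (q : M) : has_signature g q
    (rB q.1 + \sum_j weight j q.1 * rF j (q.2 j))%N
    (sB q.1 + \sum_j weight j q.1 * sF j (q.2 j))%N.
  by apply: product_signature => [|j]; [exact: HB|exact: HF].
have regE (q : M) : has_signature g q r0 s0 ->
    (rB q.1 + \sum_j weight j q.1 * rF j (q.2 j))%N = r0 /\
    (sB q.1 + \sum_j weight j q.1 * sF j (q.2 j))%N = s0.
  exact: (signature_unique aM (warped_bilinear q) (sig q)).
have [Er Es] := regE p (nbhs_singleton reg).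
have nB : \forall q \near p, (rB p.1 <= rB q.1)%N /\ (sB p.1 <= sB q.1)%N.
  apply: (near_prB (P := fun b => (rB p.1 <= rB b)%N /\ (sB p.1 <= sB b)%N)).
  by apply: filterS (signature_lsc aB mB (HB p.1)) => b; apply; exact: HB.
have nF : \forall q \near p, forall j, (rF j (p.2 j) <= rF j (q.2 j))%N /\ (sF j (p.2 j) <= sF j (q.2 j))%N.
  near=> q => j; move: (j); near: q; apply: filter_forall => {}j.
  apply: (near_prF (P := fun y => (rF j (p.2 j) <= rF j y)%N /\ (sF j (p.2 j) <= sF j y)%N)).
  by apply: filterS (signature_lsc (aF j) (mF j) (HF j (p.2 j))) => y; apply; exact: HF.
(* Weights are lower semicontinuous as well, since [f j != 0] is an open condition; hence each
   product of a weight with an index is. *)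
have nW : \forall q \near p, forall j, (weight j p.1 <= weight j q.1)%N.
  near=> q => j; move: (j); near: q; apply: filter_forall => {}j.
  apply: (near_prB (P := fun b => (weight j p.1 <= weight j b)%N)).
  rewrite /weight; have [f0|f0] := eqVneq (f j p.1) 0; first exact: nearW.
  by apply: filterS (near_neq0 aB (sf j) f0) => b ->.
have N : \forall q \near p, [/\ rB q.1 = rB p.1, sB q.1 = sB p.1,
    forall j, (weight j q.1 * rF j (q.2 j) = weight j p.1 * rF j (p.2 j))%N &
    forall j, (weight j q.1 * sF j (q.2 j) = weight j p.1 * sF j (p.2 j))%N].
  near=> q.
  have hq : has_signature g q r0 s0 by near: q.
  have [rq sq] := regE q hq.
  have [bB1 bB2] : (rB p.1 <= rB q.1)%N /\ (sB p.1 <= sB q.1)%N by near: q.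
  have bf : forall j, (rF j (p.2 j) <= rF j (q.2 j))%N /\ (sF j (p.2 j) <= sF j (q.2 j))%N by near: q.
  have bW : forall j, (weight j p.1 <= weight j q.1)%N by near: q.
  rewrite -rq in Er; rewrite -sq in Es.
  have [-> e1] := leq_sum_eq bB1 (fun j => leq_mul (bW j) (bf j).1) Er.
  have [-> e2] := leq_sum_eq bB2 (fun j => leq_mul (bW j) (bf j).2) Es.
  by split.
split.
- exists (rB p.1), (sB p.1).
  apply: filterS (near_sliceB N) => b /= [<- <- _ _]; exact: HB.
- move=> j f0; exists (rF j (p.2 j)), (sF j (p.2 j)).
  apply: filterS (near_sliceF j N) => y /= [_ _ /(_ j) + /(_ j)].
  by rewrite dfwithin /weight f0 !mul1n => <- <-; exact: HF.
- move=> j u f0 tu uf.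
  have [r00 s00] : rF j (p.2 j) = 0%N /\ sF j (p.2 j) = 0%N.
    (* If an index of the fibre were nonzero, constancy of its weighted contribution along the slice
       through [p.2] would force [f j] to vanish near [p.1], and then [u (f j) = 0]. *)
    have [//|n0] := pselect (rF j (p.2 j) = 0%N /\ sF j (p.2 j) = 0%N).
    case/eqP: uf; rewrite -(tangent_cst 0 tu).
    apply: (tangent_near aB tu) => //; first exact: smooth_cst.
    apply: filterS (near_sliceB N) => b /= [_ _ /(_ j) e1 /(_ j) e2].
    apply: contrapT => /eqP fb; apply: n0.
    by move: e1 e2; rewrite /weight f0 eqxx fb !mul0n !mul1n.
  have [e [be oe pe ne]] := HF j (p.2 j).
  have e0 i k : gF j (p.2 j) (e i) (e k) = 0.
    have [->|ik] := eqVneq i k; last exact: oe.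
    rewrite r00 in pe; rewrite s00 in ne.
    have := card0_eq pe k; have := card0_eq ne k; rewrite !inE.
    by case: ltrgtP.
  have bp := metric_bilinear (mF j) (p.2 j).
  have te : forall i, tangent (p.2 j) (e i) by case: be.
  move=> v w tv tw; have [_ se] := be.
  have [a [-> _]] := se v tv; have [a' [-> _]] := se w tw.
  rewrite (form_suml (aF j) bp)//; last exact: tangent_bigsum.
  rewrite big1// => i _; rewrite (form_sumr (aF j) bp)// big1 ?mulr0// => k _.
  by rewrite e0 mulr0.
Unshelve. all: by end_near. Qed.

(** The assumption on [f] makes the weights locally constant, so the sum of locally constant
    signatures is constant. *)
Lemma regular_warped (p : M) : regular_point gB p.1 ->
  (forall j, regular_point (gF j) (p.2 j)) ->
  (forall j, f j p.1 != 0 \/ \forall b \near p.1, f j b = 0) -> regular_point g p.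
Proof.
move=> [r0 [s0 hB]] hF hf.
have [r hr] := fin_all_exists hF; have [s hs] := fin_all_exists hr.
exists (r0 + \sum_j weight j p.1 * r j)%N, (s0 + \sum_j weight j p.1 * s j)%N.
near=> q.
have nw : forall j, weight j q.1 = weight j p.1.
  move=> j; move: (j); near: q; apply: filter_forall => {}j.
  apply: (near_prB (P := fun b => weight j b = weight j p.1)); rewrite /weight.
  have [f0|f0] := hf j.
    by apply: filterS (near_neq0 aB (sf j) f0) => b ->; rewrite f0.
  by rewrite (nbhs_singleton f0) eqxx; apply: filterS f0 => b ->; rewrite eqxx.
have -> : (r0 + \sum_j weight j p.1 * r j)%N = (r0 + \sum_j weight j q.1 * r j)%N.
  by under [in RHS]eq_bigr do rewrite nw.
have -> : (s0 + \sum_j weight j p.1 * s j)%N = (s0 + \sum_j weight j q.1 * s j)%N.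
  by under [in RHS]eq_bigr do rewrite nw.
apply: product_signature.
  by near: q; exact: (near_prB (P := fun b => has_signature gB b r0 s0) hB).
move=> j; move: (j); near: q; apply: filter_forall => {}j.
exact: (near_prF (P := fun y => has_signature (gF j) y (r j) (s j)) (hs j)).
Unshelve. all: by end_near. Qed.

(** For each [j] in turn, the open set is cut down to the part where [f j] is nonzero, unless that
    part is empty. *)
Lemma constant_vanishing (s : seq 'I_l) (O : set B) b : open O -> O b ->
  exists V b', [/\ open V, V b', V `<=` O & forall j, j \in s ->
    (forall x, V x -> f j x != 0) \/ (forall x, V x -> f j x = 0)].
Proof.
move=> oO Ob; elim: s => [|j s [V [b' [oV Vb' VO HV]]]].
  by exists O, b; split.
have [[x [Vx fx]]|nx] := pselect (exists x, V x /\ f j x != 0).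
  exists (V `&` (f j @^-1` [set t | t != 0])), x; split=> //.
  - apply: openI => //; apply: open_comp; last exact: open_neq.
    by move=> y _; exact: smooth_continuous.
  - by apply: subset_trans VO; exact: subIsetl.
  - move=> k; rewrite inE => /orP[/eqP ->|/HV[H|H]]; first by left=> y [].
      by left=> y [/H].
    by right=> y [/H].
exists V, b'; split=> // k; rewrite inE => /orP[/eqP ->|/HV//].
right=> x Vx; apply/eqP; apply: contraT => fx; case: nx.
by exists x.
Qed.

(** The point is corrected one coordinate at a time inside the open set, by density in each factor,
    after [B] has been restricted to a set where every [f j] is nowhere zero or identically zero. *)
Lemma warped_regular_dense (O : set M) p : open O -> O p ->
  exists q, O q /\ regular_point g q.
Proof.
case: p => b q oO Op.
have oOB : open [set b' : B | O (b', q)].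
  apply: (@open_comp _ _ (fun b' : B => ((b', q) : M))) => // b' _.
  exact: (@sliceB_continuous (b, q)).
have [V [b1 [oV Vb1 VO HV]]] := constant_vanishing (enum 'I_l) oOB Op.
have [b2 [Vb2 rb2]] := regular_dense aB mB oV Vb1.
have [q2 [Oq2 rq2]] : exists q2, O (b2, q2) /\
    forall j, j \in enum 'I_l -> regular_point (gF j) (q2 j).
  elim: (enum 'I_l) => [|j s [q1 [Oq1 rq1]]].
    by exists q; split=> //; exact: VO.
  have oOF : open [set y : F j | O (b2, upd q1 j y)].
    apply: (@open_comp _ _ (fun y : F j => ((b2, upd q1 j y) : M))) => // y _.
    exact: (@sliceF_continuous j (b2, q1)).
  have Oj : [set y : F j | O (b2, upd q1 j y)] (q1 j) by rewrite /mkset upd_self.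
  have [y [Oy ry]] := regular_dense (aF j) (mF j) oOF Oj.
  exists (upd q1 j y); split=> // k; rewrite inE => ks.
  have [E|jk] := eqVneq j k; first by case: _ / E {ks}; rewrite dfwithin.
  by rewrite dfwithout//; apply: rq1; move: ks; rewrite eq_sym (negbTE jk).
exists (b2, q2); split=> //; apply: regular_warped => //= j.
  by apply: rq2; rewrite mem_enum.
have [H|H] : (forall x, V x -> f j x != 0) \/ (forall x, V x -> f j x = 0).
  by apply: HV; rewrite mem_enum.
  by left; exact: H.
by right; apply: filterS (open_nbhs_nbhs (conj oV Vb2)).
Qed.

End Warped.

(** * Symmetry of second derivatives and Lie brackets *)

Lemma near_dist (R : realType) (T : topologicalType) (h : T -> R) x (e : R) :
  {for x, continuous h} -> 0 < e -> \forall z \near x, `|h z - h x| <= e.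
Proof.
move=> ch e0; have /cvgrPdist_le/(_ _ e0) := ch.
by apply: filterS => z; rewrite distrC.
Qed.

Section Clairaut.
Context {R : realType} {n : nat}.
Implicit Types (f : 'rV[R]_n -> R) (x v : 'rV[R]_n).

Lemma is_derive_shiftV f c v x l : is_derive (x + c) v f l ->
  is_derive x v (fun z => f (z + c)) l.
Proof.
have E : (fun h : R => h^-1 *: (((fun z => f (z + c)) \o shift x) (h *: v) - f (x + c))) =
         (fun h : R => h^-1 *: ((f \o shift (x + c)) (h *: v) - f (x + c))).
  by apply/funext => h /=; rewrite addrA.
by case=> d e; split; [rewrite /derivable E|rewrite /derive E].
Qed.

(* Two nested applications of the mean value inequality. *)
Lemma second_difference f (i j : 'I_n) x (t b e : R) :
  (forall s u : R, `|s| <= `|t| -> `|u| <= `|t| ->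
     let z := s *: delta_mx 0 i + (u *: delta_mx 0 j + x) in
     [/\ derivable f z (delta_mx 0 i),
       derivable ('D_(delta_mx 0 i) f) z (delta_mx 0 j) &
       `|'D_(delta_mx 0 j) ('D_(delta_mx 0 i) f) z - b| <= e]) ->
  `|f (t *: delta_mx 0 i + (t *: delta_mx 0 j + x)) - f (t *: delta_mx 0 j + x)
    - (f (t *: delta_mx 0 i + x) - f x) - t * (t * b)| <= e * `|t| * `|t|.
Proof.
move=> H.
pose phi z := f (z + t *: delta_mx 0 j) - f z.
have lt0 : `|(0 : R)| <= `|t| by rewrite normr0.
have dphi s : `|s| <= `|t| -> is_derive (s *: delta_mx 0 i + x) (delta_mx 0 i) phi
    ('D_(delta_mx 0 i) f (s *: delta_mx 0 i + x + t *: delta_mx 0 j) -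
     'D_(delta_mx 0 i) f (s *: delta_mx 0 i + x)).
  move=> st; apply: (@is_deriveB _ _ _ (fun z => f (z + t *: delta_mx 0 j)) f).
    apply: is_derive_shiftV; apply/derivableP.
    by have [+ _ _] := H s t st (lexx _); rewrite -addrA [x + _]addrC.
  by apply/derivableP; have [+ _ _] := H s 0 st lt0; rewrite scale0r add0r.
have phi1 : phi (t *: delta_mx 0 i + x) =
    f (t *: delta_mx 0 i + (t *: delta_mx 0 j + x)) - f (t *: delta_mx 0 i + x).
  by rewrite /phi -addrA [x + _]addrC.
have phi0 : phi x = f (t *: delta_mx 0 j + x) - f x by rewrite /phi [x + _]addrC.
have M := @mvt_line R n phi i x t (t * b) (e * `|t|); rewrite phi1 phi0 in M.
set D := f _ in M *; set D1 := f (_ *: delta_mx 0 i + x) in M *.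
set D2 := f (_ *: delta_mx 0 j + x) in M *.
have -> : D - D2 - (D1 - f x) = D - D1 - (D2 - f x) by ring.
apply: M => s st; first by have [] := dphi s st.
have [_ ->] := dphi s st.
have -> : s *: delta_mx 0 i + x + t *: delta_mx 0 j =
   t *: delta_mx 0 j + (s *: delta_mx 0 i + x) by rewrite addrC.
apply: (@mvt_line R n ('D_(delta_mx 0 i) f) j (s *: delta_mx 0 i + x) t b e) => u ut.
  by have [_ + _] := H s u st ut; rewrite addrCA.
by have [_ _ +] := H s u st ut; rewrite addrCA.
Qed.

Lemma derive_comm (U : set 'rV[R]_n) f x (i j : 'I_n) : open U -> ck_on 2 U f -> U x ->
  'D_(delta_mx 0 i) ('D_(delta_mx 0 j) f) x = 'D_(delta_mx 0 j) ('D_(delta_mx 0 i) f) x.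
Proof.
move=> oU Cf Ux; set A := LHS; set C := RHS.
apply/eqP; rewrite -subr_eq0 -normr_le0; apply/ler_addgt0Pr => e e0; rewrite add0r.
have e20 : 0 < e / 2 by rewrite divr_gt0.
have cont k m : {for x, continuous ('D_(delta_mx 0 k) ('D_(delta_mx 0 m) f))}.
  by have [_ /(_ m)[_ [_ /(_ k)[_ [c _]]]]] := Cf; exact: c.
have N0 : \forall z \near x, U z by exact: open_nbhs_nbhs.
have N1 := near_dist (cont i j) e20; have N2 := near_dist (cont j i) e20.
have : \forall z \near x, U z /\
    (`|'D_(delta_mx 0 i) ('D_(delta_mx 0 j) f) z - A| <= e / 2 /\
     `|'D_(delta_mx 0 j) ('D_(delta_mx 0 i) f) z - C| <= e / 2).
  exact: filterI N0 (filterI N1 N2).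
move=> /nbhs_ballP[r /= r0 rU].
(* Two displacements of length at most [t], possibly along the same axis, stay in the ball of radius
   [r]. *)
pose t := r / 3; have t0 : 0 < t by rewrite divr_gt0.
have inb (k m : 'I_n) (s u : R) : `|s| <= `|t| -> `|u| <= `|t| ->
    ball x r (s *: delta_mx 0 k + (u *: delta_mx 0 m + x)).
  rewrite (gtr0_norm t0) => st ut; split=> // a c; rewrite ord1 {a} !mxE eqxx /= /ball /=.
  rewrite addrA opprD addrCA subrr addr0 normrN; apply: le_lt_trans (ler_normD _ _) _.
  rewrite !normrM !normr_nat.
  have b1 (b : bool) : b%:R <= 1 :> R by case: b.
  have : `|s| * (c == k)%:R <= t by rewrite -[leRHS]mulr1 ler_pM.
  have : `|u| * (c == m)%:R <= t by rewrite -[leRHS]mulr1 ler_pM.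
  by rewrite /t; lra.
have der k m z : U z -> derivable f z (delta_mx 0 k) /\
    derivable ('D_(delta_mx 0 k) f) z (delta_mx 0 m).
  by move=> Uz; have [_ /(_ k)[d1 [_ /(_ m)[d2 _]]]] := Cf; split; [exact: d1|exact: d2].
have h1 : `|f (t *: delta_mx 0 i + (t *: delta_mx 0 j + x)) - f (t *: delta_mx 0 j + x)
    - (f (t *: delta_mx 0 i + x) - f x) - t * (t * C)| <= e / 2 * `|t| * `|t|.
  apply: second_difference => s u st ut z.
  have /rU[Uz [_ hz]] := inb i j s u st ut.
  by have [d1 d2] := der i j z Uz.
have h2 : `|f (t *: delta_mx 0 j + (t *: delta_mx 0 i + x)) - f (t *: delta_mx 0 i + x)
    - (f (t *: delta_mx 0 j + x) - f x) - t * (t * A)| <= e / 2 * `|t| * `|t|.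
  apply: second_difference => s u st ut z.
  have /rU[Uz [hz _]] := inb j i s u st ut.
  by have [d1 d2] := der j i z Uz.
have E : t *: delta_mx 0 j + (t *: delta_mx 0 i + x) = t *: delta_mx 0 i + (t *: delta_mx 0 j + x) :> 'rV[R]_n.
  by rewrite addrCA.
rewrite E in h2.
set D := f _ in h1 h2; set D1 := f (_ *: delta_mx 0 j + _) in h1 h2.
set D2 := f (_ *: delta_mx 0 i + _) in h1 h2; set D0 := f x in h1 h2.
(* The second difference is symmetric in the two directions, and both mixed derivatives approximate
   its quotient by [t * t] up to [e / 2]. *)
have h3 : `|t * (t * A) - t * (t * C)| <= e * (t * t).
  have -> : t * (t * A) - t * (t * C) = (D - D1 - (D2 - D0) - t * (t * C)) -
     (D - D2 - (D1 - D0) - t * (t * A)) by ring.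
  apply: le_trans (ler_normB _ _) _; apply: le_trans (lerD h1 h2) _.
  rewrite (gtr0_norm t0).
  by have -> : e / 2 * t * t + e / 2 * t * t = e * (t * t) by field.
have tt0 : 0 < t * t by rewrite mulr_gt0.
move: h3; have -> : t * (t * A) - t * (t * C) = (t * t) * (A - C) by ring.
by rewrite normrM (gtr0_norm tt0) [e * _]mulrC ler_pM2l.
Qed.

End Clairaut.

(** * Lie brackets as vector fields, and fields through a given tangent vector *)

Section Bracket.
Context {R : realType} {M : charted R} (aM : smooth_atlas M).

Lemma partial_comm c i j p (f F G : M -> R) : atlas c -> ch_dom c p -> smooth f ->
  (\forall q \near p, F q = partial c i q f) ->
  (\forall q \near p, G q = partial c j q f) ->
  partial c j p F = partial c i p G.
Proof.
move=> ac cp sf hF hG.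
have E k (H : M -> R) : (\forall q \near p, H q = partial c k q f) ->
  \forall x \near ch_map c p, H (ch_inv c x) = 'D_(delta_mx 0 k) (fun x => f (ch_inv c x)) x.
  move=> hH; have N1 := near_im aM ac (im_map cp).
  have N2 : \forall x \near ch_map c p, H (ch_inv c x) = partial c k (ch_inv c x) f.
    apply: (near_inv (P := fun q => H q = partial c k q f) aM ac (im_map cp)).
    by rewrite (sa_mapK aM).
  by apply: filterS2 N1 N2 => x cx ->; rewrite /partial (map_inv aM).
rewrite /partial (near_eq_derive _ (E _ _ hF)) (near_eq_derive _ (E _ _ hG)).
exact: derive_comm (sa_im_open aM ac) (sf c ac 2%N) (im_map cp).
Qed.

Lemma vfield_cst (X : (M -> R) -> (M -> R)) a : vfield X -> X (fun=> a) = fun=> 0.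
Proof. by move=> [tX _]; apply/funext => p; exact: (tangent_cst a (tX p)). Qed.

Lemma vfield_nonsmooth (X : (M -> R) -> (M -> R)) f : vfield X -> ~ smooth f -> X f = fun=> 0.
Proof. by move=> [tX _] nf; apply/funext => p; exact: (tangent_nonsmooth (tX p) nf). Qed.

(** In a frame of coordinate fields the second-order terms of X Y h and Y X h agree by symmetry of
    second derivatives; what remains is a first-order operator with components
    [bracket X Y (y j) p]. *)
Lemma bracket_local (X Y : (M -> R) -> (M -> R)) p : vfield X -> vfield Y ->
  tangent p (vat (bracket X Y) p).
Proof.
move=> vX vY; have [tX sX] := vX; have [tY sY] := vY.
have [c ac cp] := sa_cover aM p.
have [E [y [vE sy nE]]] := local_frame_chart aM ac cp.
have [Ey Es [_ Ec]] := nbhs_singleton nE.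
have tE i q : tangent q (vat (E i) q) by have [+ _] := vE i; apply.
have sE i h : smooth h -> smooth (E i h) by have [_] := vE i; apply.
pose S i j h := E i (E j h) p.
have Ssym i j h : smooth h -> S i j h = S j i h.
  move=> sh; rewrite /S Ec; last exact: sE.
  rewrite Ec; last exact: sE.
  by apply: (partial_comm ac cp sh); apply: filterS nE => q [_ _ [_ H]]; exact: H.
(* Near [p], [W h] is the sum of [W (y j) * E j h]; differentiating by the product rule separates
   first-order from second-order terms. *)
have key (Z W : (M -> R) -> (M -> R)) h : vfield Z -> vfield W -> smooth h ->
   Z (W h) p = \sum_j Z (W (y j)) p * E j h p +
     \sum_j \sum_i W (y j) p * Z (y i) p * S i j h.
  move=> vZ vW sh; have [tZ sZ] := vZ; have [tW sW] := vW.
  have sWE j : smooth (fun q => W (y j) q * E j h q).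
    by apply: (smoothM aM); [exact/sW/sy|exact: sE].
  rewrite -[LHS]/(vat Z p (W h)).
  rewrite (@tangent_near _ _ aM _ _ _ (fun q => \sum_j W (y j) q * E j h q) (tZ p)).
  - rewrite (tangent_sum aM _ (tZ p))// -big_split /=; apply: eq_bigr => j _.
    rewrite (tangentM aM (tZ p)); [|exact/sW/sy|exact: sE].
    rewrite addrC [E j h p * _]mulrC; congr (_ + _).
    have H : vat Z p (E j h) = \sum_i Z (y i) p * E i (E j h) p.
      exact: (congr1 (fun u => u (E j h)) (Es _ (tZ p))).
    by rewrite H mulr_sumr; apply: eq_bigr => i _; rewrite mulrA.
  - exact: sW.
  - exact: smooth_sum.
  - apply: filterS nE => q [_ Esq _].
    by have := congr1 (fun u => u h) (Esq _ (tW q)).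
suff -> : vat (bracket X Y) p = fun h => \sum_j bracket X Y (y j) p * vat (E j) p h.
  exact: tangent_bigsum.
apply/funext => h; case: (pselect (smooth h)) => [sh|nh]; last first.
  rewrite big1 => [|j _]; last by rewrite (tangent_nonsmooth (tE j p) nh) mulr0.
  rewrite /vat /bracket !(vfield_nonsmooth _ nh)//.
  by rewrite (vfield_cst 0 vX) (vfield_cst 0 vY) subrr.
rewrite /vat /bracket (key X Y)// (key Y X)//.
have -> : \sum_j \sum_i Y (y j) p * X (y i) p * S i j h =
   \sum_j \sum_i X (y j) p * Y (y i) p * S i j h.
  rewrite exchange_big /=; apply: eq_bigr => i _; apply: eq_bigr => j _.
  by rewrite Ssym// [_ * X _ _]mulrC.
rewrite opprD addrACA subrr addr0 -sumrB; apply: eq_bigr => j _.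
by rewrite mulrBl.
Qed.

Lemma vfield_bracket (X Y : (M -> R) -> (M -> R)) : vfield X -> vfield Y ->
  vfield (bracket X Y).
Proof.
move=> vX vY; split=> [p|f sf]; first exact: bracket_local.
by apply: smoothB => //; [apply: vX.2; apply: vY.2|apply: vY.2; apply: vX.2].
Qed.

Lemma vfield_sum (I : Type) (r : seq I) (P : pred I) (a : I -> R)
    (E : I -> (M -> R) -> (M -> R)) : (forall i, P i -> vfield (E i)) ->
  vfield (fun f p => \sum_(i <- r | P i) a i * E i f p).
Proof.
move=> vE; split=> [p|f sf].
  by apply: (@tangent_bigsum _ _ aM p _ r P a (fun i => vat (E i) p)) => i /vE[+ _]; apply.
apply: smooth_sum => // i Pi; apply: smoothM => //; first exact: smooth_cst.
exact: (vE i Pi).2.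
Qed.

(* Constant coefficients in a local frame. *)
Lemma tangent_extend p v : tangent p v -> exists Y : (M -> R) -> (M -> R), vfield Y /\ vat Y p = v.
Proof.
move=> tv; have [E [y [vE sy /nbhs_singleton[_ Es]]]] := local_frame aM p.
exists (fun f q => \sum_i v (y i) * E i f q); split; first exact: vfield_sum.
by rewrite [RHS](Es _ tv).
Qed.

End Bracket.

(** * Koszul form, covariant derivative and gradient *)

Section MetricGeometry.
Context {R : realType} {M : charted R} (aM : smooth_atlas M) (g : tensor02 M).
Local Notation vf := ((M -> R) -> (M -> R)).
Local Notation n := (mdim M).

Section Represent.
Hypothesis bg : forall p, bilinear_at g p.

Lemma represents_eq p u u' w v : represents g p u w -> represents g p u' w ->
  tangent p v -> g p u v = g p u' v.
Proof.
move=> [_ ru] [_ ru'] tv; have [Y [vY <-]] := tangent_extend aM tv.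
by rewrite -ru// -ru'.
Qed.

(** The representatives chosen by [xget] are replaced by the given ones one argument at a time, with
    symmetry in between. *)
Lemma bullet_eq p u v w t : represents g p u w -> represents g p v t ->
  bullet g w t p = g p u v.
Proof.
move=> ru rv; rewrite /bullet.
set S := [set r | _].
have : S (xget 0 S) by apply: xgetPex; exists (g p u v), u, v.
move=> [u' [v' [ru' rv' ->]]].
have [tu _] := ru; have [tv _] := rv; have [tu' _] := ru'; have [tv' _] := rv'.
rewrite (represents_eq ru' ru tv') (form_sym (bg p) tu tv') (represents_eq rv' rv tu).
exact: (form_sym (bg p) tv tu).
Qed.

Lemma pairing_sym (X Y : vf) : vfield X -> vfield Y -> pairing g X Y = pairing g Y X.
Proof.
by move=> [tX _] [tY _]; apply/funext => p; exact: (form_sym (bg p) (tX p) (tY p)).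
Qed.

Lemma bracket_anti (X Y : vf) : bracket X Y = vscale (fun=> -1) (bracket Y X).
Proof.
by apply/funext => f; apply/funext => p; rewrite /bracket /vscale mulN1r opprB.
Qed.

Lemma pairing_bracket_anti (X Y Z : vf) p : vfield X -> vfield Y -> vfield Z ->
  pairing g X (bracket Y Z) p = - pairing g X (bracket Z Y) p.
Proof.
move=> vX vY vZ; have [tX _] := vX; have [tB _] := vfield_bracket aM vZ vY.
rewrite (bracket_anti Y Z) /pairing.
have -> : vat (vscale (fun=> -1) (bracket Z Y)) p = fun f => -1 * vat (bracket Z Y) p f by [].
by rewrite (form_scaler aM (bg p) (-1) (tB p) (tX p)) mulN1r.
Qed.

(** Metric compatibility in a form that makes sense for degenerate metrics, with the Koszul form in
    place of a connection; [koszul_torsion] does the same for torsion. *)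
Lemma koszul_metric (X Y Z : vf) p : vfield X -> vfield Y -> vfield Z ->
  X (pairing g Y Z) p = koszul g X Y Z p + koszul g X Z Y p.
Proof.
move=> vX vY vZ; rewrite /koszul.
rewrite (pairing_bracket_anti p vX vZ vY) (pairing_bracket_anti p vZ vY vX).
rewrite (pairing_bracket_anti p vY vX vZ) (pairing_sym vZ vY) (pairing_sym vY vX) (pairing_sym vX vZ).
by field.
Qed.

Lemma koszul_torsion (X Y Z : vf) p : vfield X -> vfield Y -> vfield Z ->
  koszul g X Y Z p - koszul g Y X Z p = pairing g (bracket X Y) Z p.
Proof.
move=> vX vY vZ; rewrite /koszul.
rewrite (pairing_bracket_anti p vY vX vZ) (pairing_bracket_anti p vX vZ vY).
rewrite (pairing_bracket_anti p vZ vY vX) (pairing_sym vZ vX) (pairing_sym vZ vY) (pairing_sym vX vY).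
rewrite (pairing_sym (vfield_bracket aM vX vY) vZ).
by field.
Qed.

End Represent.

Section SemiRegular.

Lemma lower_cov_spec X (w : vf -> M -> R) Y :
  (exists h, smooth h /\ forall p, regular_point g p -> h p = lower_cov_raw g X w Y p) ->
  smooth (lower_cov g X w Y) /\
  forall p, regular_point g p -> lower_cov g X w Y p = lower_cov_raw g X w Y p.
Proof.
move=> ex; rewrite /lower_cov; set S := [set h | _].
exact: (xgetPex (lower_cov_raw g X w Y) (ex : exists h, S h)).
Qed.

(** Without a smooth extension, [lower_cov] would be [lower_cov_raw] itself; semi-regularity makes
    it smooth, so it would be an extension after all. *)
Lemma lower_cov_semi_regular (X Y Z T : vf) : semi_regular g ->
  vfield X -> vfield Y -> vfield Z -> vfield T ->
  smooth (lower_cov g X (nabla_flat g Y Z) T) /\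
  forall p, regular_point g p ->
    lower_cov g X (nabla_flat g Y Z) T p = lower_cov_raw g X (nabla_flat g Y Z) T p.
Proof.
move=> sr vX vY vZ vT; apply: lower_cov_spec; apply: contrapT => /forallNP nex.
have [[/(_ _ vT) sm _ _] _] := semi_regular_cov sr vY vZ vX.
move: sm; rewrite /lower_cov; set S := [set h | _].
rewrite (xgetPN (lower_cov_raw g X (nabla_flat g Y Z) T) (P := S)).
  by move=> sm; apply: (nex (lower_cov_raw g X (nabla_flat g Y Z) T)).
by move=> h Sh; exact: (nex h Sh).
Qed.

End SemiRegular.

Section LeviCivita.
Hypothesis mg : singular_metric g.
Variable D : vf -> vf -> vf.
Hypothesis LC : levi_civita g D.
Let bg p := metric_bilinear mg p.

Lemma koszul_levi_civita (X Y Z : vf) p : vfield X -> vfield Y -> vfield Z ->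
  koszul g X Y Z p = pairing g (D X Y) Z p.
Proof.
move=> vX vY vZ.
have vD A A' : vfield A -> vfield A' -> vfield (D A A') by exact: (lc_vfield LC).
have br (A A' A'' : vf) : vfield A -> vfield A' -> vfield A'' ->
    pairing g A (bracket A' A'') p = pairing g A (D A' A'') p - pairing g A (D A'' A') p.
  move=> vA vA' vA''.
  have [t1 _] := vD _ _ vA' vA''; have [t2 _] := vD _ _ vA'' vA'; have [tA _] := vA.
  have E : vat (bracket A' A'') p = fun f => vat (D A' A'') p f + -1 * vat (D A'' A') p f.
    by apply/funext => f; rewrite mulN1r; rewrite /vat (lc_torsion_free LC).
  rewrite /pairing E (form_addr aM (bg p) (t1 p) (tangent_scale aM (-1) (t2 p)) (tA p)).
  by rewrite (form_scaler aM (bg p) (-1) (t2 p) (tA p)) mulN1r.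
rewrite /koszul !br//.
rewrite (lc_metric LC vX vY vZ) (lc_metric LC vY vZ vX) (lc_metric LC vZ vX vY).
rewrite (pairing_sym bg (vD _ _ vX vY) vZ) (pairing_sym bg (vD _ _ vY vZ) vX).
rewrite (pairing_sym bg (vD _ _ vZ vX) vY).
by field.
Qed.

Lemma represents_levi_civita (X Y : vf) p : vfield X -> vfield Y ->
  represents g p (vat (D X Y) p) (nabla_flat g X Y).
Proof.
move=> vX vY; split; first by have [+ _] := lc_vfield LC vX vY; apply.
by move=> Z vZ; rewrite /nabla_flat koszul_levi_civita.
Qed.

Lemma lower_cov_levi_civita (X Y Z T : vf) :
  vfield X -> vfield Y -> vfield Z -> vfield T ->
  smooth (lower_cov g X (nabla_flat g Y Z) T) /\
  forall p, regular_point g p ->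
    lower_cov g X (nabla_flat g Y Z) T p = lower_cov_raw g X (nabla_flat g Y Z) T p.
Proof.
move=> vX vY vZ vT; apply: lower_cov_spec.
have vD A A' : vfield A -> vfield A' -> vfield (D A A') by exact: (lc_vfield LC).
(* With representatives [D Y Z] and [D X T] the raw expression is smooth everywhere, so it is its
   own extension. *)
exists (fun p => X (pairing g (D Y Z) T) p - pairing g (D X T) (D Y Z) p); split.
  apply: (smoothB aM); last by apply: (metric_smooth mg); exact: vD.
  by apply: vX.2; apply: (metric_smooth mg) => //; exact: vD.
move=> p _; rewrite /lower_cov_raw.
rewrite (bullet_eq bg (represents_levi_civita p vX vT) (represents_levi_civita p vY vZ)).
congr (X _ p - _); apply/funext => q.
by rewrite /nabla_flat koszul_levi_civita.
Qed.

End LeviCivita.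

Section Gradient.
Hypothesis mg : singular_metric g.
Hypothesis nd : nondegenerate_metric g.
Let bg p := metric_bilinear mg p.

Lemma represents_tangent p u (f : M -> R) v : represents g p u (differential f) ->
  tangent p v -> g p u v = v f.
Proof.
by move=> [_ ru] tv; have [Y [vY <-]] := tangent_extend aM tv; rewrite -ru.
Qed.

(** A row in the kernel of the Gram matrix is the coordinate row of a vector orthogonal to
    everything, which is 0 by nondegeneracy; its coordinates are then 0 by uniqueness. *)
Lemma gram_unit p e : tangent_basis p e -> gram g p e \in unitmx.
Proof.
move=> [te se]; rewrite -row_free_unit -kermx_eq0; apply/negPn/negP => /rowV0Pn[c].
move=> /sub_kermxP cG; apply/negP; rewrite negbK.
pose u := fun f => \sum_i c 0 i * e i f.
have tu : tangent p u by exact: tangent_bigsum.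
have u0 : u = fun=> 0.
  apply: (nd tu) => v tv; have [a [-> _]] := se _ tv.
  rewrite (form_sumr aM (bg p) _ _ (fun i _ => te i) tu) big1// => j _.
  rewrite (form_suml aM (bg p) _ _ (fun i _ => te i) (te j)).
  have := congr1 (fun A : 'rV_ _ => A 0 j) cG; rewrite !mxE => E.
  rewrite (_ : \sum_i _ = 0) ?mulr0// -[RHS]E; apply: eq_bigr => i _.
  by rewrite mxE.
have [a [_ ua]] := se _ tu.
have <- : a = c by apply: ua.
apply/eqP; apply: ua; rewrite u0; apply/funext => f.
by rewrite big1// => i _; rewrite mxE mul0r.
Qed.

Lemma gradient_coord p e (f : M -> R) : tangent_basis p e ->
  represents g p (fun h => \sum_i ((\row_j e j f) *m invmx (gram g p e)) 0 i * e i h)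
    (differential f).
Proof.
move=> be; have [te se] := be; split; first exact: tangent_bigsum.
set a := _ *m _ => Y [tY _]; have [b [Yb _]] := se _ (tY p).
have ta : tangent p (fun h => \sum_i a 0 i * e i h) by exact: tangent_bigsum.
rewrite -[LHS]/(vat Y p f) Yb (form_sumr aM (bg p) _ _ (fun i _ => te i) ta).
apply: eq_bigr => j _; congr (_ * _); rewrite (form_suml aM (bg p) _ _ (fun i _ => te i) (te j)).
have aG : a *m gram g p e = \row_j e j f by rewrite /a -mulmxA mulVmx ?mulmx1// gram_unit.
have := congr1 (fun A : 'rV_ _ => A 0 j) aG; rewrite [in RHS]mxE mxE => <-.
by apply: eq_bigr => i _; rewrite [gram _ _ _ _ _]mxE.
Qed.

Lemma gradient_exists p (f : M -> R) : exists u, represents g p u (differential f).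
Proof.
have [E [y [vE sy /nbhs_singleton[Ey Es]]]] := local_frame aM p.
by eexists; exact: gradient_coord (frame_basis vE Ey Es).
Qed.

(* Cramer's rule: [\det G] times the bullet is polynomial in smooth functions. *)
Lemma smooth_bullet_differential (f h : M -> R) : smooth f -> smooth h ->
  smooth (bullet g (differential f) (differential h)).
Proof.
move=> sf sh; apply: (smooth_quotient_local aM) => p.
have [E [y [vE sy nE]]] := local_frame aM p.
pose G q := gram g q (fun i => vat (E i) q).
have sG i j : smooth (fun q => G q i j).
  rewrite (_ : (fun q => G q i j) = pairing g (E i) (E j)); first exact: (metric_smooth mg).
  by apply/funext => q; rewrite mxE.
pose N q := \sum_i (\sum_j E j f q * (\adj (G q)) j i) * E i h q.
have bas q : ((forall i j, E i (y j) q = (i == j)%:R) /\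
     forall v, tangent q v -> v = fun f => \sum_(i < mdim M) v (y i) * E i f q) ->
     tangent_basis q (fun i => vat (E i) q).
  by move=> [Ey Es]; exact: frame_basis vE Ey Es.
exists (fun q => \det (G q)), N; split.
- exact: (smooth_det aM).
- apply: (smooth_sum aM) => i _; apply: (smoothM aM); last exact: (vE i).2.
  apply: (smooth_sum aM) => j _; apply: (smoothM aM); first exact: (vE j).2.
  rewrite (_ : (fun q => _) = (fun q => cofactor (G q) i j)); last first.
    by apply/funext => q; rewrite mxE.
  apply: (smoothM aM); first exact: smooth_cst.
  apply: (smooth_det aM) => k m.
  rewrite (_ : (fun q => _) = (fun q => G q (lift i k) (lift j m))); first exact: sG.
  by apply/funext => q; rewrite !mxE.
- by rewrite -unitfE -unitmxE gram_unit//; exact/bas/(nbhs_singleton nE).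
- apply: filterS nE => q /bas bq.
  rewrite (bullet_eq bg (gradient_coord f bq) (gradient_coord h bq)).
  have [th _] := gradient_coord h bq; have [tf _] := gradient_coord f bq.
  rewrite (form_sym (bg q) tf th) (represents_tangent (gradient_coord h bq) tf).
  rewrite mulr_sumr; apply: eq_bigr => i _; rewrite mulrA; congr (_ * _).
  have uG : G q \in unitmx by exact: gram_unit.
  rewrite -/(G q) mxE mulr_sumr; apply: eq_bigr => j _.
  rewrite mxE mulrCA; congr (_ * _).
  rewrite /invmx uG mxE mulrA mulrV ?mul1r//.
Qed.

End Gradient.

End MetricGeometry.

(** * Sums of lifted fields *)

Section JField.
Context {R : realType} {l : nat} {B : charted R} {F : 'I_l -> charted R}.
Hypotheses (aB : smooth_atlas B) (aF : forall j, smooth_atlas (F j)).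
Local Notation M := (prod_manifold B F).
Let aM : smooth_atlas M := prod_smooth_atlas aB aF.
Local Notation prF := (@prF R l B F).
Local Notation prB := (@prB R l B F).

Lemma tangent_eq (p : M) u v : tangent p u -> tangent p v ->
  pushforward prB u = pushforward prB v ->
  (forall j, pushforward (prF j) u = pushforward (prF j) v) -> u = v.
Proof.
move=> tu tv eB eF.
rewrite (joinv_pushforward aB aF tu) (joinv_pushforward aB aF tv) eB; congr joinv.
by apply: functional_extensionality_dep.
Qed.

(** The components of a tangent vector in the chart are its values on globally smooth functions, so
    for a field on a factor they are smooth and can be pulled back to the product. *)
Lemma chart_expansion (N : charted R) (aN : smooth_atlas N) (c : chart R N (mdim N)) p :
  atlas c -> ch_dom c p -> exists y : 'I_(mdim N) -> N -> R, (forall i, smooth (y i)) /\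
    \forall q \near p, ch_dom c q /\ forall v f, tangent q v -> smooth f ->
      v f = \sum_i v (y i) * partial c i q f.
Proof.
move=> ac cp; have [E [y [_ sy nE]]] := local_frame_chart aN ac cp.
exists y; split=> //; apply: filterS nE => q [_ Es [cq Ec]]; split=> // v f tv sf.
rewrite {1}(Es v tv); apply: eq_bigr => i _.
by rewrite Ec.
Qed.

(* In a product chart, [jfield X V h] is a combination of partial derivatives of
   [h] with coefficients pulled back from the factors. *)
Lemma smooth_jfield (X : (B -> R) -> (B -> R)) (V : forall j, (F j -> R) -> (F j -> R)) h :
  vfield X -> (forall j, vfield (V j)) -> smooth h -> smooth (jfield X V h : M -> R).
Proof.
move=> vX vV sh; apply: (smooth_local aM) => p.
have [c [d [ac ad cp dp]]] := prod_cover aB aF p.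
have [yB [syB nB]] := chart_expansion aB ac cp.
have [yF HF] := fin_all_exists (fun j => chart_expansion (aF j) (ad j) (dp j)).
have ae : atlas (prod_chart c d : chart R M (mdim M)) by exists c, d.
have [E [y [vE _ nE]]] := local_frame_chart aM ae (conj cp dp).
exists (fun q => \sum_i X (yB i) (prB q) * E (idxB i) h q +
  \sum_j \sum_i V j (yF j i) (prF j q) * E (@idxF _ _ _ _ j i) h q); split.
  apply: (smoothD aM).
    apply: (smooth_sum aM) => i _; apply: (smoothM aM); last exact: (vE _).2.
    by apply: smooth_prB => //; exact: vX.2.
  apply: (smooth_sum aM) => j _; apply: (smooth_sum aM) => i _.
  apply: (smoothM aM); last exact: (vE _).2.
  by apply: (smooth_prF aB aF); apply: (vV j).2; exact: (HF j).1.
have nF : \forall q \near p, forall j, ch_dom (d j) (q.2 j) /\ forall v f,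
    tangent (q.2 j) v -> smooth f -> v f = \sum_i v (yF j i) * partial (d j) i (q.2 j) f.
  near=> q => j; move: (j); near: q; apply: filter_forall => {}j.
  exact: (@prF_continuous R l B F j p _ (HF j).2).
have nB' : \forall q \near p, ch_dom c q.1 /\ forall v f,
    tangent q.1 v -> smooth f -> v f = \sum_i v (yB i) * partial c i q.1 f.
  exact: (@prB_continuous R l B F p _ nB).
apply: filterS3 nB' nF nE => q [cq XE] VE [_ _ [_ Eh]].
rewrite /jfield joinvE// (XE _ _ (vX.1 _) (smooth_sliceB aB aF q sh)); congr (_ + _).
  by apply: eq_bigr => i _; rewrite Eh// (partial_idxB aF c ad (fun j => (VE j).1)).
apply: eq_bigr => j _; rewrite ((VE j).2 _ _ ((vV j).1 _) (smooth_sliceF aB aF q sh)).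
by apply: eq_bigr => i _; rewrite Eh// (partial_idxF aB aF ac ad cq (fun j => (VE j).1)).
Unshelve. all: by end_near. Qed.

Lemma vfield_jfield (X : (B -> R) -> (B -> R)) (V : forall j, (F j -> R) -> (F j -> R)) :
  vfield X -> (forall j, vfield (V j)) -> vfield (jfield X V).
Proof.
by move=> vX vV; split=> [p|h sh]; [exact: tangent_jfield|exact: smooth_jfield].
Qed.

(** Pushforwards to the factors determine a tangent vector, and on functions pulled back from a
    factor both sides act as the bracket on that factor. *)
Lemma bracket_jfield (X X' : (B -> R) -> (B -> R)) (V V' : forall j, (F j -> R) -> (F j -> R)) :
  vfield X -> vfield X' -> (forall j, vfield (V j)) -> (forall j, vfield (V' j)) ->
  bracket (jfield X V) (jfield X' V') =
  jfield (bracket X X') (fun j => bracket (V j) (V' j)).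
Proof.
move=> vX vX' vV vV'.
have vE := vfield_jfield vX vV; have vE' := vfield_jfield vX' vV'.
have vb := vfield_bracket aB vX vX'.
have vbF j := vfield_bracket (aF j) (vV j) (vV' j).
suff H p : vat (bracket (jfield X V) (jfield X' V')) p =
    vat (jfield (bracket X X') (fun j => bracket (V j) (V' j))) p.
  by apply/funext => h; apply/funext => p; exact: (congr1 (fun u => u h) (H p)).
apply: tangent_eq.
- by have [+ _] := vfield_bracket aM vE vE'; apply.
- exact: tangent_jfield.
- apply/funext => h; rewrite /pushforward; case: asboolP => // sh.
  rewrite /vat (jfield_prB aB aF)// /bracket !(jfield_prB aB aF)//.
    exact: vX.2.
  exact: vX'.2.
- move=> j; apply/funext => h; rewrite /pushforward; case: asboolP => // sh.
  rewrite /vat (jfield_prF aB aF)// /bracket !(jfield_prF aB aF)//.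
    exact: (vV j).2.
  exact: (vV' j).2.
Qed.

End JField.

(** * Koszul form of a metric pulled back along a smooth map *)

Section Pullback.
Context {R : realType} {M N : charted R} (aM : smooth_atlas M) (aN : smooth_atlas N).
Variables (pi : M -> N) (g : tensor02 N).
Hypothesis mg : singular_metric g.
Hypothesis cpi : continuous pi.
Hypothesis spi : forall h : N -> R, smooth h -> smooth (fun p => h (pi p)).
Hypothesis tpi : forall p v, tangent p v -> tangent (pi p) (pushforward pi v).
Let bg p := metric_bilinear mg p.

Definition pull : tensor02 M := fun p u v => g (pi p) (pushforward pi u) (pushforward pi v).

Definition related (E : (M -> R) -> (M -> R)) (X : (N -> R) -> (N -> R)) :=
  forall f, smooth f -> E (fun p => f (pi p)) = fun p => X f (pi p).

Lemma pushforward_related E X p : vfield X -> related E X ->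
  pushforward pi (vat E p) = vat X (pi p).
Proof.
move=> [tX _] rel; apply/funext => f; rewrite /pushforward; case: asboolP => sf.
  by rewrite /vat rel.
by rewrite (tangent_nonsmooth (tX _) sf).
Qed.

Lemma pairing_pull_related E E' X X' : vfield X -> vfield X' -> related E X ->
  related E' X' -> pairing pull E E' = fun p => pairing g X X' (pi p).
Proof.
move=> vX vX' r r'; apply/funext => p; rewrite /pairing /pull.
by rewrite (pushforward_related p vX r) (pushforward_related p vX' r').
Qed.

Lemma pairing_pull_sym E E' : vfield E -> vfield E' -> pairing pull E E' = pairing pull E' E.
Proof.
move=> [tE _] [tE' _]; apply/funext => p.
exact: (form_sym (bg _) (tpi (tE p)) (tpi (tE' p))).
Qed.

Section At.
Variable p : M.
Variables (e : 'I_(mdim N) -> (N -> R) -> (N -> R)) (y : 'I_(mdim N) -> N -> R).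
Hypothesis ve : forall i, vfield (e i).
Hypothesis sy : forall i, smooth (y i).
Hypothesis ne : \forall q \near pi p, forall v, tangent q v ->
  v = fun f => \sum_i v (y i) * e i f q.
Let near_e : \forall q \near p, forall v, tangent (pi q) v ->
  v = fun f => \sum_i v (y i) * e i f (pi q).
Proof. exact: (cpi ne). Qed.

Lemma push_expand q Z : vfield Z -> (forall v, tangent (pi q) v ->
  v = fun f => \sum_i v (y i) * e i f (pi q)) ->
  pushforward pi (vat Z q) = fun f => \sum_i Z (fun p => y i (pi p)) q * vat (e i) (pi q) f.
Proof.
move=> [tZ _] H; rewrite (H _ (tpi (tZ q))); apply/funext => f.
by apply: eq_bigr => i _; rewrite [in LHS]/pushforward asboolT.
Qed.

(** The pushforward of an arbitrary [Z] is only a field along [pi]: a frame of [N] expands it with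
    coefficients on [M]. *)
Lemma pairing_pull_near E X Z : vfield X -> related E X -> vfield Z ->
  \forall q \near p, pairing pull E Z q =
    \sum_i Z (fun p => y i (pi p)) q * pairing g X (e i) (pi q).
Proof.
move=> vX rel vZ; apply: filterS near_e => q Hq.
rewrite /pairing /pull (pushforward_related q vX rel) (push_expand vZ Hq).
have [tX _] := vX.
by rewrite (form_sumr aN (bg _) _ _ (fun i _ => (ve i).1 (pi q)) (tX (pi q))).
Qed.

End At.

Lemma smooth_pairing_pull E X Z : vfield X -> related E X -> vfield Z ->
  smooth (pairing pull E Z).
Proof.
move=> vX rel vZ; apply: (smooth_local aM) => p.
have [e [y [ve sy ne]]] := local_frame aN (pi p).
exists (fun q => \sum_i Z (fun p => y i (pi p)) q * pairing g X (e i) (pi q)); split.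
  apply: (smooth_sum aM) => i _; apply: (smoothM aM).
    exact/vZ.2/spi/sy.
  exact/spi/(metric_smooth mg).
apply: (pairing_pull_near ve sy _ vX rel vZ).
by apply: filterS ne => q [].
Qed.

(** Only the first two arguments are related to fields on [N]. In the expansion of [Z] along a
    frame, the derivatives of its coefficients coming from the pairings cancel those coming from the
    brackets, which leaves the Koszul form of [N] on the frame fields. *)
Lemma koszul_pull E E' X X' Z p u : vfield E -> vfield E' -> vfield X -> vfield X' ->
  related E X -> related E' X' -> vfield Z ->
  represents g (pi p) u (nabla_flat g X X') ->
  koszul pull E E' Z p = g (pi p) u (pushforward pi (vat Z p)).
Proof.
move=> vE vE' vX vX' r r' vZ [tu ru].
have [e [y [ve sy ne0]]] := local_frame aN (pi p).
have ne : \forall q \near pi p, forall v, tangent q v ->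
  v = fun f => \sum_i v (y i) * e i f q by apply: filterS ne0 => q [].
have nE : \forall q \near p, forall v, tangent (pi q) v ->
  v = fun f => \sum_i v (y i) * e i f (pi q) by exact: (cpi ne).
have Hp := nbhs_singleton ne.
pose a i := Z (fun p => y i (pi p)).
have sa i : smooth (a i) by exact/vZ.2/spi/sy.
have te i q : tangent q (vat (e i) q) by have [+ _] := ve i; apply.
(* The pairing with [Z] is differentiated as a sum of coefficients [a i] times functions from
   [N]. *)
have deriv W A (vW : vfield W) (vA : vfield A) (rW : related W A) C K :
    vfield K -> related C K ->
    W (pairing pull C Z) p = \sum_i (a i p * A (pairing g K (e i)) (pi p) +
      pairing g K (e i) (pi p) * W (a i) p).
  move=> vK rK; have [tW _] := vW.
  have sP i : smooth (fun q => pairing g K (e i) (pi q)) by exact/spi/(metric_smooth mg).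
  rewrite -[LHS]/(vat W p (pairing pull C Z)).
  rewrite (tangent_near aM (tW p) _ _ (pairing_pull_near ve sy ne vK rK vZ)).
  - rewrite (tangent_sum aM _ (tW p)); last by move=> i _; apply: (smoothM aM); [exact: sa|exact: sP].
    apply: eq_bigr => i _; rewrite (tangentM aM (tW p) (sa i) (sP i)).
    by rewrite {1}/vat rW//; exact: (metric_smooth mg).
  - exact: smooth_pairing_pull rK vZ.
  - by apply: (smooth_sum aM) => i _; apply: (smoothM aM); [exact: sa|exact: sP].
(* The same expansion for the bracket with [Z], which is not related to any given field of [N]. *)
have br W A (vW : vfield W) (vA : vfield A) (rW : related W A) C K :
    vfield K -> related C K ->
    pairing pull C (bracket W Z) p = \sum_i (W (a i) p * pairing g K (e i) (pi p) +
      a i p * pairing g K (bracket A (e i)) (pi p)).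
  move=> vK rK; have [tW _] := vW; have [tK _] := vK.
  have tb i : tangent (pi p) (vat (bracket A (e i)) (pi p)).
    by have [+ _] := vfield_bracket aN vA (ve i); apply.
  have H : pushforward pi (vat (bracket W Z) p) = fun f =>
      \sum_i W (a i) p * vat (e i) (pi p) f +
      \sum_i a i p * vat (bracket A (e i)) (pi p) f.
    apply/funext => f; rewrite /pushforward; case: asboolP => sf; last first.
      rewrite !big1 ?addr0// => i _; first by rewrite (tangent_nonsmooth (tb i) sf) mulr0.
      by rewrite (tangent_nonsmooth (te i _) sf) mulr0.
    have sef i : smooth (fun q => e i f (pi q)) by exact/spi/(ve i).2.
    rewrite /vat /bracket rW//.
    have -> : W (Z (fun p => f (pi p))) p =
        \sum_i (a i p * A (e i f) (pi p) + e i f (pi p) * W (a i) p).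
      rewrite -[LHS]/(vat W p (Z (fun p => f (pi p)))).
      have nZ : \forall q \near p, Z (fun p => f (pi p)) q = \sum_i a i q * e i f (pi q).
        apply: filterS nE => q Hq.
        by have := congr1 (fun u => u f) (push_expand sy vZ Hq); rewrite /pushforward asboolT.
      rewrite (tangent_near aM (tW p) _ _ nZ).
      - rewrite (tangent_sum aM _ (tW p)); last by move=> i _; apply: (smoothM aM); [exact: sa|exact: sef].
        apply: eq_bigr => i _; rewrite (tangentM aM (tW p) (sa i) (sef i)).
        by rewrite {1}/vat rW//; exact: (ve i).2.
      - exact/vZ.2/spi.
      - by apply: (smooth_sum aM) => i _; apply: (smoothM aM); [exact: sa|exact: sef].
    have -> : Z (fun p => A f (pi p)) p = \sum_i a i p * e i (A f) (pi p).
      have sAf : smooth (A f) by exact: vA.2.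
      by have := congr1 (fun u => u (A f)) (push_expand sy vZ Hp); rewrite /pushforward asboolT.
    by rewrite -sumrB -big_split /=; apply: eq_bigr => i _; ring.
  rewrite /pairing /pull (pushforward_related p vK rK) H.
  rewrite (form_addr aN (bg _)).
  - rewrite (form_sumr aN (bg _) _ _ (fun i _ => te i (pi p)) (tK (pi p))).
    by rewrite (form_sumr aN (bg _) _ _ (fun i _ => tb i) (tK (pi p))) -big_split.
  - by apply: (tangent_bigsum aN) => i _; exact: te.
  - by apply: (tangent_bigsum aN) => i _; exact: tb.
  - exact: tK.
have rb : related (bracket E E') (bracket X X').
  move=> f sf; apply/funext => q.
  by rewrite /bracket (r' f sf) (r f sf) (r _ (vX'.2 f sf)) (r' _ (vX.2 f sf)).
have vb := vfield_bracket aN vX vX'.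
have bb : forall p, bilinear_at pull p.
  move=> q; split=> [v w tv tw|c v w z tv tw tz].
    exact: (form_sym (bg _) (tpi tv) (tpi tw)).
  rewrite /pull -(form_linl (bg _) c (tpi tv) (tpi tw) (tpi tz)); congr (g _ _ _).
  by apply/funext => f; rewrite /pushforward; case: asboolP => // _; rewrite mulr0 addr0.
have ZE : Z (pairing pull E E') p = \sum_i a i p * e i (pairing g X X') (pi p).
  rewrite (pairing_pull_related vX vX' r r').
  have sXX : smooth (pairing g X X') by exact: (metric_smooth mg).
  by have := congr1 (fun u => u (pairing g X X')) (push_expand sy vZ Hp);
    rewrite /pushforward asboolT.
have ZB : pairing pull Z (bracket E E') p = \sum_i a i p * pairing g (e i) (bracket X X') (pi p).
  rewrite /pairing /pull (pushforward_related p vb rb) (push_expand sy vZ Hp).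
  by rewrite (form_suml aN (bg _) _ _ (fun i _ => te i (pi p)) (vb.1 (pi p))).
rewrite (push_expand sy vZ Hp) (form_sumr aN (bg _) _ _ (fun i _ => te i (pi p)) tu).
rewrite /koszul (deriv E X vE vX r E' X' vX' r').
rewrite (pairing_pull_sym vZ vE) (deriv E' X' vE' vX' r' E X vX r) ZE ZB.
rewrite (br E' X' vE' vX' r' E X vX r).
rewrite (pairing_bracket_anti aM bb p vE' vZ vE) (br E X vE vX r E' X' vX' r').
rewrite -!sumrN -!big_split /= mulr_sumr; apply: eq_bigr => i _.
rewrite -(ru _ (ve i)) /nabla_flat /koszul.
rewrite (pairing_bracket_anti aN bg (pi p) vX' (ve i) vX) (pairing_sym bg (ve i) vX).
by rewrite /a; field.
Qed.

End Pullback.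

(** * Koszul form of a warped product *)

Section WarpedKoszul.
Context {R : realType} {l : nat} {B : charted R} {F : 'I_l -> charted R}.
Hypotheses (aB : smooth_atlas B) (aF : forall j, smooth_atlas (F j)).
Variables (gB : tensor02 B) (gF : forall j, tensor02 (F j)) (f : 'I_l -> B -> R).
Arguments gF : clear implicits.
Hypotheses (mB : singular_metric gB) (mF : forall j, singular_metric (gF j)).
Hypothesis sf : forall j, smooth (f j).
Local Notation M := (prod_manifold B F).
Local Notation g := (warped_metric gB gF f : tensor02 M).
Let aM : smooth_atlas M := prod_smooth_atlas aB aF.
Local Notation prF := (@prF R l B F).
Local Notation prB := (@prB R l B F).
Local Notation vB := ((B -> R) -> (B -> R)).
Local Notation vF := (forall j : 'I_l, (F j -> R) -> (F j -> R)).
Let bB (b : B) : bilinear_at gB b := metric_bilinear mB b.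
Let bF (j : 'I_l) (y : F j) : bilinear_at (gF j) y := metric_bilinear (mF j) y.
Arguments bF : clear implicits.

Let pB : tensor02 M := pull prB gB.
Let pF j : tensor02 M := pull (prF j) (gF j).
Let phi j (p : M) : R := f j (prB p) ^+ 2.

Let spB (h : B -> R) : smooth h -> smooth (fun p : M => h (prB p)).
Proof. exact: smooth_prB. Qed.
Let spF j (h : F j -> R) : smooth h -> smooth (fun p : M => h (prF j p)).
Proof. exact: (smooth_prF aB aF). Qed.
Let tpB (p : M) v : tangent p v -> tangent (prB p) (pushforward prB v).
Proof. exact: tangent_pushforwardB. Qed.
Let tpF j (p : M) v : tangent p v -> tangent (prF j p) (pushforward (prF j) v).
Proof. by move=> tv; exact: (tangent_pushforwardF aB aF tv j). Qed.
Let cpB : continuous prB. Proof. exact: prB_continuous. Qed.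
Let cpF j : continuous (prF j). Proof. exact: prF_continuous. Qed.

Lemma related_jfieldB (X : vB) (V : vF) : vfield X -> (forall j, vfield (V j)) ->
  related prB (jfield X V) X.
Proof. by move=> vX vV h sh; exact: jfield_prB. Qed.

Lemma related_jfieldF j (X : vB) (V : vF) : vfield X -> (forall j, vfield (V j)) ->
  related (prF j) (jfield X V) (V j).
Proof. by move=> vX vV h sh; exact: (jfield_prF aB aF). Qed.

Let smooth_phi j : smooth (phi j).
Proof. by apply: (smoothX aM); exact: spB. Qed.

Let smooth_pairB (X : vB) (V : vF) Z : vfield X -> (forall j, vfield (V j)) -> vfield Z ->
  smooth (pairing pB (jfield X V) Z).
Proof.
move=> vX vV vZ.
exact: (smooth_pairing_pull aM aB mB cpB spB tpB vX (related_jfieldB vX vV) vZ).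
Qed.

Let smooth_pairF j (X : vB) (V : vF) Z : vfield X -> (forall j, vfield (V j)) -> vfield Z ->
  smooth (pairing (pF j) (jfield X V) Z).
Proof.
move=> vX vV vZ.
exact: (smooth_pairing_pull aM (aF j) (mF j) (@cpF j) (@spF j) (@tpF j) (vV j)
  (@related_jfieldF j _ _ vX vV) vZ).
Qed.

Let pairing_warped (E Z : (M -> R) -> (M -> R)) :
  pairing g E Z = fun p => pairing pB E Z p + \sum_j phi j p * pairing (pF j) E Z p.
Proof. by []. Qed.

(** The pairing is a sum of pull-back pairings with weights [phi j]; besides the weighted Koszul
    forms, the product rule leaves the derivatives of the weights. Bracket terms are not
    differentiated and just add up. *)
Lemma koszul_warped_split (E E' Z : (M -> R) -> (M -> R)) p :
  vfield E -> vfield E' -> vfield Z ->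
  smooth (pairing pB E' Z) -> smooth (pairing pB Z E) -> smooth (pairing pB E E') ->
  (forall j, smooth (pairing (pF j) E' Z)) -> (forall j, smooth (pairing (pF j) Z E)) ->
  (forall j, smooth (pairing (pF j) E E')) ->
  koszul g E E' Z p = koszul pB E E' Z p + \sum_j (phi j p * koszul (pF j) E E' Z p +
    2^-1 * (E (phi j) p * pairing (pF j) E' Z p + E' (phi j) p * pairing (pF j) Z E p -
            Z (phi j) p * pairing (pF j) E E' p)).
Proof.
move=> vE vE' vZ s1 s2 s3 t1 t2 t3.
have deriv (W C C' : (M -> R) -> (M -> R)) : vfield W -> smooth (pairing pB C C') ->
    (forall j, smooth (pairing (pF j) C C')) ->
    W (pairing g C C') p = W (pairing pB C C') p +
      \sum_j (phi j p * W (pairing (pF j) C C') p + pairing (pF j) C C' p * W (phi j) p).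
  move=> [tW _] s t; rewrite pairing_warped.
  have sM j : smooth (fun p => phi j p * pairing (pF j) C C' p).
    exact: (smoothM aM (@smooth_phi j) (t j)).
  rewrite -[LHS]/(vat W p _) (tangentD aM (tW p) s); last by apply: (smooth_sum aM).
  rewrite (tangent_sum aM _ (tW p))//; congr (_ + _); apply: eq_bigr => j _.
  exact: (tangentM aM (tW p) (@smooth_phi j) (t j)).
rewrite /koszul (deriv E E' Z)// (deriv E' Z E)// (deriv Z E E')//.
rewrite !pairing_warped.
set a1 := E _ p; set a2 := E' _ p; set a3 := Z _ p.
set b1 := pairing pB _ _ p; set b2 := pairing pB _ _ p; set b3 := pairing pB _ _ p.
set S1 := \sum_j _; set S2 := \sum_j _; set S3 := \sum_j _.
set T1 := \sum_j _; set T2 := \sum_j _; set T3 := \sum_j _.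
transitivity (2^-1 * (a1 + a2 - a3 - b1 + b2 + b3) + 2^-1 * (S1 + S2 - S3 - T1 + T2 + T3)).
  by ring.
congr (_ + _); rewrite /S1 /S2 /S3 /T1 /T2 /T3 -!sumrN -!big_split /= mulr_sumr.
by apply: eq_bigr => j _; ring.
Qed.

Section TwoFields.
Variables (X X' : vB) (V V' : vF).
Arguments V : clear implicits.
Arguments V' : clear implicits.
Hypotheses (vX : vfield X) (vX' : vfield X') (vV : forall j, vfield (V j))
  (vV' : forall j, vfield (V' j)).
Local Notation E := (jfield X V).
Local Notation E' := (jfield X' V').

Lemma koszul_formula Z (p : M) uB (u : forall j, (F j -> R) -> R) : vfield Z ->
  represents gB p.1 uB (nabla_flat gB X X') ->
  (forall j, represents (gF j) (p.2 j) (u j) (nabla_flat (gF j) (V j) (V' j))) ->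
  koszul g E E' Z p = gB p.1 uB (pushforward prB (vat Z p)) +
    \sum_j (f j p.1 ^+ 2 * gF j (p.2 j) (u j) (pushforward (prF j) (vat Z p)) +
      f j p.1 * X (f j) p.1 * gF j (p.2 j) (vat (V' j) (p.2 j)) (pushforward (prF j) (vat Z p)) +
      f j p.1 * X' (f j) p.1 * gF j (p.2 j) (vat (V j) (p.2 j)) (pushforward (prF j) (vat Z p)) -
      f j p.1 * pushforward prB (vat Z p) (f j) * pairing (gF j) (V j) (V' j) (p.2 j)).
Proof.
move=> vZ ruB ru.
have vE := vfield_jfield aB aF vX vV; have vE' := vfield_jfield aB aF vX' vV'.
have rB := related_jfieldB vX vV; have rB' := related_jfieldB vX' vV'.
have rF j := @related_jfieldF j _ _ vX vV; have rF' j := @related_jfieldF j _ _ vX' vV'.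
rewrite koszul_warped_split//; first last.
- by move=> j; exact: smooth_pairF.
- move=> j; rewrite (pairing_pull_sym (mF j) (@tpF j) vZ vE); exact: smooth_pairF.
- by move=> j; exact: smooth_pairF.
- exact: smooth_pairB.
- rewrite (pairing_pull_sym mB tpB vZ vE); exact: smooth_pairB.
- exact: smooth_pairB.
rewrite (koszul_pull aM aB mB cpB spB tpB vE vE' vX vX' rB rB' vZ ruB).
congr (_ + _); apply: eq_bigr => j _.
rewrite (koszul_pull aM (aF j) (mF j) (@cpF j) (@spF j) (@tpF j) vE vE' (vV j) (vV' j)
  (rF j) (rF' j) vZ (ru j)).
(* The derivative of the square [phi j] carries a factor 2, which cancels the [2^-1] of the Koszul
   form. *)
have sq (A : vB) (C : (M -> R) -> (M -> R)) : vfield A -> related prB C A ->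
    C (phi j) p = 2 * (f j p.1 * A (f j) p.1).
  move=> [tA _] rA; rewrite /phi (rA (fun b => f j b ^+ 2)); last exact: (smoothX aB).
  have -> : (fun b => f j b ^+ 2) = (fun b => f j b * f j b) by apply/funext => b; rewrite expr2.
  have := tangentM aB (tA p.1) (sf j) (sf j); rewrite /vat => ->.
  by ring.
rewrite (sq X E vX rB) (sq X' E' vX' rB').
have -> : Z (phi j) p = 2 * (f j p.1 * pushforward prB (vat Z p) (f j)).
  have tZ : tangent p (vat Z p) by case: vZ => + _; apply.
  have -> : Z (phi j) p = pushforward prB (vat Z p) (fun b => f j b * f j b).
    rewrite /pushforward asboolT; last exact: (smoothM aB).
    by rewrite /vat; congr (Z _ p); apply/funext => q; rewrite /phi expr2.
  rewrite (tangentM aB (tpB tZ))//; ring.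
have -> : pairing (pF j) E' Z p = gF j (p.2 j) (vat (V' j) (p.2 j)) (pushforward (prF j) (vat Z p)).
  by rewrite /pairing /pF /pull (pushforward_related p (vV' j) (rF' j)).
have -> : pairing (pF j) Z E p = gF j (p.2 j) (vat (V j) (p.2 j)) (pushforward (prF j) (vat Z p)).
  rewrite (pairing_pull_sym (mF j) (@tpF j) vZ vE).
  by rewrite /pairing /pF /pull (pushforward_related p (vV j) (rF j)).
have -> : pairing (pF j) E E' p = pairing (gF j) (V j) (V' j) (p.2 j).
  by rewrite (pairing_pull_related (gF j) (vV j) (vV' j) (rF j) (rF' j)).
by rewrite /phi /Defs.prB /Defs.prF; field.
Qed.

Definition rep_coefB (p : M) j : R := - (f j p.1 * pairing (gF j) (V j) (V' j) (p.2 j)).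

Definition repB (p : M) uB (w : 'I_l -> (B -> R) -> R) : (B -> R) -> R :=
  fun h => uB h + \sum_j rep_coefB p j * w j h.

(* At a zero of [f j] both quotients are 0, as they must be: there the metric of
   the fibre is multiplied by [f j ^+ 2]. *)
Definition repF (p : M) (u : forall j, (F j -> R) -> R) j : (F j -> R) -> R :=
  fun h => u j h + (X (f j) p.1 / f j p.1 * vat (V' j) (p.2 j) h +
                    X' (f j) p.1 / f j p.1 * vat (V j) (p.2 j) h).

Lemma tangent_repB (p : M) uB (w : 'I_l -> (B -> R) -> R) : tangent p.1 uB -> (forall j, tangent p.1 (w j)) ->
  tangent p.1 (repB p uB w).
Proof.
by move=> tu tw; apply: (tangent_add aB) => //; apply: (tangent_bigsum aB).
Qed.

Lemma tangent_repF (p : M) (u : forall j, (F j -> R) -> R) j : (forall j, tangent (p.2 j) (u j)) ->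
  tangent (p.2 j) (@repF p u j).
Proof.
move=> tu; apply: (tangent_add (aF j)) => //; apply: (tangent_lin (aF j)).
  exact: (vV' j).1.
by apply: (tangent_scale (aF j)); exact: (vV j).1.
Qed.

Lemma represents_warped (p : M) uB (u : forall j, (F j -> R) -> R) (w : 'I_l -> (B -> R) -> R) :
  represents gB p.1 uB (nabla_flat gB X X') ->
  (forall j, represents (gF j) (p.2 j) (u j) (nabla_flat (gF j) (V j) (V' j))) ->
  (forall j, represents gB p.1 (w j) (differential (f j))) ->
  represents g p (joinv p (repB p uB w) (@repF p u)) (nabla_flat g E E').
Proof.
move=> ruB ru rw; have tuB := ruB.1; have tu j := (ru j).1; have tw j := (rw j).1.
have tRB := tangent_repB tuB tw; have tRF j := @tangent_repF p u j tu.
split; first exact: tangent_joinv.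
move=> Z vZ; have tZ : tangent p (vat Z p) by case: vZ => + _; apply.
have tZB := tpB tZ; have tZF j := @tpF j _ _ tZ.
rewrite /nabla_flat (koszul_formula vZ ruB ru).
rewrite [in RHS](joinv_pushforward aB aF tZ) (warped_joinv aB aF)//.
set ZB := pushforward prB _ in tZB *.
have tsum : tangent p.1 (fun h => \sum_j rep_coefB p j * w j h) by exact: (tangent_bigsum aB).
rewrite (form_addl (bB p.1) tuB tsum tZB).
rewrite (form_suml aB (bB p.1) _ _ (fun j _ => tw j) tZB) -addrA -big_split /=.
congr (_ + _); apply: eq_bigr => j _.
rewrite (represents_tangent aB (rw j) tZB).
set ZF := pushforward (prF j) _.
have tZFj : tangent (p.2 j) ZF by exact: tZF.
have tV' : tangent (p.2 j) (vat (V' j) (p.2 j)) by exact: (vV' j).1.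
have tV : tangent (p.2 j) (vat (V j) (p.2 j)) by exact: (vV j).1.
have tVs := tangent_scale (aF j) (X' (f j) p.1 / f j p.1) tV.
rewrite (form_addl (bF j _) (tu j) (tangent_lin (aF j) _ tV' tVs) tZFj).
rewrite (form_linl (bF j _) _ tV' tVs tZFj) (form_scalel (aF j) (bF j _) _ tV tZFj).
(* Every term in question has a factor [f j p.1], so at a zero both sides vanish; elsewhere the
   quotients simplify. *)
rewrite /rep_coefB; have [->|f0] := eqVneq (f j p.1) 0.
  by rewrite expr0n /= invr0 !(mul0r, mulr0, addr0, subr0, oppr0).
by field.
Qed.

End TwoFields.

End WarpedKoszul.

(** * Curvature of a warped product *)

Section ZeroField.
Context {R : realType} {M : charted R} (aM : smooth_atlas M) (g : tensor02 M).
Hypothesis mg : singular_metric g.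
Local Notation vf := ((M -> R) -> (M -> R)).
Let bg p := metric_bilinear mg p.

Lemma pairing0l (Y : vf) : vfield Y -> pairing g zero_field Y = fun=> 0.
Proof. by move=> [tY _]; apply/funext => p; exact: (form0l aM (bg p)). Qed.

Lemma pairing0r (X : vf) : vfield X -> pairing g X zero_field = fun=> 0.
Proof.
by move=> vX; rewrite (pairing_sym bg vX (vfield0 aM)) pairing0l.
Qed.

Lemma bracket0l (X : vf) : vfield X -> bracket zero_field X = zero_field.
Proof.
move=> vX; apply/funext => h; apply/funext => p; rewrite /bracket vfield_cst//.
by rewrite subrr.
Qed.

Lemma bracket0r (X : vf) : vfield X -> bracket X zero_field = zero_field.
Proof.
move=> vX; apply/funext => h; apply/funext => p; rewrite /bracket vfield_cst//.
by rewrite subrr.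
Qed.

Lemma koszul_eq0 (X Y Z : vf) : vfield X -> vfield Y -> vfield Z ->
  [\/ X = zero_field, Y = zero_field | Z = zero_field] -> koszul g X Y Z = fun=> 0.
Proof.
have v0 := vfield0 aM.
move=> vX vY vZ E; apply/funext => p; rewrite /koszul.
have vb (A C : vf) : vfield A -> vfield C -> vfield (bracket A C) by exact: (vfield_bracket aM).
have c0 (A : vf) : vfield A -> A (fun=> 0) = fun=> 0 by exact: vfield_cst.
have pl (A : vf) : vfield A -> pairing g zero_field A = fun=> 0 by exact: pairing0l.
have pr (A : vf) : vfield A -> pairing g A zero_field = fun=> 0 by exact: pairing0r.
case: E => E; rewrite E.
- rewrite (bracket0l vY) (bracket0r vZ) (pl _ vY) (pr _ vZ) (pl _ (vb _ _ vY vZ)) (pr _ vY).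
  by rewrite (c0 _ vY) (c0 _ vZ) !(subr0, addr0, mulr0).
- rewrite (bracket0l vZ) (bracket0r vX) (pl _ vZ) (pr _ vX) (pl _ (vb _ _ vZ vX)) (pr _ vZ).
  by rewrite (c0 _ vX) (c0 _ vZ) !(subr0, addr0, mulr0).
rewrite (bracket0l vX) (bracket0r vY) (pl _ vX) (pr _ vY) (pl _ (vb _ _ vX vY)) (pr _ vX).
by rewrite (c0 _ vX) (c0 _ vY) !(subr0, addr0, mulr0).
Qed.

(** If one of the forms has no representative, the value is the default 0; otherwise it is [w]
    evaluated on a field extending the representative of [t]. *)
Lemma bullet_eq0l w t p : (forall Y, vfield Y -> w Y p = 0) -> bullet g w t p = 0.
Proof.
move=> w0; rewrite /bullet; set S := [set r | _].
have [[r Sr]|nS] := pselect (exists r, S r); last first.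
  by rewrite xgetPN// => r Sr; apply: nS; exists r.
have : S (xget 0 S) by apply: xgetPex; exists r.
move=> [u [v [[tu ru] [tv _] ->]]]; have [Y [vY <-]] := tangent_extend aM tv.
by rewrite -ru// w0.
Qed.

Lemma bullet_eq0r w t p : (forall Y, vfield Y -> t Y p = 0) -> bullet g w t p = 0.
Proof.
move=> w0; rewrite /bullet; set S := [set r | _].
have [[r Sr]|nS] := pselect (exists r, S r); last first.
  by rewrite xgetPN// => r Sr; apply: nS; exists r.
have : S (xget 0 S) by apply: xgetPex; exists r.
move=> [u [v [[tu _] [tv rv] ->]]]; have [Y [vY <-]] := tangent_extend aM tu.
by rewrite (form_sym (bg p) (vY.1 p) tv) -rv// w0.
Qed.

Lemma lower_cov_eq0 (X Y Z T : vf) : vfield X -> vfield Y -> vfield Z -> vfield T ->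
  [\/ X = zero_field, Y = zero_field, Z = zero_field | T = zero_field] ->
  lower_cov g X (nabla_flat g Y Z) T = fun=> 0.
Proof.
move=> vX vY vZ vT E; apply: (lower_cov_eq aM).
- by move=> O p oO Op; exact: (regular_dense aM mg oO Op).
- exact: smooth_cst.
move=> p _; rewrite /lower_cov_raw /nabla_flat; have v0 := vfield0 aM; case: E => E.
- rewrite bullet_eq0l ?E ?subr0// => A vA.
  by rewrite (koszul_eq0 v0 vT vA)//; constructor 1.
- rewrite bullet_eq0r => [|A vA]; rewrite (koszul_eq0 vY vZ)//; try by constructor 1.
  by rewrite vfield_cst// subrr.
- rewrite bullet_eq0r => [|A vA]; rewrite (koszul_eq0 vY vZ)//; try by constructor 2.
  by rewrite vfield_cst// subrr.
- rewrite bullet_eq0l => [|A vA]; last by rewrite (koszul_eq0 vX vT vA)//; constructor 2.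
  by rewrite (koszul_eq0 vY vZ vT) ?vfield_cst ?subrr//; constructor 3.
Qed.

Lemma riemann_eq0 (X Y Z T : vf) p : vfield X -> vfield Y -> vfield Z -> vfield T ->
  [\/ X = zero_field, Y = zero_field, Z = zero_field | T = zero_field] ->
  riemann g X Y Z T p = 0.
Proof.
move=> vX vY vZ vT E; rewrite /riemann /nabla_flat.
have vb := vfield_bracket aM vX vY.
rewrite -/(nabla_flat g Y Z) -/(nabla_flat g X Z).
rewrite !lower_cov_eq0//; last by case: E => E; [constructor 2|constructor 1|constructor 3|constructor 4].
rewrite koszul_eq0 ?subrr//; case: E => E.
- by rewrite E bracket0l//; constructor 1.
- by rewrite E bracket0r//; constructor 1.
- by constructor 2.
- by constructor 3.
Qed.

Section Hessian.
Variable D : vf -> vf -> vf.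
Hypothesis LC : levi_civita g D.

(** The axioms of [levi_civita] speak of sums and multiples only, so the zero field is written as 0
    times a field. *)
Lemma hessian0l (h : M -> R) (T : vf) p : vfield T -> hessian D h zero_field T p = 0.
Proof.
move=> vT; have sc : smooth ((fun=> 0) : M -> R) by exact: smooth_cst.
have E : zero_field = vscale (fun=> 0) T.
  by apply/funext => k; apply/funext => q; rewrite /vscale mul0r.
by rewrite /hessian E (lc_scalel LC sc vT vT) /vscale mul0r subrr.
Qed.

Lemma hessian0r (h : M -> R) (X : vf) p : vfield X -> hessian D h X zero_field p = 0.
Proof.
move=> vX; have sc : smooth ((fun=> 0) : M -> R) by exact: smooth_cst.
have E : zero_field = vscale (fun=> 0) X.
  by apply/funext => k; apply/funext => q; rewrite /vscale mul0r.
rewrite /hessian vfield_cst// E (lc_leibniz LC sc vX vX) /vadd /vscale vfield_cst//.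
by rewrite !mul0r addr0 subrr.
Qed.

End Hessian.

End ZeroField.

(** * Covariant derivative and curvature on sums of lifted fields *)

Section WarpedCurvature.
Context {R : realType} {l : nat} {B : charted R} {F : 'I_l -> charted R}.
Hypotheses (aB : smooth_atlas B) (aF : forall j, smooth_atlas (F j)).
Variables (gB : tensor02 B) (gF : forall j, tensor02 (F j)) (f : 'I_l -> B -> R).
Arguments gF : clear implicits.
Variable D : ((B -> R) -> (B -> R)) -> ((B -> R) -> (B -> R)) -> ((B -> R) -> (B -> R)).
Hypotheses (mB : singular_metric gB) (mF : forall j, singular_metric (gF j)).
Hypotheses (nd : nondegenerate_metric gB) (LC : levi_civita gB D).
Hypothesis srF : forall j, semi_regular (gF j).
Hypothesis sf : forall j, smooth (f j).
Local Notation M := (prod_manifold B F).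
Local Notation g := (warped_metric gB gF f : tensor02 M).
Let aM : smooth_atlas M := prod_smooth_atlas aB aF.
Local Notation prF := (@prF R l B F).
Local Notation prB := (@prB R l B F).
Local Notation vB := ((B -> R) -> (B -> R)).
Local Notation vF := (forall j : 'I_l, (F j -> R) -> (F j -> R)).
Local Notation met j U W := (pairing (gF j) (U j) (W j)).
Local Notation kos j U W Z := (koszul (gF j) (U j) (W j) (Z j)).
Let bB (b : B) : bilinear_at gB b := metric_bilinear mB b.
Let bF (j : 'I_l) (y : F j) : bilinear_at (gF j) y := metric_bilinear (mF j) y.
Arguments bF : clear implicits.

Lemma represents_fibre (V V' : vF) (q : forall j, F j) :
  (forall j, vfield (V j)) -> (forall j, vfield (V' j)) ->
  exists u : forall j, (F j -> R) -> R,
    forall j, represents (gF j) (q j) (u j) (nabla_flat (gF j) (V j) (V' j)).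
Proof.
move=> vV vV'.
have H j : exists u, represents (gF j) (q j) u (nabla_flat (gF j) (V j) (V' j)).
  by have [_ +] := semi_regular_flat (srF j) (vV j) (vV' j); apply.
exact: (fin_all_exists H).
Qed.

Lemma represents_gradients (b : B) : exists w : 'I_l -> (B -> R) -> R,
  forall j, represents gB b (w j) (differential (f j)).
Proof. exact: (fin_all_exists (fun j => gradient_exists aB mB nd b (f j))). Qed.

Lemma koszul_jfield (X2 X3 X4 : vB) (V2 V3 V4 : vF) (p : M) :
  vfield X2 -> vfield X3 -> vfield X4 -> (forall j, vfield (V2 j)) ->
  (forall j, vfield (V3 j)) -> (forall j, vfield (V4 j)) ->
  koszul g (jfield X2 V2) (jfield X3 V3) (jfield X4 V4) p =
  koszul gB X2 X3 X4 p.1 + \sum_j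
    (f j p.1 ^+ 2 * kos j V2 V3 V4 (p.2 j) +
     f j p.1 * X2 (f j) p.1 * met j V3 V4 (p.2 j) +
     f j p.1 * X3 (f j) p.1 * met j V2 V4 (p.2 j) -
     f j p.1 * X4 (f j) p.1 * met j V2 V3 (p.2 j)).
Proof.
move=> vX2 vX3 vX4 vV2 vV3 vV4.
have [u ru] := represents_fibre p.2 vV2 vV3.
have ruB := represents_levi_civita aB mB LC p.1 vX2 vX3.
have vE4 := vfield_jfield aB aF vX4 vV4.
rewrite (koszul_formula aB aF mB mF sf vX2 vX3 vV2 vV3 vE4 ruB ru).
have pushB : pushforward prB (vat (jfield X4 V4) p) = vat X4 p.1.
  exact: (pushforward_joinvB aB aF (vX4.1 p.1) (fun j => (vV4 j).1 (p.2 j))).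
have pushF j : pushforward (prF j) (vat (jfield X4 V4) p) = vat (V4 j) (p.2 j).
  exact: (pushforward_joinvF aB aF j (vX4.1 p.1) (fun j => (vV4 j).1 (p.2 j))).
rewrite pushB -(ruB.2 _ vX4); congr (_ + _); apply: eq_bigr => j _.
by rewrite pushF -((ru j).2 _ (vV4 j)).
Qed.

Lemma jfield_product (X : vB) (V : vF) j (a : B -> R) (c : F j -> R) (p : M) :
  vfield X -> (forall j, vfield (V j)) -> smooth a -> smooth c ->
  jfield X V (fun p => a (prB p) * c (prF j p)) p =
  a p.1 * V j c (p.2 j) + c (p.2 j) * X a p.1.
Proof.
move=> vX vV sa sc; have tE := tangent_jfield aB aF p vX vV.
have := tangentM aM tE (smooth_prB aB aF sa) (smooth_prF aB aF sc).
by rewrite /vat (jfield_prB aB aF)// (jfield_prF aB aF).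
Qed.

Section CovariantDerivative.
Variables (X1 X2 X3 X4 : vB) (V1 V2 V3 V4 : vF).
Arguments V1 : clear implicits.
Arguments V2 : clear implicits.
Arguments V3 : clear implicits.
Arguments V4 : clear implicits.
Hypotheses (vX1 : vfield X1) (vX2 : vfield X2) (vX3 : vfield X3) (vX4 : vfield X4).
Hypotheses (vV1 : forall j, vfield (V1 j)) (vV2 : forall j, vfield (V2 j)).
Hypotheses (vV3 : forall j, vfield (V3 j)) (vV4 : forall j, vfield (V4 j)).

(* The contribution of the [j]-th fibre to [cov_warped], the everywhere smooth
   expression for the covariant derivative; it involves no division by [f j]. *)
Definition cov_fibre (j : 'I_l) (p : M) : R :=
  let b := p.1 in let y := p.2 j in let h := f j in
  h b ^+ 2 * lower_cov (gF j) (V1 j) (nabla_flat (gF j) (V2 j) (V3 j)) (V4 j) y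
  + (h b * X1 h b * kos j V2 V3 V4 y - h b * X2 h b * kos j V1 V4 V3 y
     - h b * X3 h b * kos j V1 V4 V2 y - h b * X4 h b * kos j V2 V3 V1 y)
  + (h b * X1 (X2 h) b * met j V3 V4 y + h b * X1 (X3 h) b * met j V2 V4 y
     - h b * X1 (X4 h) b * met j V2 V3 y)
  + (h b * X2 h b * V1 j (met j V3 V4) y + h b * X3 h b * V1 j (met j V2 V4) y
     - h b * X4 h b * V1 j (met j V2 V3) y)
  + (h b * D X1 X4 h b * met j V2 V3 y + h b * D X2 X3 h b * met j V1 V4 y)
  - (X1 h b * X4 h b * met j V2 V3 y + X4 h b * X2 h b * met j V1 V3 y
     + X4 h b * X3 h b * met j V1 V2 y).

(** The product of the two gradient sums in the base components of the representatives; it is the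
    only term that couples different fibres. *)
Definition cov_mixed (p : M) : R := \sum_j \sum_k
  f j p.1 * f k p.1 * bullet gB (differential (f j)) (differential (f k)) p.1 *
  (met j V1 V4 (p.2 j) * met k V2 V3 (p.2 k)).

Definition cov_warped (p : M) : R :=
  lower_cov gB X1 (nabla_flat gB X2 X3) X4 p.1 + \sum_j cov_fibre j p - cov_mixed p.

Lemma smooth_cov_warped : smooth cov_warped.
Proof.
have SB (a : B -> R) : smooth a -> smooth (fun p : M => a p.1) by exact: (smooth_prB aB aF).
have SF j (c : F j -> R) : smooth c -> smooth (fun p : M => c (p.2 j)) by exact: (smooth_prF aB aF).
have sX (X : vB) h : vfield X -> smooth h -> smooth (X h) by case=> _; apply.
have sV j (V : vF) h : vfield (V j) -> smooth h -> smooth (V j h) by case=> _; apply.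
have sP j (U W : vF) : (forall j, vfield (U j)) -> (forall j, vfield (W j)) ->
  smooth (met j U W) by move=> vU vW; exact: (metric_smooth (mF j)).
have sK j (U W Z : vF) : (forall j, vfield (U j)) -> (forall j, vfield (W j)) ->
    (forall j, vfield (Z j)) -> smooth (kos j U W Z).
  move=> vU vW vZ; have [[+ _ _] _] := semi_regular_flat (srF j) (vU j) (vW j).
  by apply.
have sD A A' h : vfield A -> vfield A' -> smooth h -> smooth (D A A' h).
  by move=> vA vA' sh; exact: (lc_vfield LC vA vA').2.
have m1 j (a a' : B -> R) (c : F j -> R) : smooth a -> smooth a' -> smooth c ->
    smooth (fun p : M => a p.1 * a' p.1 * c (p.2 j)).
  move=> sa sa' sc; apply: (smoothM aM); last exact: SF.
  by apply: (smoothM aM); exact: SB.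
have sfj j := sf j.
apply: (smoothB aM).
  apply: (smoothD aM).
    exact: (SB _ (lower_cov_levi_civita aB mB LC vX1 vX2 vX3 vX4).1).
  apply: (smooth_sum aM) => j _; rewrite /cov_fibre /=.
  apply: (smoothB aM); last by do ! apply: (smoothD aM); apply: m1; auto.
  apply: (smoothD aM); last by do ! apply: (smoothD aM); apply: m1; auto.
  apply: (smoothD aM); last first.
    by apply: (smoothB aM); [apply: (smoothD aM)|]; apply: m1; auto.
  apply: (smoothD aM); last first.
    by apply: (smoothB aM); [apply: (smoothD aM)|]; apply: m1; auto.
  apply: (smoothD aM).
    apply: (smoothM aM); first by apply: (smoothX aM); exact: SB.
    exact: (SF _ _ (lower_cov_semi_regular (srF j) (vV1 j) (vV2 j) (vV3 j) (vV4 j)).1).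
  apply: (smoothB aM); last by apply: m1; auto.
  apply: (smoothB aM); last by apply: m1; auto.
  by apply: (smoothB aM); apply: m1; auto.
apply: (smooth_sum aM) => j _; apply: (smooth_sum aM) => k _.
apply: (smoothM aM).
  apply: (smoothM aM); first by apply: (smoothM aM); exact: SB.
  by apply: SB; exact: smooth_bullet_differential.
by apply: (smoothM aM); apply: SF; auto.
Qed.

Local Notation E1 := (jfield X1 V1).
Local Notation E2 := (jfield X2 V2).
Local Notation E3 := (jfield X3 V3).
Local Notation E4 := (jfield X4 V4).

Lemma derive_koszul_jfield (p : M) : E1 (koszul g E2 E3 E4) p =
  X1 (koszul gB X2 X3 X4) p.1 + \sum_j
   (f j p.1 ^+ 2 * V1 j (kos j V2 V3 V4) (p.2 j) +
    kos j V2 V3 V4 (p.2 j) * (2 * f j p.1 * X1 (f j) p.1) +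
    (f j p.1 * X2 (f j) p.1 * V1 j (met j V3 V4) (p.2 j) +
     met j V3 V4 (p.2 j) *
       (f j p.1 * X1 (X2 (f j)) p.1 + X2 (f j) p.1 * X1 (f j) p.1)) +
    (f j p.1 * X3 (f j) p.1 * V1 j (met j V2 V4) (p.2 j) +
     met j V2 V4 (p.2 j) *
       (f j p.1 * X1 (X3 (f j)) p.1 + X3 (f j) p.1 * X1 (f j) p.1)) -
    (f j p.1 * X4 (f j) p.1 * V1 j (met j V2 V3) (p.2 j) +
     met j V2 V3 (p.2 j) *
       (f j p.1 * X1 (X4 (f j)) p.1 + X4 (f j) p.1 * X1 (f j) p.1))).
Proof.
have tE := tangent_jfield aB aF p vX1 vV1.
have sKB : smooth (koszul gB X2 X3 X4).
  have -> : koszul gB X2 X3 X4 = pairing gB (D X2 X3) X4.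
    by apply/funext => b; exact: (koszul_levi_civita aB mB LC).
  by apply: (metric_smooth mB) => //; exact: (lc_vfield LC).
have sKF j : smooth (kos j V2 V3 V4).
  by have [[+ _ _] _] := semi_regular_flat (srF j) (vV2 j) (vV3 j); apply.
have sX (X : vB) h : vfield X -> smooth h -> smooth (X h) by case=> _; apply.
have sP j (U W : vF) : (forall j, vfield (U j)) -> (forall j, vfield (W j)) ->
  smooth (met j U W) by move=> vU vW; exact: (metric_smooth (mF j)).
(* With these names each summand of the Koszul form is a function from [B] times a function from one
   fibre, the shape [jfield_product] differentiates. *)
pose a0 j b := f j b * f j b.
pose a (X : vB) j b := f j b * X (f j) b.
have sa0 j : smooth (a0 j) by exact: (smoothM aB).
have sa X j : vfield X -> smooth (a X j).
  by move=> vX; apply: (smoothM aB) => //; exact: sX.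
have spr j (c : B -> R) (d : F j -> R) : smooth c -> smooth d ->
    smooth (fun p : M => c (prB p) * d (prF j p)).
  by move=> sc sd; apply: (smoothM aM); [exact: smooth_prB|exact: (smooth_prF aB aF)].
have -> : koszul g E2 E3 E4 = fun p : M => koszul gB X2 X3 X4 (prB p) + \sum_j
   (a0 j (prB p) * kos j V2 V3 V4 (prF j p) +
    a X2 j (prB p) * met j V3 V4 (prF j p) +
    a X3 j (prB p) * met j V2 V4 (prF j p) -
    a X4 j (prB p) * met j V2 V3 (prF j p)).
  by apply/funext => q; rewrite koszul_jfield.
have s1 j := spr j _ _ (sa0 j) (sKF j).
have s2 j := spr j _ _ (sa X2 j vX2) (sP j V3 V4 vV3 vV4).
have s3 j := spr j _ _ (sa X3 j vX3) (sP j V2 V4 vV2 vV4).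
have s4 j := spr j _ _ (sa X4 j vX4) (sP j V2 V3 vV2 vV3).
have s12 j := smoothD aM (s1 j) (s2 j).
have s123 j := smoothD aM (s12 j) (s3 j).
have s1234 j := smoothB aM (s123 j) (s4 j).
rewrite -[LHS]/(vat E1 p _) (tangentD aM tE (smooth_prB aB aF sKB)); last exact: (smooth_sum aM).
rewrite {1}/vat (jfield_prB aB aF)//; congr (_ + _).
rewrite (tangent_sum aM _ tE)//; apply: eq_bigr => j _.
rewrite (tangentB aM tE (s123 j) (s4 j)) (tangentD aM tE (s12 j) (s3 j)).
rewrite (tangentD aM tE (s1 j) (s2 j)) /vat !jfield_product//; try exact: sP; try exact: sa.
have Xa (X : vB) : vfield X -> X1 (a X j) p.1 = f j p.1 * X1 (X (f j)) p.1 + X (f j) p.1 * X1 (f j) p.1.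
  by move=> vX; exact: (tangentM aB (vX1.1 p.1) (sf j) (sX _ _ vX (sf j))).
have Xa0 : X1 (a0 j) p.1 = 2 * f j p.1 * X1 (f j) p.1.
  have := tangentM aB (vX1.1 p.1) (sf j) (sf j); rewrite /vat => ->.
  by ring.
by rewrite !Xa// Xa0 /a0 /a; ring.
Qed.

(** The form [gF j] on the fibre components of the representatives of the two Koszul forms,
    multiplied out; terms with a quotient are 0 where [f j] vanishes. *)
Definition fibre_bullet j (p : M) : R :=
     bullet (gF j) (nabla_flat (gF j) (V1 j) (V4 j))
       (nabla_flat (gF j) (V2 j) (V3 j)) (p.2 j) +
     X2 (f j) p.1 / f j p.1 * kos j V1 V4 V3 (p.2 j) +
     X3 (f j) p.1 / f j p.1 * kos j V1 V4 V2 (p.2 j) +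
     X1 (f j) p.1 / f j p.1 * kos j V2 V3 V4 (p.2 j) +
     X4 (f j) p.1 / f j p.1 * kos j V2 V3 V1 (p.2 j) +
     X1 (f j) p.1 / f j p.1 * (X2 (f j) p.1 / f j p.1) * met j V3 V4 (p.2 j) +
     X1 (f j) p.1 / f j p.1 * (X3 (f j) p.1 / f j p.1) * met j V2 V4 (p.2 j) +
     X4 (f j) p.1 / f j p.1 * (X2 (f j) p.1 / f j p.1) * met j V1 V3 (p.2 j) +
     X4 (f j) p.1 / f j p.1 * (X3 (f j) p.1 / f j p.1) * met j V1 V2 (p.2 j).

(** On the base, pairing a gradient with a vector differentiates [f j], which gives the terms in
    [D X1 X4] and [D X2 X3]; two gradients give [cov_mixed]. *)
Lemma bullet_warped (p : M) :
  bullet g (nabla_flat g E1 E4) (nabla_flat g E2 E3) p =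
  bullet gB (nabla_flat gB X1 X4) (nabla_flat gB X2 X3) p.1 + cov_mixed p +
  \sum_j (- (f j p.1 * met j V2 V3 (p.2 j) * D X1 X4 (f j) p.1)
    - (f j p.1 * met j V1 V4 (p.2 j) * D X2 X3 (f j) p.1) +
   f j p.1 ^+ 2 * (fibre_bullet j p)).
Proof.
have [u14 r14] := represents_fibre p.2 vV1 vV4.
have [u23 r23] := represents_fibre p.2 vV2 vV3.
have [w rw] := represents_gradients p.1.
have b14 := represents_levi_civita aB mB LC p.1 vX1 vX4.
have b23 := represents_levi_civita aB mB LC p.1 vX2 vX3.
have R14 := represents_warped aB aF mB mF sf vX1 vX4 vV1 vV4 b14 r14 rw.
have R23 := represents_warped aB aF mB mF sf vX2 vX3 vV2 vV3 b23 r23 rw.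
rewrite (bullet_eq aM (warped_bilinear aB aF f mB mF) R14 R23).
have t14 := b14.1; have t23 := b23.1; have tw j := (rw j).1.
have tu14 j := (r14 j).1; have tu23 j := (r23 j).1.
have tV (V : vF) : (forall j, vfield (V j)) -> forall j, tangent (p.2 j) (vat (V j) (p.2 j)).
  by move=> vV j; exact: (vV j).1.
have tV1 := tV _ vV1; have tV2 := tV _ vV2; have tV3 := tV _ vV3; have tV4 := tV _ vV4.
rewrite (warped_joinv aB aF)//; first last.
- by move=> j; exact: tangent_repF.
- exact: tangent_repB.
- by move=> j; exact: tangent_repF.
- exact: tangent_repB.
set c14 := rep_coefB gF f V1 V4 p; set c23 := rep_coefB gF f V2 V3 p.
have s14 : tangent p.1 (fun h => \sum_j c14 j * w j h) by exact: (tangent_bigsum aB).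
have s23 : tangent p.1 (fun h => \sum_j c23 j * w j h) by exact: (tangent_bigsum aB).
have gBE : gB p.1 (repB gF f V1 V4 p (vat (D X1 X4) p.1) w)
                  (repB gF f V2 V3 p (vat (D X2 X3) p.1) w) =
    bullet gB (nabla_flat gB X1 X4) (nabla_flat gB X2 X3) p.1 +
    \sum_j c23 j * D X1 X4 (f j) p.1 + \sum_j c14 j * D X2 X3 (f j) p.1 +
    \sum_j \sum_k c14 j * c23 k * bullet gB (differential (f j)) (differential (f k)) p.1.
  rewrite (bullet_eq aB bB b14 b23) /repB.
  rewrite (form_addl (bB p.1) t14 s14 (tangent_add aB t23 s23)).
  rewrite (form_addr aB (bB p.1) t23 s23 t14) (form_addr aB (bB p.1) t23 s23 s14).
  rewrite (form_sumr aB (bB p.1) _ _ (fun j _ => tw j) t14).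
  rewrite (form_suml aB (bB p.1) _ _ (fun j _ => tw j) t23).
  rewrite (form_suml aB (bB p.1) _ _ (fun j _ => tw j) s23) !addrA.
  congr (_ + _ + _ + _).
  - apply: eq_bigr => j _; rewrite (form_sym (bB p.1) t14 (tw j)).
    by rewrite (represents_tangent aB (rw j) t14).
  - by apply: eq_bigr => j _; rewrite (represents_tangent aB (rw j) t23).
  - apply: eq_bigr => j _; rewrite (form_sumr aB (bB p.1) _ _ (fun j _ => tw j) (tw j)).
    rewrite mulr_sumr; apply: eq_bigr => k _.
    by rewrite (bullet_eq aB bB (rw j) (rw k)) mulrA.
rewrite gBE.
have gFE j : gF j (p.2 j) (@repF R l B F f X1 X4 V1 V4 p u14 j) (@repF R l B F f X2 X3 V2 V3 p u23 j) =
    fibre_bullet j p.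
  have bq := bF j (p.2 j); have aj := aF j.
  rewrite /fibre_bullet (bullet_eq aj (bF j) (r14 j) (r23 j)) /repF.
  set x1 := X1 (f j) p.1 / f j p.1; set x2 := X2 (f j) p.1 / f j p.1.
  set x3 := X3 (f j) p.1 / f j p.1; set x4 := X4 (f j) p.1 / f j p.1.
  have T (A : (F j -> R) -> R) : tangent (p.2 j) A ->
      gF j (p.2 j) A (fun h => u23 j h + (x2 * vat (V3 j) (p.2 j) h + x3 * vat (V2 j) (p.2 j) h)) =
      gF j (p.2 j) A (u23 j) + (x2 * gF j (p.2 j) A (vat (V3 j) (p.2 j)) +
        x3 * gF j (p.2 j) A (vat (V2 j) (p.2 j))).
    move=> tA; have ts := tangent_scale aj x3 (tV2 j); have ts' := tangent_scale aj x2 (tV3 j).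
    rewrite (form_addr aj bq (tu23 j) (tangent_add aj ts' ts) tA).
    by rewrite (form_addr aj bq ts' ts tA) (form_scaler aj bq _ (tV3 j) tA)
      (form_scaler aj bq _ (tV2 j) tA).
  have tsA := tangent_scale aj x4 (tV1 j).
  have tlA := tangent_lin aj x1 (tV4 j) tsA.
  have tR : tangent (p.2 j) (fun h => u23 j h + (x2 * vat (V3 j) (p.2 j) h + x3 * vat (V2 j) (p.2 j) h)).
    apply: (tangent_add aj (tu23 j)); apply: (tangent_lin aj _ (tV3 j)).
    exact: (tangent_scale aj).
  rewrite (form_addl bq (tu14 j) tlA tR) (form_linl bq _ (tV4 j) tsA tR).
  rewrite (form_scalel aj bq _ (tV1 j) tR) (T _ (tu14 j)) (T _ (tV4 j)) (T _ (tV1 j)).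
  rewrite -((r14 j).2 _ (vV3 j)) -((r14 j).2 _ (vV2 j)).
  rewrite (form_sym bq (tV4 j) (tu23 j)) (form_sym bq (tV1 j) (tu23 j)).
  rewrite -((r23 j).2 _ (vV4 j)) -((r23 j).2 _ (vV1 j)).
  rewrite (form_sym bq (tV4 j) (tV3 j)) (form_sym bq (tV4 j) (tV2 j)).
  by rewrite /nabla_flat /pairing; ring.
have cE : cov_mixed p = \sum_j \sum_k c14 j * c23 k *
    bullet gB (differential (f j)) (differential (f k)) p.1.
  apply: eq_bigr => j _; apply: eq_bigr => k _; rewrite /c14 /c23 /rep_coefB.
  by ring.
rewrite -cE (eq_bigr _ (fun j _ => congr1 (fun t => f j p.1 ^+ 2 * t) (gFE j))).
set B0 := bullet gB _ _ _; set S1 := \sum_j _; set S2 := \sum_j _; set S3 := \sum_j _.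
transitivity (B0 + cov_mixed p + (S1 + S2 + S3)); first by ring.
congr (_ + _); rewrite /S1 /S2 /S3 -!big_split /=; apply: eq_bigr => j _.
by rewrite /c14 /c23 /rep_coefB !mulNr.
Qed.

Lemma lower_cov_warped :
  lower_cov g (jfield X1 V1) (nabla_flat g (jfield X2 V2) (jfield X3 V3)) (jfield X4 V4) =
  cov_warped.
Proof.
apply: (lower_cov_eq aM).
- by move=> O p oO Op; exact: (warped_regular_dense aB aF mB mF sf oO Op).
- exact: smooth_cov_warped.
move=> p /(warped_regular aB aF mB mF sf)[rB rF zF].
rewrite /lower_cov_raw -[nabla_flat g _ _ _]/(koszul g _ _ _).
rewrite derive_koszul_jfield bullet_warped.
rewrite /cov_warped (lower_cov_levi_civita aB mB LC vX1 vX2 vX3 vX4).2// /lower_cov_raw.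
rewrite -[nabla_flat gB X2 X3 X4]/(koszul gB X2 X3 X4).
set a := X1 _ _; set b := bullet _ _ _ _; set c := cov_mixed _.
set S := \sum_j _; set S1 := \sum_j _; set S2 := \sum_j _.
suff -> : S = S1 - S2 by ring.
rewrite /S /S1 /S2 -sumrB; apply: eq_bigr => j _; rewrite /cov_fibre /fibre_bullet /=.
(* Where [f j] is nonzero the fibre point is regular, so the covariant derivative on the fibre is
   its raw form and the rest is algebra. At a zero that derivative is multiplied by 0. *)
have [f0|f0] := eqVneq (f j p.1) 0; last first.
  rewrite (lower_cov_semi_regular (srF j) (vV1 j) (vV2 j) (vV3 j) (vV4 j)).2; last exact: rF.
  rewrite /lower_cov_raw -[nabla_flat (gF j) (V2 j) (V3 j) (V4 j)]/(koszul _ _ _ _).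
  by field.
(* At a zero of [f j] only products of two derivatives of [f j] with the fibre metric survive, and
   regularity of the point makes each of them 0. *)
have Z (X X' : vB) (U W : vF) : vfield X -> (forall j, vfield (U j)) ->
    (forall j, vfield (W j)) ->
    X (f j) p.1 * X' (f j) p.1 * met j U W (p.2 j) = 0.
  move=> vX vU vW; have [->|Xf] := eqVneq (X (f j) p.1) 0; first by rewrite !mul0r.
  rewrite /pairing (zF j (vat X p.1) f0 (vX.1 _) Xf) ?mulr0//; first exact: (vU j).1.
  exact: (vW j).1.
rewrite f0 invr0 !expr0n /= !(mul0r, mulr0, addr0, add0r, subr0, sub0r, oppr0).
rewrite !Z// !addr0 oppr0.
have Z' X X' (U W : vF) : vfield X -> (forall j, vfield (U j)) ->
    (forall j, vfield (W j)) ->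
    met j U W (p.2 j) * (X (f j) p.1 * X' (f j) p.1) = 0.
  by move=> *; rewrite mulrC Z.
by rewrite !Z'// addr0 subr0.
Qed.

End CovariantDerivative.

Section Curvature.
Variables (X1 X2 X3 X4 : vB) (V1 V2 V3 V4 : vF).
Arguments V1 : clear implicits.
Arguments V2 : clear implicits.
Arguments V3 : clear implicits.
Arguments V4 : clear implicits.
Hypotheses (vX1 : vfield X1) (vX2 : vfield X2) (vX3 : vfield X3) (vX4 : vfield X4).
Hypotheses (vV1 : forall j, vfield (V1 j)) (vV2 : forall j, vfield (V2 j)).
Hypotheses (vV3 : forall j, vfield (V3 j)) (vV4 : forall j, vfield (V4 j)).

(** Derivatives of the fibre metric and pairings with brackets are turned into fibre Koszul forms by
    compatibility and torsion. These then cancel, as do the products of two derivatives of [f j];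
    the second derivatives combine with [D] into Hessians. *)
Lemma fibre_curvature j (p : M) :
  cov_fibre X1 X2 X3 X4 V1 V2 V3 V4 j p - cov_fibre X2 X1 X3 X4 V2 V1 V3 V4 j p
  - (f j p.1 ^+ 2 * koszul (gF j) (bracket (V1 j) (V2 j)) (V3 j) (V4 j) (p.2 j) +
     f j p.1 * bracket X1 X2 (f j) p.1 * met j V3 V4 (p.2 j) +
     f j p.1 * X3 (f j) p.1 * pairing (gF j) (bracket (V1 j) (V2 j)) (V4 j) (p.2 j) -
     f j p.1 * X4 (f j) p.1 * pairing (gF j) (bracket (V1 j) (V2 j)) (V3 j) (p.2 j)) =
  f j p.1 ^+ 2 * riemann (gF j) (V1 j) (V2 j) (V3 j) (V4 j) (p.2 j) -
  f j p.1 * (hessian D (f j) X1 X4 p.1 * met j V2 V3 (p.2 j) -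
             hessian D (f j) X2 X4 p.1 * met j V1 V3 (p.2 j) -
             hessian D (f j) X1 X3 p.1 * met j V2 V4 (p.2 j) +
             hessian D (f j) X2 X3 p.1 * met j V1 V4 (p.2 j)).
Proof.
have metric (A C E : (F j -> R) -> (F j -> R)) : vfield A -> vfield C -> vfield E ->
    A (pairing (gF j) C E) (p.2 j) = koszul (gF j) A C E (p.2 j) + koszul (gF j) A E C (p.2 j).
  by move=> vA vC vE; exact: (koszul_metric (aF j) (bF j)).
have torsion (E : (F j -> R) -> (F j -> R)) : vfield E ->
    pairing (gF j) (bracket (V1 j) (V2 j)) E (p.2 j) =
    koszul (gF j) (V1 j) (V2 j) E (p.2 j) - koszul (gF j) (V2 j) (V1 j) E (p.2 j).
  by move=> vE; rewrite (koszul_torsion (aF j) (bF j)).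
rewrite /cov_fibre /= !metric// !torsion// /riemann /hessian /bracket /nabla_flat.
rewrite (pairing_sym (bF j) (vV2 j) (vV1 j)).
by ring.
Qed.

Lemma riemann_jfield (p : M) :
  riemann g (jfield X1 V1) (jfield X2 V2) (jfield X3 V3) (jfield X4 V4) p =
  riemann gB X1 X2 X3 X4 p.1 +
  \sum_j (f j p.1 ^+ 2 * riemann (gF j) (V1 j) (V2 j) (V3 j) (V4 j) (p.2 j) -
    f j p.1 * (hessian D (f j) X1 X4 p.1 * met j V2 V3 (p.2 j) -
               hessian D (f j) X2 X4 p.1 * met j V1 V3 (p.2 j) -
               hessian D (f j) X1 X3 p.1 * met j V2 V4 (p.2 j) +
               hessian D (f j) X2 X3 p.1 * met j V1 V4 (p.2 j))) +
  \sum_j \sum_k f j p.1 * f k p.1 *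
    bullet gB (differential (f j)) (differential (f k)) p.1 *
    (met j V1 V3 (p.2 j) * met k V2 V4 (p.2 k) -
     met j V1 V4 (p.2 j) * met k V2 V3 (p.2 k)).
Proof.
rewrite {1}/riemann (lower_cov_warped vX1 vX2 vX3 vX4 vV1 vV2 vV3 vV4).
rewrite (lower_cov_warped vX2 vX1 vX3 vX4 vV2 vV1 vV3 vV4).
rewrite (bracket_jfield aB aF)// -[nabla_flat g _ _ _]/(koszul g _ _ _).
have vb := vfield_bracket aB vX1 vX2.
have vbF j := vfield_bracket (aF j) (vV1 j) (vV2 j).
rewrite koszul_jfield// /cov_warped {1}/riemann.
under [X in _ = _ + X + _]eq_bigr do rewrite -fibre_curvature.
(* Needed to match one mixed sum with the other: the roles of the two fibre indices are exchanged
   between them. *)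
have sym j k : bullet gB (differential (f j)) (differential (f k)) p.1 =
    bullet gB (differential (f k)) (differential (f j)) p.1.
  have [w rw] := represents_gradients p.1.
  rewrite (bullet_eq aB bB (rw j) (rw k)) (bullet_eq aB bB (rw k) (rw j)).
  exact: (form_sym (bB p.1) (rw j).1 (rw k).1).
have -> : \sum_j \sum_k f j p.1 * f k p.1 *
    bullet gB (differential (f j)) (differential (f k)) p.1 *
    (met j V1 V3 (p.2 j) * met k V2 V4 (p.2 k) -
     met j V1 V4 (p.2 j) * met k V2 V3 (p.2 k)) =
   cov_mixed V2 V1 V3 V4 p - cov_mixed V1 V2 V3 V4 p.
  rewrite {1}/cov_mixed [in X in _ = X - _]exchange_big /cov_mixed -sumrB; apply: eq_bigr => j _.
  rewrite -sumrB; apply: eq_bigr => k _; rewrite (sym k j).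
  by ring.
rewrite !sumrB /nabla_flat.
by ring.
Qed.

End Curvature.

(** Keeping the whole family [A] and testing [k == i] spares transporting a field on [F i] to [F k]
    along an equality of indices. *)
Definition concentrated (i : 'I_l) (A : vF) : vF :=
  fun k => if k == i then A k else zero_field.
Arguments concentrated : clear implicits.

Lemma liftF_concentrated i (A : vF) : liftF (A i) =
  jfield zero_field (concentrated i A) :> ((M -> R) -> (M -> R)).
Proof.
rewrite liftF_jfield; congr jfield; apply: functional_extensionality_dep => k.
rewrite /concentrated; have [->|ki] := eqVneq k i; first by rewrite dfwithin.
by rewrite dfwithout// eq_sym.
Qed.

Lemma vfield_concentrated i (A : vF) : (forall j, vfield (A j)) ->
  forall k, vfield (concentrated i A k).
Proof.
by move=> vA k; rewrite /concentrated; case: ifP => // _; exact: (vfield0 (aF k)).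
Qed.

Lemma pairing_concentrated i j (A C : vF) k y :
  (forall j, vfield (A j)) -> (forall j, vfield (C j)) ->
  pairing (gF k) (concentrated i A k) (concentrated j C k) y =
  if (k == i) && (k == j) then met k A C y else 0.
Proof.
move=> vA vC; rewrite /concentrated; case: eqP => _ /=; last first.
  by case: ifP => _; rewrite (pairing0l (aF k) (mF k))//; exact: (vfield0 (aF k)).
by case: eqP => _ //; rewrite (pairing0r (aF k) (mF k)).
Qed.

(** * Curvature with arguments from prescribed factors *)

Section Cases.
Variables (X1 X2 X3 X4 : vB) (V1 V2 V3 V4 : vF).
Arguments V1 : clear implicits.
Arguments V2 : clear implicits.
Arguments V3 : clear implicits.
Arguments V4 : clear implicits.
Hypotheses (vX1 : vfield X1) (vX2 : vfield X2) (vX3 : vfield X3) (vX4 : vfield X4).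
Hypotheses (vV1 : forall j, vfield (V1 j)) (vV2 : forall j, vfield (V2 j)).
Hypotheses (vV3 : forall j, vfield (V3 j)) (vV4 : forall j, vfield (V4 j)).
Let v0B : vfield (zero_field : vB) := vfield0 aB.
Let v0F j : vfield (zero_field : (F j -> R) -> (F j -> R)) := vfield0 (aF j).
Local Notation z := (fun=> zero_field).
Let P0l j (W : vF) y : (forall j, vfield (W j)) -> pairing (gF j) zero_field (W j) y = 0.
Proof. by move=> vW; rewrite (pairing0l (aF j) (mF j)). Qed.
Let P0r j (W : vF) y : (forall j, vfield (W j)) -> pairing (gF j) (W j) zero_field y = 0.
Proof. by move=> vW; rewrite (pairing0r (aF j) (mF j)). Qed.
Let simp0 := (mulr0, mul0r, addr0, add0r, subr0, sub0r, oppr0).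

(** Every fibre term contains [V1] or [V2]. The last two arguments keep arbitrary fibre components,
    so the mixed cases with two base fields in front are covered too. *)
Lemma riemann_base (p : M) :
  riemann g (jfield X1 z) (jfield X2 z) (jfield X3 V3) (jfield X4 V4) p =
  riemann gB X1 X2 X3 X4 p.1.
Proof.
rewrite riemann_jfield//.
rewrite [X in _ + X + _]big1 ?addr0 => [|j _]; last first.
  rewrite (riemann_eq0 (aF j) (mF j))//; last by constructor 1.
  by rewrite !P0l// !simp0.
by rewrite big1 ?addr0// => j _; rewrite big1// => k _; rewrite !P0l// !simp0.
Qed.

(** Besides all terms pairing [V1], the Hessians in [X2] disappear, so only the Hessians of [X1]
    with the base parts of the last two arguments remain. *)
Lemma riemann_mixed (p : M) :
  riemann g (jfield X1 z) (jfield zero_field V2) (jfield X3 V3) (jfield X4 V4) p =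
  \sum_j f j p.1 * (hessian D (f j) X1 X3 p.1 * met j V2 V4 (p.2 j) -
                    hessian D (f j) X1 X4 p.1 * met j V2 V3 (p.2 j)).
Proof.
rewrite riemann_jfield//.
rewrite (riemann_eq0 aB mB)//; last by constructor 2.
rewrite add0r [X in _ + X]big1 ?addr0 => [|j _]; last first.
  by rewrite big1// => k _; rewrite !P0l// !simp0.
apply: eq_bigr => j _; rewrite (riemann_eq0 (aF j) (mF j))//; last by constructor 1.
by rewrite !P0l// !(hessian0l LC)//; ring.
Qed.

Lemma riemann_fibre_base (p : M) :
  riemann g (jfield zero_field V1) (jfield zero_field V2) (jfield X3 z) (jfield zero_field V4) p = 0.
Proof.
rewrite riemann_jfield//.
rewrite (riemann_eq0 aB mB)//; last by constructor 1.
rewrite !big1 ?addr0// => [j _|j _].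
  by rewrite big1// => k _; rewrite !P0r// !simp0.
rewrite (riemann_eq0 (aF j) (mF j))//; last by constructor 3.
by rewrite !P0r// !(hessian0l LC)// !simp0.
Qed.

End Cases.

(** With no base components the Hessians vanish and each sum reduces to at most one term. Leaving
    the four indices free turns all purely fibral cases into comparisons of indices. *)
Lemma riemann_fibres (U V W Q : vF) i j k m (p : M) :
  (forall j, vfield (U j)) -> (forall j, vfield (V j)) ->
  (forall j, vfield (W j)) -> (forall j, vfield (Q j)) ->
  riemann g (jfield zero_field (concentrated i U)) (jfield zero_field (concentrated j V))
    (jfield zero_field (concentrated k W)) (jfield zero_field (concentrated m Q)) p =
  (if [&& i == j, i == k & i == m]
   then f i p.1 ^+ 2 * riemann (gF i) (U i) (V i) (W i) (Q i) (p.2 i) else 0) +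
  f i p.1 * f j p.1 * bullet gB (differential (f i)) (differential (f j)) p.1 *
  ((if (i == k) && (j == m) then met i U W (p.2 i) *
      met j V Q (p.2 j) else 0) -
   (if (i == m) && (j == k) then met i U Q (p.2 i) *
      met j V W (p.2 j) else 0)).
Proof.
move=> vU vV vW vQ.
have v0B : vfield (zero_field : vB) := vfield0 aB.
have cU := vfield_concentrated i vU; have cV := vfield_concentrated j vV.
have cW := vfield_concentrated k vW; have cQ := vfield_concentrated m vQ.
rewrite riemann_jfield//.
rewrite (riemann_eq0 aB mB)//; last by constructor 1.
rewrite add0r; congr (_ + _).
  rewrite (bigD1 i)//= big1 ?addr0 => [|a ai]; last first.
    rewrite !(hessian0l LC)// (riemann_eq0 (aF a) (mF a))//; first by ring.
    by constructor 1; rewrite /concentrated (negbTE ai).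
  rewrite !(hessian0l LC)// !mul0r !subr0 addr0 mulr0 subr0.
  case: ifP => [/and3P[/eqP<- /eqP<- /eqP<-]|E].
    by rewrite /concentrated eqxx.
  rewrite (riemann_eq0 (aF i) (mF i)) ?mulr0//.
  have [ij|ij] := eqVneq i j; last by constructor 2; rewrite /concentrated (negbTE ij).
  have [ik|ik] := eqVneq i k; last by constructor 3; rewrite /concentrated (negbTE ik).
  have [im|im] := eqVneq i m; last by constructor 4; rewrite /concentrated (negbTE im).
  by move: E; rewrite -ij -ik -im !eqxx.
rewrite (bigD1 i)//= [X in _ + X]big1 ?addr0 => [|a ai]; last first.
  rewrite big1// => b _; rewrite !pairing_concentrated// (negbTE ai) /=.
  by rewrite !mul0r subrr mulr0.
rewrite (bigD1 j)//= big1 ?addr0 => [|b bj]; last first.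
  rewrite !pairing_concentrated// (negbTE bj) /=.
  by rewrite !mulr0 subrr mulr0.
rewrite !pairing_concentrated// !eqxx /=.
by do 2 (case: eqP => _; rewrite /= ?mul0r); do ?(case: eqP => _; rewrite /= ?mul0r ?mulr0).
Qed.

End WarpedCurvature.

Theorem theorem5p5 (R : realType) (l : nat)
  (B : charted R) (F : 'I_l -> charted R)
  (gB : tensor02 B) (gF : forall j : 'I_l, tensor02 (F j))
  (f : 'I_l -> B -> R)
  (nablaB : ((B -> R) -> (B -> R)) -> ((B -> R) -> (B -> R)) ->
            ((B -> R) -> (B -> R)))
  (manB : is_manifold B) (manF : forall j, is_manifold (F j))
  (metB : singular_metric gB) (ndgB : nondegenerate_metric gB)
  (LCB : levi_civita gB nablaB)
  (metF : forall j, singular_metric (gF j))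
  (srF : forall j, semi_regular (gF j))
  (smf : forall j, smooth (f j))
  (X Y Z T : (B -> R) -> (B -> R))
  (U V W Q : forall j : 'I_l, (F j -> R) -> (F j -> R))
  (vfX : vfield X) (vfY : vfield Y) (vfZ : vfield Z) (vfT : vfield T)
  (vfU : forall j, vfield (U j)) (vfV : forall j, vfield (V j))
  (vfW : forall j, vfield (W j)) (vfQ : forall j, vfield (Q j)) :
  let M := prod_manifold B F in
  let Rm := riemann (warped_metric gB gF f) in
  let b (A : (B -> R) -> (B -> R)) : (M -> R) -> (M -> R) := liftB A in
  let v (A : forall j, (F j -> R) -> (F j -> R)) (j : 'I_l) :
    (M -> R) -> (M -> R) := liftF (A j) in
  (* (1) *)
  (forall p : M, Rm (b X) (b Y) (b Z) (b T) p = riemann gB X Y Z T (prB p)) /\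
  (* (2) *)
  (forall j (p : M), Rm (b X) (b Y) (b Z) (v Q j) p = 0 /\
                     Rm (b X) (b Y) (v W j) (v Q j) p = 0) /\
  (* (3) *)
  (forall j (p : M), Rm (b X) (v V j) (v W j) (b T) p =
     - f j (prB p) * hessian nablaB (f j) X T (prB p) *
       pairing (gF j) (V j) (W j) (prF j p)) /\
  (* (4) *)
  (forall j k (p : M), j != k ->
     [/\ Rm (b X) (b Y) (v W j) (v Q k) p = 0,
         Rm (b X) (v V j) (v W k) (b T) p = 0,
         Rm (b X) (v V j) (v W k) (v Q j) p = 0 &
         Rm (b X) (v W k) (v V j) (v Q j) p = 0]) /\
  (* (5) *)
  (forall j (p : M), Rm (v U j) (v V j) (b Z) (v Q j) p = 0) /\
  (* (6) *)
  (forall k j a (p : M), k != j -> k != a -> j != a ->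
     Rm (b X) (v W k) (v V j) (v Q a) p = 0) /\
  (* (7) *)
  (forall j (p : M), Rm (v U j) (v V j) (v W j) (v Q j) p =
     f j (prB p) ^+ 2 * riemann (gF j) (U j) (V j) (W j) (Q j) (prF j p) +
     f j (prB p) ^+ 2 *
       bullet gB (differential (f j)) (differential (f j)) (prB p) *
       (pairing (gF j) (U j) (W j) (prF j p) *
        pairing (gF j) (V j) (Q j) (prF j p) -
        pairing (gF j) (V j) (W j) (prF j p) *
        pairing (gF j) (U j) (Q j) (prF j p))) /\
  (* (8) *)
  (forall j k (p : M), j != k ->
     Rm (v U k) (v V j) (v W j) (v Q j) p = 0 /\
     Rm (v U k) (v V k) (v W j) (v Q j) p = 0) /\
  (* (9) *)
  (forall j k (p : M), j != k -> Rm (v U k) (v V j) (v W k) (v Q j) p =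
     f k (prB p) * f j (prB p) *
     bullet gB (differential (f k)) (differential (f j)) (prB p) *
     pairing (gF k) (U k) (W k) (prF k p) *
     pairing (gF j) (V j) (Q j) (prF j p)) /\
  (* (10) *)
  (forall k j a (p : M), k != j -> k != a -> j != a ->
     Rm (v U j) (v V j) (v W k) (v Q a) p = 0 /\
     Rm (v U j) (v V k) (v W j) (v Q a) p = 0) /\
  (* (11) *)
  (forall k j a c (p : M), uniq [:: k; j; a; c] ->
     Rm (v U j) (v V k) (v W a) (v Q c) p = 0).
Proof.
move=> M Rm b v.
have aB := manifold_smooth_atlas manB.
have aF j := manifold_smooth_atlas (manF j).
have bE A : b A = jfield A (fun=> zero_field) by exact: liftB_jfield.
have vE A i : v A i = jfield zero_field (concentrated i A).
  exact: liftF_concentrated.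
have z0 : vfield (zero_field : (B -> R) -> (B -> R)) by exact: (vfield0 aB).
have zF j : vfield (zero_field : (F j -> R) -> (F j -> R)) by exact: (vfield0 (aF j)).
have c0 i A (vA : forall j, vfield (A j)) := @vfield_concentrated R l F aF i A vA.
have base := riemann_base aB aF metB metF ndgB LCB srF smf.
have mixed := riemann_mixed aB aF metB metF ndgB LCB srF smf.
have fibre_base := riemann_fibre_base aB aF metB metF ndgB LCB srF smf.
have fibres := riemann_fibres aB aF metB metF ndgB LCB srF smf.
(* One base field followed by three fibre fields: the Hessians have a zero argument, whatever the
   indices. *)
have mixed0 A i j k (A1 A2 A3 : forall j, (F j -> R) -> (F j -> R)) p :
    vfield A -> (forall j, vfield (A1 j)) -> (forall j, vfield (A2 j)) ->
    (forall j, vfield (A3 j)) -> Rm (b A) (v A1 i) (v A2 j) (v A3 k) p = 0.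
  move=> vA v1 v2 v3; rewrite /Rm bE !vE mixed//; try exact: c0.
  by rewrite big1// => a _; rewrite !(hessian0r LCB)// !mul0r subrr mulr0.
have mixed2 j k p : Rm (b X) (v V j) (v W k) (b T) p =
    if j == k then - f j (prB p) * hessian nablaB (f j) X T (prB p) *
       pairing (gF j) (V j) (W j) (prF j p) else 0.
  rewrite /Rm !bE !vE mixed//; try exact: c0.
  rewrite (bigD1 j)//= big1 ?addr0 => [|a aj].
    rewrite (hessian0r LCB)// mul0r sub0r pairing_concentrated// eqxx /=.
    by case: eqP => _; rewrite ?mulr0 ?oppr0 ?mulr0// mulrN !mulNr mulrA.
  rewrite (hessian0r LCB)// pairing_concentrated// (negbTE aj) /=.
  by rewrite mul0r mulr0 subrr mulr0.
(* Two base fields in front and a fibre field last: only the base curvature could contribute, and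
   its last argument is the zero field. *)
have flat A A' C j p : vfield A -> vfield A' -> (forall j, vfield (C j)) ->
    forall X3 V3, vfield X3 -> (forall j, vfield (V3 j)) ->
    Rm (b A) (b A') (jfield X3 V3) (v C j) p = 0.
  move=> vA vA' vC X3 V3 v3 vV3; rewrite /Rm !bE vE base//; last exact: c0.
  by rewrite (riemann_eq0 aB metB)//; constructor 4.
split; first by move=> p; rewrite /Rm !bE base.
split.
  move=> j p; split; first by rewrite [b Z]bE flat.
  by rewrite [v W j]vE flat//; exact: c0.
split; first by move=> j p; rewrite mixed2 eqxx.
split.
  move=> j k p /negPf jk; split; rewrite ?mixed0//; last by rewrite mixed2 jk.
  by rewrite [v W j]vE flat//; exact: c0.
split; first by move=> j p; rewrite /Rm bE !vE fibre_base//; exact: c0.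
split; first by move=> *; exact: mixed0.
split.
  move=> j p; rewrite /Rm !vE fibres// !eqxx /=; congr (_ + _).
  rewrite -expr2; congr (_ * (_ - _)); exact: mulrC.
split.
  move=> j k p /negPf jk; have kj : (k == j) = false by rewrite eq_sym.
  by rewrite /Rm !vE !fibres// kj ?eqxx /= ?subrr ?mulr0 addr0.
split.
  move=> j k p /negPf jk; have kj : (k == j) = false by rewrite eq_sym.
  by rewrite /Rm !vE fibres// kj ?eqxx /= subr0 add0r mulrA.
split.
  move=> k j a p /negPf kj /negPf ka /negPf ja.
  have jk : (j == k) = false by rewrite eq_sym.
  by rewrite /Rm !vE !fibres// jk ja ?ka ?eqxx /= ?subrr ?mulr0 addr0.
move=> k j a c p /=; rewrite !inE !negb_or.
move=> /and4P[/and3P[/negPf kj /negPf ka /negPf kc] /andP[/negPf ja /negPf jc] _ _].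
have jk : (j == k) = false by rewrite eq_sym.
by rewrite /Rm !vE fibres// jk ja jc /= subrr mulr0 addr0.
Qed.
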